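(* The space $S(\mathbf I)$ of all continuous surjections from $\mathbf I=[0,1]$ onto itself, with the supremum metric, is homeomorphic to the separable Hilbert space $\ell_2$.
   Context: The supremum metric is $d(f,g)=\sup_{x\in\mathbf I}|f(x)-g(x)|$. *)

(* Defs.v *)
From Stdlib Require Import Reals.
From Coquelicot Require Import Coquelicot.
Open Scope R_scope.

Definition I01 : Type := {x : R | 0 <= x <= 1}.
Definition ival (x : I01) : R := proj1_sig x.

Definition I_continuous (f : I01 -> I01) : Prop :=
  forall x : I01, forall eps : R, 0 < eps ->
    exists delta : R, 0 < delta /\
      forall y : I01, Rabs (ival y - ival x) < delta ->
        Rabs (ival (f y) - ival (f x)) < eps.

Definition I_surjective (f : I01 -> I01) : Prop :=
  forall y : I01, exists x : I01, f x = y.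

Definition SI : Type := {f : I01 -> I01 | I_continuous f /\ I_surjective f}.

Definition sup_dist (f g : SI) : R :=
  real (Lub_Rbar (fun r : R => exists x : I01,
          r = Rabs (ival (proj1_sig f x) - ival (proj1_sig g x)))).

Definition l2 : Type := {x : nat -> R | ex_series (fun n => (x n) ^ 2)}.

Definition l2_dist (x y : l2) : R :=
  sqrt (Series (fun n => (proj1_sig x n - proj1_sig y n) ^ 2)).

Definition metric_continuous {A B : Type} (dA : A -> A -> R) (dB : B -> B -> R)
  (h : A -> B) : Prop :=
  forall a : A, forall eps : R, 0 < eps ->
    exists delta : R, 0 < delta /\
      forall a' : A, dA a a' < delta -> dB (h a) (h a') < eps.

Definition metric_homeomorphic {A B : Type} (dA : A -> A -> R) (dB : B -> B -> R)
  : Prop :=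
  exists (h : A -> B) (k : B -> A),
    (forall a, k (h a) = a) /\ (forall b, h (k b) = b) /\
    metric_continuous dA dB h /\ metric_continuous dB dA k.

(* Main.v *)
(* Let X be the space of continuous functions on [0,1] vanishing at 0, normed by the
   oscillation max - min.  Subtracting the value at 0 identifies the surjections of [0,1],
   that is, the functions with minimum 0 and maximum 1, with the unit sphere of X.

   "Isomorphic" below means homeomorphic by a norm-preserving, not necessarily linear map;
   such maps are compatible with l1-sums and restrict to unit spheres.
   1. X is isomorphic to l1, by Pelczynski's decomposition method: X is a factor of l1, as
      the image of an operator l1 -> X, and l1 is a factor of X, which contains a copy of
      it.  In both cases the complement is obtained from a continuous homogeneous
      (Bartle-Graves) selection, and a homogeneous homeomorphism is made norm-preserving
      by rescaling along rays.
   2. Hence X is isomorphic to l1, to R + l1 and to R + X, and so the sphere of X is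
      homeomorphic to the sphere of R + X.
   3. By stereographic projection the sphere of R + X is X with a point at infinity.
      Inversion moves that point to 0, and 0 is deleted by the non-complete norm trick
      x |-> x + r(|x|), where |.| is a weaker norm and r(t) is bounded in X and converges
      for the weaker norm, as t -> 0, to a point outside X.  As the displacement is
      bounded, the map extends to infinity.  So the sphere of R + X is homeomorphic to X.
   4. Signed square roots of the coordinates identify l1 with l2. *)

Require Import Defs.
From Stdlib Require Import Reals Lra Lia List Classical ClassicalEpsilon.
From Stdlib Require Import FunctionalExtensionality ProofIrrelevance Cantor.
From Coquelicot Require Import Coquelicot.
From mathcomp Require Import ssreflect.
Open Scope R_scope.

(** * Limits and series *)

(** Linear splittings are impossible: an infinite-dimensional complemented subspace of l1 is
    linearly isomorphic to l1, and X is not. Hence the nonlinear maps. They keep positive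
    homogeneity, and so norms can be preserved; this is what gives infinite sums of such maps a
    meaning. Continuity on sums then always comes down to dominated convergence with varying
    dominating series ([series_pratt]). The selection theorem is proved once, for a seminorm [p],
    and used twice: with the norm of X it splits l1 over X; with the distance to the copy of l1 it
    splits X over the quotient by that copy. The sphere of X has no preferred axis for a projection;
    the summand R provides one. Infinite dimension enters the last steps through the weaker norm: a
    finite-dimensional space admits only complete norms, and its sphere is not homeomorphic to a
    linear space. *)

Lemma lim_eps (u : nat -> R) (l : R) :
  is_lim_seq u l <->
  (forall eps, 0 < eps -> exists N, forall n, (N <= n)%nat -> Rabs (u n - l) < eps).
Proof.
  split; [move=> /is_lim_seq_Reals H eps He | move=> H; apply/is_lim_seq_Reals => eps He].
  - case: (H eps He) => N HN; exists N => n Hn; exact: HN.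
  - case: (H eps He) => N HN; exists N => n Hn; exact: HN.
Qed.

Lemma lim_squeeze (u v : nat -> R) (l : R) (N : nat) :
  (forall k, (N <= k)%nat -> Rabs (u k - l) <= v k) -> is_lim_seq v 0 -> is_lim_seq u l.
Proof.
  move=> Huv /lim_eps Hv; apply/lim_eps => eps He.
  case: (Hv eps He) => M HM; exists (Nat.max N M) => n Hn.
  have := Huv n ltac:(lia); have := HM n ltac:(lia).
  rewrite Rminus_0_r => /Rabs_def2 [? ?]; lra.
Qed.

Lemma lim_dist (u : nat -> R) (l : R) :
  is_lim_seq u l <-> is_lim_seq (fun k => Rabs (u k - l)) 0.
Proof.
  split => H.
  - rewrite -(Rabs_R0); apply: (is_lim_seq_abs _ 0).
    replace (Finite 0) with (Finite (l - l)) by (f_equal; ring).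
    apply: is_lim_seq_minus'; [exact: H | exact: is_lim_seq_const].
  - apply: (lim_squeeze _ _ _ 0 _ H) => k _; lra.
Qed.

Lemma lim_plus0 (u v : nat -> R) :
  is_lim_seq u 0 -> is_lim_seq v 0 -> is_lim_seq (fun k => u k + v k) 0.
Proof.
  move=> Hu Hv; replace (Finite 0) with (Finite (0 + 0)) by (f_equal; ring).
  exact: is_lim_seq_plus'.
Qed.

Lemma lim_scal0 (c : R) (u : nat -> R) :
  is_lim_seq u 0 -> is_lim_seq (fun k => c * u k) 0.
Proof.
  move=> Hu; replace (Finite 0) with (Rbar_mult c 0) by (simpl; f_equal; ring).
  exact: is_lim_seq_scal_l.
Qed.

Lemma lim_geom0 (c : R) : is_lim_seq (fun k => c * (/ 2) ^ k) 0.
Proof.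
  apply: lim_scal0; apply: is_lim_seq_geom; rewrite Rabs_pos_eq; lra.
Qed.

Lemma lim_eventually_gt (u : nat -> R) (l c : R) :
  is_lim_seq u l -> c < l -> exists N, forall n, (N <= n)%nat -> c < u n.
Proof.
  move=> /lim_eps H Hc; case: (H (l - c)); first lra.
  move=> N HN; exists N => n Hn; have /Rabs_def2 := HN n Hn; lra.
Qed.

Lemma lim_ge0 (c : nat -> R) (d : R) : (forall k, 0 <= c k) -> is_lim_seq c d -> 0 <= d.
Proof. move=> Hc L; exact (is_lim_seq_le (fun _ => 0) c 0 d Hc (is_lim_seq_const 0) L). Qed.

Lemma le_of_lim (a b : R) (v : nat -> R) :
  (forall k, a <= b + v k) -> is_lim_seq v 0 -> a <= b.
Proof.
  move=> H /lim_eps Hv; apply: Rnot_lt_le => Hab.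
  case: (Hv (a - b)); first lra.
  move=> N HN; have := HN N (Nat.le_refl N); have := H N.
  move=> ? /Rabs_def2; lra.
Qed.

(* [real] sends an infinite least upper bound to [0]: the lemmas need a bounded,
   nonempty family. *)
Definition supr {T : Type} (f : T -> R) : R :=
  real (Lub_Rbar (fun r => exists x, r = f x)).

Definition bounded_above {T : Type} (f : T -> R) : Prop :=
  exists M, forall x, f x <= M.

Lemma supr_ub {T : Type} (f : T -> R) :
  bounded_above f -> forall x, f x <= supr f.
Proof.
  move=> [M HM] x; rewrite /supr.
  have [H1 H2] := Lub_Rbar_correct (fun r => exists x, r = f x).
  have Hx := H1 (f x) (ex_intro _ x (Logic.eq_refl _)).
  have := H2 (Finite M); have HM' : is_ub_Rbar (fun r => exists x, r = f x) M.
    by move=> r [y ->]; exact: HM.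
  move=> /(_ HM'); by case: (Lub_Rbar _) Hx.
Qed.

Lemma supr_le {T : Type} (f : T -> R) (x0 : T) (M : R) :
  (forall x, f x <= M) -> supr f <= M.
Proof.
  move=> HM; rewrite /supr.
  have [H1 H2] := Lub_Rbar_correct (fun r => exists x, r = f x).
  have Hx := H1 (f x0) (ex_intro _ x0 (Logic.eq_refl _)).
  have := H2 (Finite M); have HM' : is_ub_Rbar (fun r => exists x, r = f x) M.
    by move=> r [y ->]; exact: HM.
  move=> /(_ HM'); by case: (Lub_Rbar _) Hx.
Qed.

Lemma supr_approx {T : Type} (f : T -> R) (x0 : T) (c : R) :
  c < supr f -> exists x, c < f x.
Proof.
  move=> Hc; apply: NNPP => Hn; suff: supr f <= c by lra.
  apply: (supr_le f x0) => x; apply: Rnot_lt_le => Hx; apply: Hn; by exists x.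
Qed.

Lemma supr_ext {T : Type} (f g : T -> R) : (forall x, f x = g x) -> supr f = supr g.
Proof. by move=> H; have -> : f = g by apply: functional_extensionality. Qed.

Lemma series_lim (a : nat -> R) : ex_series a -> is_lim_seq (sum_n a) (Series a).
Proof. exact: Series_correct. Qed.

Lemma series_pos_partial (a : nat -> R) (N : nat) :
  (forall n, 0 <= a n) -> ex_series a -> sum_n a N <= Series a.
Proof.
  move=> Ha Hs; have H := series_lim a Hs.
  apply: (is_lim_seq_incr_compare (sum_n a)); first exact: H.
  move=> n; rewrite sum_Sn /plus /=; have := Ha (S n); lra.
Qed.

Lemma series_pos_bound (a : nat -> R) (M : R) :
  (forall n, 0 <= a n) -> (forall N, sum_n a N <= M) ->
  ex_series a /\ Series a <= M.
Proof.
  move=> Ha HM.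
  have Hex : ex_finite_lim_seq (sum_n a).
    apply: (ex_finite_lim_seq_incr _ M) => // n.
    rewrite sum_Sn /plus /=; have := Ha (S n); lra.
  have Hs : ex_series a by case: Hex => l Hl; exists l.
  split => //; have H := series_lim a Hs.
  have := is_lim_seq_le (sum_n a) (fun _ => M) (Series a) M HM H (is_lim_seq_const M).
  by [].
Qed.

Lemma series_pos_ge0 (a : nat -> R) :
  (forall n, 0 <= a n) -> ex_series a -> 0 <= Series a.
Proof.
  move=> Ha Hs; have := series_pos_partial a 0 Ha Hs.
  rewrite sum_O; have := Ha O; lra.
Qed.

Lemma series_pos_term (a : nat -> R) (n : nat) :
  (forall n, 0 <= a n) -> ex_series a -> a n <= Series a.
Proof.
  move=> Ha Hs; apply: Rle_trans (series_pos_partial a n Ha Hs).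
  case: n => [|n]; first by rewrite sum_O; right.
  rewrite sum_Sn /plus /=.
  have : 0 <= sum_n a n by elim: n => [|n IH]; rewrite ?sum_O // sum_Sn /plus /=; have := Ha (S n); lra.
  lra.
Qed.

Lemma ex_series_le_pos (a b : nat -> R) :
  (forall n, 0 <= a n <= b n) -> ex_series b -> ex_series a.
Proof.
  move=> H Hb; apply: (ex_series_le a b) => // n.
  rewrite /norm /= /abs /= Rabs_pos_eq; by case: (H n).
Qed.

Lemma ex_series_eq (a b : nat -> R) : (forall n, a n = b n :> R) -> ex_series a -> ex_series b.
Proof. exact: ex_series_ext. Qed.

Lemma half_pow_pos (n : nat) : 0 < (/ 2) ^ n.
Proof. apply: pow_lt; lra. Qed.

Lemma half_pow_series : ex_series (fun n => (/ 2) ^ n).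
Proof. apply: ex_series_geom; rewrite Rabs_pos_eq; lra. Qed.

Lemma ex_series_const0 : ex_series (fun _ : nat => 0).
Proof. exists 0; apply: filterlim_ext (filterlim_const 0) => n; by rewrite sum_n_const Rmult_0_r. Qed.

Lemma series_const0 : Series (fun _ : nat => 0) = 0.
Proof.
  apply: is_series_unique; apply: filterlim_ext (filterlim_const 0) => n.
  by rewrite sum_n_const Rmult_0_r.
Qed.

Lemma lim_sum_n (f : nat -> nat -> R) (g : nat -> R) (N : nat) :
  (forall i, is_lim_seq (fun k => f k i) (g i)) ->
  is_lim_seq (fun k => sum_n (f k) N) (sum_n g N).
Proof.
  move=> H; elim: N => [|N IH].
  - rewrite sum_O; apply: is_lim_seq_ext (H O) => k; by rewrite sum_O.
  - rewrite sum_Sn; apply: is_lim_seq_ext (is_lim_seq_plus' _ _ _ _ IH (H (S N))) => k.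
    by rewrite sum_Sn.
Qed.

(** A partial sum of [g] carries the series up to [eps / 2]; the same partial sum of [f k] converges
    to it and, by positivity, is a lower bound for the whole series of [f k]. *)
Lemma series_fatou (f : nat -> nat -> R) (g : nat -> R) (eps : R) :
  (forall k i, 0 <= f k i) -> (forall k, ex_series (f k)) -> ex_series g ->
  (forall i, is_lim_seq (fun k => f k i) (g i)) -> 0 < eps ->
  exists K, forall k, (K <= k)%nat -> Series g - eps < Series (f k).
Proof.
  move=> Hf Hs Hg Hlim He.
  have /lim_eps /(_ (eps / 2)) := series_lim g Hg.
  case=> [|N HN]; first lra.
  have /lim_eps /(_ (eps / 2)) := lim_sum_n f g N Hlim.
  case=> [|K HK]; first lra.
  exists K => k Hk.
  have := HN N (Nat.le_refl N); have := HK k Hk.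
  have := series_pos_partial (f k) N (Hf k) (Hs k).
  move=> ? /Rabs_def2 [? ?] /Rabs_def2 [? ?]; lra.
Qed.

(* Dominated convergence with varying dominating series: Fatou for both [g] and [G - g]. *)
Lemma series_pratt (g G : nat -> nat -> R) (g0 G0 : nat -> R) :
  (forall k i, 0 <= g k i <= G k i) ->
  (forall k, ex_series (G k)) -> ex_series G0 ->
  (forall i, is_lim_seq (fun k => g k i) (g0 i)) ->
  (forall i, is_lim_seq (fun k => G k i) (G0 i)) ->
  is_lim_seq (fun k => Series (G k)) (Series G0) ->
  ex_series g0 /\ is_lim_seq (fun k => Series (g k)) (Series g0).
Proof.
  move=> Hg HG HG0 Lg LG LS.
  have Hg0 i : 0 <= g0 i <= G0 i.
    split.
    - apply: (is_lim_seq_le (fun _ => 0) (fun k => g k i) 0 (g0 i)) => //.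
        by move=> n; case: (Hg n i).
      exact: is_lim_seq_const.
    - apply: (is_lim_seq_le (fun k => g k i) (fun k => G k i) (g0 i) (G0 i)) => // n.
      by case: (Hg n i).
  have Eg k : ex_series (g k) by apply: ex_series_le_pos (HG k); exact: Hg.
  have Eg0 : ex_series g0 by apply: ex_series_le_pos HG0.
  split => //; apply/lim_eps => eps He.
  have [K1 HK1] := series_fatou g g0 eps (fun k i => proj1 (Hg k i)) Eg Eg0 Lg He.
  have [] := series_fatou (fun k i => G k i - g k i) (fun i => G0 i - g0 i) (eps / 2).
  - move=> k i; case: (Hg k i); lra.
  - move=> k; exact: (ex_series_minus (G k) (g k)).
  - exact: (ex_series_minus G0 g0).
  - move=> i; exact: is_lim_seq_minus'.
  - lra.
  move=> K2 HK2.
  move/lim_eps: LS => /(_ (eps / 2)) [|K3 HK3]; first lra.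
  exists (Nat.max K1 (Nat.max K2 K3)) => k Hk.
  have := HK1 k ltac:(lia); have := HK2 k ltac:(lia); have := HK3 k ltac:(lia).
  rewrite !Series_minus // => /Rabs_def2 [? ?] ? ?.
  apply: Rabs_def1; lra.
Qed.

Lemma sum_n_scal (c : R) (a : nat -> R) (N : nat) :
  sum_n (fun n => c * a n) N = c * sum_n a N.
Proof.
  elim: N => [|N IH]; first by rewrite !sum_O.
  rewrite !sum_Sn IH /plus /=; ring.
Qed.

(** * Double series of nonnegative terms along the Cantor enumeration *)

Definition lsum {T : Type} (f : T -> R) (l : list T) : R :=
  fold_right (fun x s => f x + s) 0 l.

Lemma lsum_app {T : Type} (f : T -> R) (l m : list T) :
  lsum f (l ++ m) = lsum f l + lsum f m.
Proof. elim: l => [|x l IH] /=; [lra | rewrite IH; lra]. Qed.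

Lemma lsum_ge0 {T : Type} (f : T -> R) (l : list T) :
  (forall x, 0 <= f x) -> 0 <= lsum f l.
Proof. move=> Hf; elim: l => [|x l IH] /=; [lra | have := Hf x; lra]. Qed.

Lemma lsum_le {T : Type} (f g : T -> R) (l : list T) :
  (forall x, f x <= g x) -> lsum f l <= lsum g l.
Proof. move=> H; elim: l => [|x l IH] /=; [lra | have := H x; lra]. Qed.

(** Each element of [l] is struck out of [m] once; [NoDup l] keeps the later elements in what
    remains. This compares finite pieces of two different enumerations of the same index set. *)
Lemma lsum_incl {T : Type} (f : T -> R) (l m : list T) :
  (forall x, 0 <= f x) -> NoDup l -> incl l m -> lsum f l <= lsum f m.
Proof.
  move=> Hf; elim: l m => [|x l IH] m Hl Hm /=; first exact: lsum_ge0.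
  have [m1 [m2 Em]] := in_split x m (Hm x (or_introl (Logic.eq_refl _))).
  inversion Hl; subst.
  have : lsum f l <= lsum f (m1 ++ m2).
    apply: IH => // y Hy; have := Hm y (or_intror Hy).
    rewrite !in_app_iff /=; case=> [?|[Exy|?]]; [by left | by subst | by right].
  rewrite !lsum_app /=; lra.
Qed.

Lemma lsum_map {T U : Type} (f : U -> R) (h : T -> U) (l : list T) :
  lsum f (map h l) = lsum (fun x => f (h x)) l.
Proof. by elim: l => [|x l IH] //=; rewrite IH. Qed.

Lemma lsum_seq (f : nat -> R) (N : nat) : lsum f (seq 0 (S N)) = sum_n f N.
Proof.
  elim: N => [|N IH]; first by rewrite sum_O /=; lra.
  rewrite seq_S lsum_app IH sum_Sn /= /plus /=; lra.
Qed.

Lemma lsum_prod (f : nat * nat -> R) (I J : list nat) :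
  lsum f (list_prod I J) = lsum (fun i => lsum (fun j => f (i, j)) J) I.
Proof. elim: I => [|i I IH] //=; by rewrite lsum_app lsum_map IH. Qed.

Lemma NoDup_prod {T U : Type} (l : list T) (m : list U) :
  NoDup l -> NoDup m -> NoDup (list_prod l m).
Proof.
  move=> Hl Hm; elim: l Hl => [|x l IH] Hl /=; first exact: NoDup_nil.
  inversion Hl; subst; apply: NoDup_app.
  - apply: NoDup_map_NoDup_ForallPairs => // y z _ _ E; by inversion E.
  - exact: IH.
  - move=> p /in_map_iff [y [<- _]] /in_prod_iff [? _]; contradiction.
Qed.

Lemma NoDup_of_nat (n : nat) : NoDup (map of_nat (seq 0 n)).
Proof.
  apply: NoDup_map_NoDup_ForallPairs; last exact: seq_NoDup.
  move=> x y _ _ Hxy; by rewrite -(cancel_to_of x) -(cancel_to_of y) Hxy.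
Qed.

Lemma list_nat_bounded (l : list nat) : exists N, incl l (seq 0 (S N)).
Proof.
  elim: l => [|x l [N HN]]; first by exists O => y [].
  exists (Nat.max x N) => y [->|/HN]; rewrite !in_seq; lia.
Qed.

(** One bound serves both exhaustions of the pairs, by squares and by initial segments of the
    enumeration, so that each can be trapped in the other. *)
Lemma list_pair_bounded (l : list (nat * nat)) :
  exists N, incl l (list_prod (seq 0 (S N)) (seq 0 (S N))) /\
            incl l (map of_nat (seq 0 (S N))).
Proof.
  have [N1 H1] := list_nat_bounded (map fst l).
  have [N2 H2] := list_nat_bounded (map snd l).
  have [N3 H3] := list_nat_bounded (map to_nat l).
  exists (Nat.max N1 (Nat.max N2 N3)); split=> -[i j] Hij.
  - apply: in_prod.
    + have := H1 _ (in_map fst _ _ Hij); rewrite !in_seq /=; lia.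
    + have := H2 _ (in_map snd _ _ Hij); rewrite !in_seq /=; lia.
  - rewrite -(cancel_of_to (i, j)); apply: in_map.
    have := H3 _ (in_map to_nat _ _ Hij); rewrite !in_seq; lia.
Qed.

Lemma sum_n_lim_bound (f : nat -> nat -> R) (I : nat) (M : R) :
  (forall i, ex_series (f i)) -> (forall J, sum_n (fun i => sum_n (f i) J) I <= M) ->
  sum_n (fun i => Series (f i)) I <= M.
Proof.
  move=> Hf HM.
  have H : is_lim_seq (fun J => sum_n (fun i => sum_n (f i) J) I) (sum_n (fun i => Series (f i)) I).
    apply: lim_sum_n => i; exact: (series_lim _ (Hf i)).
  exact: (is_lim_seq_le _ (fun _ => M) _ M HM H (is_lim_seq_const M)).
Qed.

(** One half of Tonelli: every rectangle lies in an initial segment of the enumeration. The columns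
    are sent to infinity first, then the rows. Equality of the sums is left to
    [series_unflatten]. *)
Lemma series_flatten (f : nat * nat -> R) :
  (forall p, 0 <= f p) ->
  ex_series (fun n => f (of_nat n)) ->
  (forall i, ex_series (fun j => f (i, j))) /\
  ex_series (fun i => Series (fun j => f (i, j))) /\
  Series (fun i => Series (fun j => f (i, j))) <= Series (fun n => f (of_nat n)).
Proof.
  move=> Hf Hs.
  have Hsq I J : sum_n (fun i => sum_n (fun j => f (i, j)) J) I <= Series (fun n => f (of_nat n)).
    have [N [_ HN]] := list_pair_bounded (list_prod (seq 0 (S I)) (seq 0 (S J))).
    apply: Rle_trans (series_pos_partial _ N (fun n => Hf _) Hs).
    rewrite -!lsum_seq -lsum_map.
    have -> : (fun i => sum_n (fun j => f (i, j)) J) = (fun i => lsum (fun j => f (i, j)) (seq 0 (S J))).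
      by apply: functional_extensionality => i; rewrite lsum_seq.
    rewrite -lsum_prod; apply: lsum_incl => //.
    apply: NoDup_prod; exact: seq_NoDup.
  have Hrow i : ex_series (fun j => f (i, j)).
    have [] := series_pos_bound (fun j => f (i, j)) (Series (fun n => f (of_nat n))) (fun j => Hf _) => // J.
    apply: Rle_trans (Hsq i J).
    case: i => [|i]; first by rewrite sum_O; right.
    rewrite sum_Sn /plus /= -lsum_seq -[X in _ <= X + _]lsum_seq.
    have : 0 <= lsum (fun i => sum_n (fun j => f (i, j)) J) (seq 0 (S i)).
      apply: lsum_ge0 => i'; rewrite -lsum_seq; apply: lsum_ge0 => j; exact: Hf.
    lra.
  split => //; apply: series_pos_bound.
  - by move=> i; apply: series_pos_ge0.
  - move=> I; apply: sum_n_lim_bound => // J; exact: Hsq.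
Qed.

(** The other half of Tonelli: an initial segment lies in a square, whose sum is at most the
    iterated series. The reverse inequality is [series_flatten]. *)
Lemma series_unflatten (f : nat * nat -> R) :
  (forall p, 0 <= f p) ->
  (forall i, ex_series (fun j => f (i, j))) ->
  ex_series (fun i => Series (fun j => f (i, j))) ->
  ex_series (fun n => f (of_nat n)) /\
  Series (fun n => f (of_nat n)) = Series (fun i => Series (fun j => f (i, j))).
Proof.
  move=> Hf Hrow Hs.
  have [] := series_pos_bound (fun n => f (of_nat n)) (Series (fun i => Series (fun j => f (i, j)))).
  - by move=> n.
  - move=> N.
    have [M [HM _]] := list_pair_bounded (map of_nat (seq 0 (S N))).
    rewrite -lsum_seq -lsum_map.
    apply: Rle_trans (lsum_incl _ _ _ Hf (NoDup_of_nat _) HM) _.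
    rewrite lsum_prod lsum_seq.
    apply: Rle_trans (series_pos_partial _ M _ Hs); last by move=> i; apply: series_pos_ge0.
    rewrite -!lsum_seq; apply: lsum_le => i; rewrite lsum_seq.
    exact: series_pos_partial.
  move=> H1 H2; split => //; apply: Rle_antisym => //.
  by have [_ [_]] := series_flatten f Hf H1.
Qed.

(** * Normed convergence spaces and their l1-sums *)

Lemma sig_ext {T : Type} (P : T -> Prop) (x y : {t | P t}) :
  proj1_sig x = proj1_sig y -> x = y.
Proof. case: x y => [x Hx] [y Hy] /= E; subst; f_equal; exact: proof_irrelevance. Qed.

Lemma pair_ext {A B : Type} (z w : A * B) : fst z = fst w -> snd z = snd w -> z = w.
Proof. by case: z w => [a b] [c d] /= -> ->. Qed.

(** Topology enters only through convergent sequences; at the two ends, for [sup_dist] and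
    [l2_dist], [metric_continuous_of_seq] goes back to epsilon and delta. *)
Record cspace := CSpace { cpt :> Type; cv : (nat -> cpt) -> cpt -> Prop }.
Arguments cv {_} _ _.

Definition seq_cont {A B : cspace} (f : A -> B) : Prop :=
  forall u x, cv u x -> cv (fun k => f (u k)) (f x).

Definition homeo (A B : cspace) : Prop :=
  exists (f : A -> B) (g : B -> A),
    (forall a, g (f a) = a) /\ (forall b, f (g b) = b) /\ seq_cont f /\ seq_cont g.

Lemma homeo_trans (A B C : cspace) : homeo A B -> homeo B C -> homeo A C.
Proof.
  move=> [f [g [H1 [H2 [H3 H4]]]]] [f' [g' [H1' [H2' [H3' H4']]]]].
  exists (fun a => f' (f a)), (fun c => g (g' c)); split; [|split; [|split]].
  - by move=> a; rewrite H1' H1.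
  - by move=> c; rewrite H2 H2'.
  - by move=> u x /H3 /H3'.
  - by move=> u x /H4' /H4.
Qed.

Record nspace := NSpace {
  ncs :> cspace;
  pn : ncs -> R;
  pn_ge0 : forall x, 0 <= pn x;
  pn_cont : forall u x, cv u x -> is_lim_seq (fun k => pn (u k)) (pn x) }.
Arguments pn {_} _.
Arguments pn_ge0 {_} _.
Arguments pn_cont {_} _ _ _.

Definition iso (A B : nspace) : Prop :=
  exists (f : A -> B) (g : B -> A),
    (forall a, g (f a) = a) /\ (forall b, f (g b) = b) /\ seq_cont f /\ seq_cont g /\
    (forall a, pn (f a) = pn a).

Lemma iso_refl (A : nspace) : iso A A.
Proof. by exists (fun a => a), (fun a => a); do !split. Qed.

Lemma iso_sym (A B : nspace) : iso A B -> iso B A.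
Proof.
  move=> [f [g [H1 [H2 [H3 [H4 H5]]]]]]; exists g, f; repeat split => //.
  by move=> b; rewrite -{2}(H2 b) H5.
Qed.

Lemma iso_trans (A B C : nspace) : iso A B -> iso B C -> iso A C.
Proof.
  move=> [f [g [H1 [H2 [H3 [H4 H5]]]]]] [f' [g' [H1' [H2' [H3' [H4' H5']]]]]].
  exists (fun a => f' (f a)), (fun c => g (g' c)); repeat split.
  - by move=> a; rewrite H1' H1.
  - by move=> c; rewrite H2 H2'.
  - by move=> u x /H3 /H3'.
  - by move=> u x /H4' /H4.
  - by move=> a; rewrite H5' H5.
Qed.

Lemma iso_homeo (A B : nspace) : iso A B -> homeo A B.
Proof. by move=> [f [g [H1 [H2 [H3 [H4 _]]]]]]; exists f, g. Qed.

Definition sphere (A : nspace) : cspace :=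
  CSpace {x : A | pn x = 1} (fun u x => cv (fun k => proj1_sig (u k)) (proj1_sig x)).

Lemma iso_sphere (A B : nspace) : iso A B -> homeo (sphere A) (sphere B).
Proof.
  move=> /[dup] /iso_sym [f' [g' [_ [_ [_ [_ H5']]]]]] [f [g [H1 [H2 [H3 [H4 H5]]]]]].
  have Hf (a : sphere A) : pn (f (proj1_sig a)) = 1 by rewrite H5; exact: proj2_sig a.
  have Hg (b : sphere B) : pn (g (proj1_sig b)) = 1 by rewrite -H5 H2; exact: proj2_sig b.
  exists (fun a => exist _ _ (Hf a) : sphere B), (fun b => exist _ _ (Hg b) : sphere A).
  split; [|split; [|split]].
  - by move=> a; apply: sig_ext; rewrite /= H1.
  - by move=> b; apply: sig_ext; rewrite /= H2.
  - by move=> u x /H3.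
  - by move=> u x /H4.
Qed.

Definition nsub (A : nspace) (P : A -> Prop) : nspace.
Proof.
  refine (NSpace (CSpace {x : A | P x} (fun u x => cv (fun k => proj1_sig (u k)) (proj1_sig x)))
    (fun x => pn (proj1_sig x)) (fun x => pn_ge0 _) _).
  move=> u x; exact: pn_cont.
Defined.

Definition realn : nspace.
Proof.
  refine (NSpace (CSpace R (fun u x => is_lim_seq u x)) Rabs Rabs_pos _).
  move=> u x /= H; exact: (is_lim_seq_abs u x).
Defined.

Definition dprod (A B : nspace) : nspace.
Proof.
  refine (NSpace (CSpace (A * B) (fun u x => cv (fun k => fst (u k)) (fst x) /\
                                              cv (fun k => snd (u k)) (snd x)))
    (fun x => pn (fst x) + pn (snd x)) _ _).
  - move=> x; have := pn_ge0 (fst x); have := pn_ge0 (snd x); lra.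
  - move=> u x [/= H1 H2]; apply: is_lim_seq_plus'; exact: pn_cont.
Defined.

(* This notion of convergence only involves [cv] and [pn] of the summands, so that every
   [iso] extends to sums; for [realn] it is convergence in norm, by [cv_l1]. *)
Definition dsum (A : nspace) : nspace.
Proof.
  refine (NSpace (CSpace {x : nat -> A | ex_series (fun i => pn (x i))}
     (fun u x => (forall i, cv (fun k => proj1_sig (u k) i) (proj1_sig x i)) /\
        is_lim_seq (fun k => Series (fun i => pn (proj1_sig (u k) i)))
                   (Series (fun i => pn (proj1_sig x i)))))
    (fun x => Series (fun i => pn (proj1_sig x i))) _ _).
  - move=> [x Hx] /=; apply: series_pos_ge0 => // i; exact: pn_ge0.
  - by move=> u x [].
Defined.

Lemma iso_dprod (A B A' B' : nspace) : iso A A' -> iso B B' -> iso (dprod A B) (dprod A' B').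
Proof.
  move=> [f [g [H1 [H2 [H3 [H4 H5]]]]]] [f' [g' [H1' [H2' [H3' [H4' H5']]]]]].
  exists (fun x => (f (fst x), f' (snd x)) : dprod A' B').
  exists (fun x => (g (fst x), g' (snd x)) : dprod A B); repeat split.
  - by move=> [a b] /=; rewrite H1 H1'.
  - by move=> [a b] /=; rewrite H2 H2'.
  - by case: H => /= /H3.
  - by case: H => /= _ /H3'.
  - by case: H => /= /H4.
  - by case: H => /= _ /H4'.
  - by move=> [a b] /=; rewrite H5 H5'.
Qed.

Lemma iso_dprodC (A B : nspace) : iso (dprod A B) (dprod B A).
Proof.
  exists (fun x => (snd x, fst x) : dprod B A), (fun x => (snd x, fst x) : dprod A B).
  repeat split => /=; try by case.
  all: try by case: H.
  by move=> [a b] /=; ring.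
Qed.

Lemma iso_dprodA (A B C : nspace) : iso (dprod A (dprod B C)) (dprod (dprod A B) C).
Proof.
  exists (fun x => ((fst x, fst (snd x)), snd (snd x)) : dprod (dprod A B) C).
  exists (fun x => (fst (fst x), (snd (fst x), snd x)) : dprod A (dprod B C)).
  split; [by move=> [a [b c]] | split; [by move=> [[a b] c] | split; [|split]]].
  - by move=> u x [? [? ?]].
  - by move=> u x [[? ?] ?].
  - by move=> [a [b c]] /=; ring.
Qed.

Lemma iso_dsum (A B : nspace) : iso A B -> iso (dsum A) (dsum B).
Proof.
  move=> [f [g [H1 [H2 [H3 [H4 H5]]]]]].
  have H6 b : pn (g b) = pn b by rewrite -{2}(H2 b) H5.
  have Hf (x : dsum A) : ex_series (fun i => pn (f (proj1_sig x i))).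
    by apply: ex_series_ext (proj2_sig x) => i; rewrite H5.
  have Hg (x : dsum B) : ex_series (fun i => pn (g (proj1_sig x i))).
    by apply: ex_series_ext (proj2_sig x) => i; rewrite H6.
  have Ef (x : dsum A) : Series (fun i => pn (f (proj1_sig x i))) = Series (fun i => pn (proj1_sig x i)).
    by apply: Series_ext => i; rewrite H5.
  have Eg (x : dsum B) : Series (fun i => pn (g (proj1_sig x i))) = Series (fun i => pn (proj1_sig x i)).
    by apply: Series_ext => i; rewrite H6.
  exists (fun x => exist _ (fun i => f (proj1_sig x i)) (Hf x) : dsum B).
  exists (fun x => exist _ (fun i => g (proj1_sig x i)) (Hg x) : dsum A).
  split; [|split; [|split; [|split]]].
  - by move=> x; apply: sig_ext; apply: functional_extensionality => i /=; rewrite H1.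
  - by move=> x; apply: sig_ext; apply: functional_extensionality => i /=; rewrite H2.
  - move=> u x [Hc Hs]; split => /=; first by move=> i; exact: H3.
    by rewrite Ef; apply: is_lim_seq_ext Hs => k; rewrite Ef.
  - move=> u x [Hc Hs]; split => /=; first by move=> i; exact: H4.
    by rewrite Eg; apply: is_lim_seq_ext Hs => k; rewrite Eg.
  - exact: Ef.
Qed.

Lemma iso_dsum_cons (A : nspace) : iso (dprod A (dsum A)) (dsum A).
Proof.
  pose cons (x : dprod A (dsum A)) i := match i with O => fst x | S j => proj1_sig (snd x) j end.
  have Hcons x : ex_series (fun i => pn (cons x i)).
    by apply/(ex_series_incr_1 (fun i => pn (cons x i))); exact: proj2_sig (snd x).
  have Htl (x : dsum A) : ex_series (fun i => pn (proj1_sig x (S i))).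
    exact: (proj1 (ex_series_incr_1 (fun i => pn (proj1_sig x i))) (proj2_sig x)).
  have Es x : Series (fun i => pn (cons x i)) = pn x.
    by rewrite (Series_incr_1 (fun i => pn (cons x i))).
  exists (fun x => exist _ (cons x) (Hcons x) : dsum A).
  exists (fun x => (proj1_sig x O, exist _ (fun i => proj1_sig x (S i)) (Htl x)) : dprod A (dsum A)).
  split; [|split; [|split; [|split]]].
  - by move=> [a x] /=; congr (_, _); apply: sig_ext.
  - by move=> x; apply: sig_ext; apply: functional_extensionality => -[|i].
  - move=> u x Hu; split => /=; first by case: Hu => Ha [Hb _] [|i] /=.
    rewrite Es; apply: is_lim_seq_ext (pn_cont _ _ Hu) => k; by rewrite Es.
  - move=> u x [Hc Hs]; split => //=; split => //=.
    have E (y : dsum A) : Series (fun i => pn (proj1_sig y (S i))) =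
        Series (fun i => pn (proj1_sig y i)) - pn (proj1_sig y O).
      by rewrite [in RHS]Series_incr_1 //; [ring | exact: proj2_sig y].
    rewrite E; apply: (is_lim_seq_ext (fun k => Series (fun i => pn (proj1_sig (u k) i)) - pn (proj1_sig (u k) O))).
      by move=> k; rewrite E.
    apply: is_lim_seq_minus' => //; exact: pn_cont.
  - exact: Es.
Qed.

Lemma fst_bound (a b : R) : 0 <= a -> 0 <= b -> 0 <= a <= a + b.
Proof. by move=> Ha Hb; split; lra. Qed.

Lemma snd_bound (a b : R) : 0 <= a -> 0 <= b -> 0 <= b <= a + b.
Proof. by move=> Ha Hb; split; lra. Qed.

(** The delicate direction is the splitting: only the total of the two norms is known to converge.
    Each part is dominated term by term by that total, so [series_pratt] gives its convergence
    separately. *)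
Lemma iso_dsum_dprod (A B : nspace) : iso (dsum (dprod A B)) (dprod (dsum A) (dsum B)).
Proof.
  have H1 (x : dsum (dprod A B)) : ex_series (fun i => pn (fst (proj1_sig x i))).
    apply: ex_series_le_pos (proj2_sig x) => i; exact: fst_bound (pn_ge0 _) (pn_ge0 _).
  have H2 (x : dsum (dprod A B)) : ex_series (fun i => pn (snd (proj1_sig x i))).
    apply: ex_series_le_pos (proj2_sig x) => i; exact: snd_bound (pn_ge0 _) (pn_ge0 _).
  have H3 (x : dprod (dsum A) (dsum B)) :
      ex_series (fun i => pn ((proj1_sig (fst x) i, proj1_sig (snd x) i) : dprod A B)).
    exact: (ex_series_plus _ _ (proj2_sig (fst x)) (proj2_sig (snd x))).
  exists (fun x => (exist _ (fun i => fst (proj1_sig x i)) (H1 x),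
                    exist _ (fun i => snd (proj1_sig x i)) (H2 x)) : dprod (dsum A) (dsum B)).
  exists (fun x => exist _ (fun i => (proj1_sig (fst x) i, proj1_sig (snd x) i)) (H3 x) : dsum (dprod A B)).
  split; [|split; [|split; [|split]]].
  - move=> x; apply: sig_ext; apply: functional_extensionality => i /=; by case: (proj1_sig x i).
  - by move=> [x y]; congr (_, _); apply: sig_ext.
  - move=> u x [Hc Hs]; split; split => /=; try by move=> i; case: (Hc i).
    + apply: (proj2 (series_pratt (fun k i => pn (fst (proj1_sig (u k) i)))
        (fun k i => pn (proj1_sig (u k) i)) _ (fun i => pn (proj1_sig x i)) _ _ _ _ _ Hs)).
      * move=> k i; exact: fst_bound (pn_ge0 _) (pn_ge0 _).
      * move=> k; exact: proj2_sig (u k).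
      * exact: proj2_sig x.
      * move=> i; apply: pn_cont; by case: (Hc i).
      * move=> i; apply: pn_cont; exact: Hc.
    + apply: (proj2 (series_pratt (fun k i => pn (snd (proj1_sig (u k) i)))
        (fun k i => pn (proj1_sig (u k) i)) _ (fun i => pn (proj1_sig x i)) _ _ _ _ _ Hs)).
      * move=> k i; exact: snd_bound (pn_ge0 _) (pn_ge0 _).
      * move=> k; exact: proj2_sig (u k).
      * exact: proj2_sig x.
      * move=> i; apply: pn_cont; by case: (Hc i).
      * move=> i; apply: pn_cont; exact: Hc.
  - move=> u x [[Hc1 Hs1] [Hc2 Hs2]]; split => /=; first by move=> i; split; [exact: Hc1 | exact: Hc2].
    rewrite Series_plus; [|exact: proj2_sig (fst x)|exact: proj2_sig (snd x)].
    apply: is_lim_seq_ext (is_lim_seq_plus' _ _ _ _ Hs1 Hs2) => k /=.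
    rewrite Series_plus //; [exact: proj2_sig (fst (u k))|exact: proj2_sig (snd (u k))].
  - by move=> x /=; rewrite Series_plus.
Qed.

Lemma dsum_real_flatten : iso (dsum (dsum realn)) (dsum realn).
Proof.
  pose val (x : dsum (dsum realn)) (p : nat * nat) : R := proj1_sig (proj1_sig x (fst p)) (snd p).
  have Hval (x : dsum (dsum realn)) := series_unflatten (fun p => Rabs (val x p)) (fun p => Rabs_pos _)
    (fun i => proj2_sig (proj1_sig x i)) (proj2_sig x).
  have Hflat (x : dsum realn) := series_flatten (fun p => Rabs (proj1_sig x (to_nat p)))
    (fun p => Rabs_pos _).
  have Hx (x : dsum realn) : ex_series (fun n => Rabs (proj1_sig x (to_nat (of_nat n)))).
    by apply: ex_series_ext (proj2_sig x) => n; rewrite cancel_to_of.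
  pose row (x : dsum realn) i : dsum realn :=
    exist _ (fun j => proj1_sig x (to_nat (i, j)) : realn) (proj1 (Hflat x (Hx x)) i).
  pose fold (x : dsum (dsum realn)) : dsum realn :=
    exist _ (fun n => val x (of_nat n) : realn) (proj1 (Hval x)).
  pose unfold (x : dsum realn) : dsum (dsum realn) :=
    exist _ (row x) (proj1 (proj2 (Hflat x (Hx x)))).
  have E1 x : unfold (fold x) = x.
    apply: sig_ext; apply: functional_extensionality => i.
    apply: sig_ext; apply: functional_extensionality => j.
    by change (val x (of_nat (to_nat (i, j))) = val x (i, j)); rewrite cancel_of_to.
  have E2 x : fold (unfold x) = x.
    apply: sig_ext; apply: functional_extensionality => n.
    change (proj1_sig x (to_nat (fst (of_nat n), snd (of_nat n))) = proj1_sig x n).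
    by rewrite -surjective_pairing cancel_to_of.
  have E3 x : pn (fold x) = pn x by exact: (proj2 (Hval x)).
  have E4 x : pn (unfold x) = pn x by rewrite -E3 E2.
  exists fold, unfold; split => //; split => //; split; [|split] => //.
  - move=> u x Hu; have Hp := pn_cont _ _ Hu; case: Hu => Hc Hs.
    split; first by move=> n; case: (Hc (fst (of_nat n))) => Hn _; exact: Hn.
    change (is_lim_seq (fun k => pn (fold (u k))) (pn (fold x))).
    rewrite E3; apply: is_lim_seq_ext Hp => k; by rewrite E3.
  - move=> u x Hu; have Hp := pn_cont _ _ Hu; case: Hu => Hc Hs.
    split; last first.
      change (is_lim_seq (fun k => pn (unfold (u k))) (pn (unfold x))).
      rewrite E4; apply: is_lim_seq_ext Hp => k; by rewrite E4.
    move=> i; split; first by move=> j; exact: Hc.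
    (* The norm of row [i] is the series of the flat sequence cut down by the indicator of that row.
       In this form it is dominated by the whole sequence, whose norms converge, and [series_pratt]
       applies. *)
    pose ind (p : nat * nat) := if Nat.eqb (fst p) i then 1 else 0.
    have Hind p : 0 <= ind p <= 1 by rewrite /ind; case: Nat.eqb; split; lra.
    pose G (x : dsum realn) n := ind (of_nat n) * Rabs (proj1_sig x n).
    have HG (y : dsum realn) n : 0 <= G y n <= Rabs (proj1_sig y n).
      have := Hind (of_nat n); have := Rabs_pos (proj1_sig y n); rewrite /G; split; nra.
    have EG (y : dsum realn) : Series (G y) = pn (row y i).
      have EGu : (fun n => G y n) = (fun n => (fun p => ind p * Rabs (proj1_sig y (to_nat p))) (of_nat n)).
        by apply: functional_extensionality => n; rewrite cancel_to_of.
      have EGy : ex_series (G y) by apply: ex_series_le_pos (proj2_sig y).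
      have Hpos p : 0 <= ind p * Rabs (proj1_sig y (to_nat p)).
        by have := Hind p; have := Rabs_pos (proj1_sig y (to_nat p)); nra.
      have EGy' : ex_series (fun n => (fun p => ind p * Rabs (proj1_sig y (to_nat p))) (of_nat n)).
        by rewrite -EGu.
      have [F1 [F2 _]] := series_flatten _ Hpos EGy'.
      have [_ F3] := series_unflatten _ Hpos F1 F2.
      have -> : Series (G y) = Series (fun n => (fun p => ind p * Rabs (proj1_sig y (to_nat p))) (of_nat n)).
        by rewrite -EGu.
      rewrite F3.
      have Erow i' : Series (fun j => ind (i', j) * Rabs (proj1_sig y (to_nat (i', j)))) =
          if Nat.eqb i' i then pn (row y i) else 0.
        rewrite /ind /=; case: Nat.eqb_spec => [->|_].
        - by apply: Series_ext => j; rewrite Rmult_1_l.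
        - by rewrite -[RHS]series_const0; apply: Series_ext => j; rewrite Rmult_0_l.
      rewrite (Series_ext _ _ Erow).
      apply: is_series_unique.
      suff : is_lim_seq (sum_n (fun i' => if Nat.eqb i' i then pn (row y i) else 0)) (pn (row y i)) by [].
      apply/lim_eps => eps He; exists i => n Hn.
      suff -> : sum_n (fun i' => if Nat.eqb i' i then pn (row y i) else 0) n = pn (row y i).
        by rewrite Rminus_diag Rabs_R0.
      elim: n Hn => [|n IH] Hn.
        by rewrite sum_O; case: Nat.eqb_spec => // ?; lia.
      rewrite sum_Sn; case: Nat.eqb_spec => [E|N].
        have -> : sum_n (fun i' => if Nat.eqb i' i then pn (row y i) else 0) n = 0; last exact: Rplus_0_l.
        rewrite (sum_n_ext_loc _ (fun _ => 0)); last by move=> m Hm; case: Nat.eqb_spec => // ?; lia.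
        by rewrite sum_n_const Rmult_0_r.
      by rewrite IH; [exact: Rplus_0_r | lia].
    change (is_lim_seq (fun k => pn (row (u k) i)) (pn (row x i))).
    rewrite -EG; apply: (is_lim_seq_ext (fun k => Series (G (u k)))); first by move=> k; rewrite EG.
    apply: (proj2 (series_pratt (fun k => G (u k)) (fun k n => Rabs (proj1_sig (u k) n)) _
       (fun n => Rabs (proj1_sig x n)) _ _ _ _ _ _)) => //.
    + move=> k; exact: proj2_sig (u k).
    + exact: proj2_sig x.
    + move=> n; have := is_lim_seq_scal_l _ (ind (of_nat n)) _ (is_lim_seq_abs _ _ (Hc n)); exact.
    + move=> n; exact: (is_lim_seq_abs _ _ (Hc n)).
Qed.

(* [A + H ~ A + sum (A + B) ~ (A + sum A) + sum B ~ sum (A + B) ~ H]. *)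
Lemma iso_absorb (H A B : nspace) :
  iso (dsum H) H -> iso (dprod A B) H -> iso (dprod A H) H.
Proof.
  move=> HH HAB.
  have E : iso (dprod (dsum A) (dsum B)) H.
    apply: iso_trans (iso_sym _ _ (iso_dsum_dprod A B)) _.
    exact: iso_trans (iso_dsum _ _ HAB) HH.
  apply: iso_trans (iso_dprod _ _ _ _ (iso_refl A) (iso_sym _ _ E)) _.
  apply: iso_trans (iso_dprodA _ _ _) _.
  apply: iso_trans (iso_dprod _ _ _ _ (iso_dsum_cons A) (iso_refl _)) E.
Qed.

(** Here [C + (H + B) ~ (C + H) + B ~ A + B ~ H], so [C] is itself a factor of [H] and is absorbed:
    [A ~ C + H ~ H]. *)
Lemma iso_decomposition (H A B C : nspace) :
  iso (dsum H) H -> iso (dprod A B) H -> iso A (dprod H C) -> iso A H.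
Proof.
  move=> HH HAB HA; apply: (iso_trans _ _ _ HA).
  apply: iso_trans (iso_dprodC _ _) _.
  apply: (iso_absorb H C (dprod H B)) => //.
  apply: iso_trans (iso_dprodA _ _ _) _.
  apply: (iso_trans _ (dprod A B)) => //; apply: iso_dprod; last exact: iso_refl.
  apply: iso_trans (iso_dprodC _ _) _; exact: (iso_sym _ _ HA).
Qed.

(** * The space l1 *)

Definition l1 : nspace := dsum realn.

Definition cf (a : l1) (n : nat) : R := proj1_sig a n.

Arguments cf : simpl never.

Lemma l1_ext (a b : l1) : (forall n, cf a n = cf b n) -> a = b.
Proof. move=> E; apply: sig_ext; exact: functional_extensionality. Qed.

Lemma l1_abs (a : l1) : ex_series (fun n => Rabs (cf a n)).
Proof. exact: proj2_sig a. Qed.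

Lemma pn_l1 (a : l1) : pn a = Series (fun n => Rabs (cf a n)).
Proof. by []. Qed.

Lemma mk_l1_abs (a : nat -> R) : ex_series (fun n => Rabs (a n)) -> {b : l1 | forall n, cf b n = a n}.
Proof. by move=> H; exists (exist _ (a : nat -> realn) H). Qed.

Lemma l1_coord (a : l1) (n : nat) : Rabs (cf a n) <= pn a.
Proof. apply: (series_pos_term (fun n => Rabs (cf a n))); [move=> m; exact: Rabs_pos | exact: l1_abs]. Qed.

Lemma l1_partial (a : l1) (N : nat) : sum_n (fun n => Rabs (cf a n)) N <= pn a.
Proof. apply: series_pos_partial; [move=> m; exact: Rabs_pos | exact: l1_abs]. Qed.

Lemma pn_l1_eq0 (a : l1) : pn a = 0 -> forall n, cf a n = 0.
Proof.
  move=> H n; have := l1_coord a n; rewrite H => Hn.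
  by apply: Rabs_eq_0; have := Rabs_pos (cf a n); lra.
Qed.

Lemma lc_abs_bound (c x d y : R) : Rabs (c * x + d * y) <= Rabs c * Rabs x + Rabs d * Rabs y.
Proof. rewrite -!Rabs_mult; exact: Rabs_triang. Qed.

Lemma l1_lc_ex (c : R) (a : l1) (d : R) (b : l1) :
  ex_series (fun n => Rabs c * Rabs (cf a n) + Rabs d * Rabs (cf b n)).
Proof.
  apply: (ex_series_plus (fun n => Rabs c * Rabs (cf a n)) (fun n => Rabs d * Rabs (cf b n))).
  - exact: (ex_series_scal_l (Rabs c) _ (l1_abs a)).
  - exact: (ex_series_scal_l (Rabs d) _ (l1_abs b)).
Qed.

Lemma l1_lc_abs (c : R) (a : l1) (d : R) (b : l1) :
  ex_series (fun n => Rabs (c * cf a n + d * cf b n)).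
Proof.
  apply: ex_series_le_pos (l1_lc_ex c a d b) => n; split; first exact: Rabs_pos.
  exact: lc_abs_bound.
Qed.

(** Sums, differences and multiples are all instances of this combination, so linearity, the norm
    inequality and continuity take one lemma each. [blc] plays the same part for functions. *)
Definition l1lc (c : R) (a : l1) (d : R) (b : l1) : l1 :=
  exist _ (fun n => c * cf a n + d * cf b n : realn) (l1_lc_abs c a d b).

Lemma cf_lc (c : R) (a : l1) (d : R) (b : l1) (n : nat) :
  cf (l1lc c a d b) n = c * cf a n + d * cf b n.
Proof. by []. Qed.

Lemma pn_l1lc (c : R) (a : l1) (d : R) (b : l1) :
  pn (l1lc c a d b) <= Rabs c * pn a + Rabs d * pn b.
Proof.
  rewrite !pn_l1 -!Series_scal_l -Series_plus.
  - apply: Series_le; last exact: l1_lc_ex.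
    move=> n; split; [exact: Rabs_pos | exact: lc_abs_bound].
  - exact: (ex_series_scal_l (Rabs c) _ (l1_abs a)).
  - exact: (ex_series_scal_l (Rabs d) _ (l1_abs b)).
Qed.

Definition l1zero : l1.
Proof.
  refine (exist _ (fun _ => 0 : realn) _).
  apply: ex_series_ext ex_series_const0 => n /=; by rewrite Rabs_R0.
Defined.

Lemma cf_l1zero (n : nat) : cf l1zero n = 0.
Proof. by []. Qed.

Definition l1d (a b : l1) : R := pn (l1lc 1 a (-1) b).

Lemma l1d_ge0 (a b : l1) : 0 <= l1d a b.
Proof. exact: pn_ge0. Qed.

Lemma l1d_tri (a b c : l1) : l1d a c <= l1d a b + l1d b c.
Proof.
  rewrite /l1d.
  have -> : l1lc 1 a (-1) c = l1lc 1 (l1lc 1 a (-1) b) 1 (l1lc 1 b (-1) c).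
    by apply: l1_ext => n; rewrite !cf_lc; ring.
  have := pn_l1lc 1 (l1lc 1 a (-1) b) 1 (l1lc 1 b (-1) c); rewrite Rabs_R1; lra.
Qed.

Lemma l1d_sym (a b : l1) : l1d a b = l1d b a.
Proof.
  rewrite /l1d !pn_l1; apply: Series_ext => n; rewrite !cf_lc -Rabs_Ropp; f_equal; ring.
Qed.

Lemma l1d_refl (a : l1) : l1d a a = 0.
Proof.
  rewrite /l1d pn_l1 -[RHS]series_const0; apply: Series_ext => n.
  rewrite cf_lc -Rabs_R0; f_equal; ring.
Qed.

Lemma l1d_coord (a b : l1) (n : nat) : Rabs (cf a n - cf b n) <= l1d a b.
Proof. have := l1_coord (l1lc 1 a (-1) b) n; rewrite cf_lc => H; replace (cf a n - cf b n) with (1 * cf a n + -1 * cf b n) by ring; exact: H. Qed.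

Lemma l1d_pn (a b : l1) : Rabs (pn a - pn b) <= l1d a b.
Proof.
  have H (x y : l1) : pn x <= pn y + l1d x y.
    have {1}-> : x = l1lc 1 y 1 (l1lc 1 x (-1) y) by apply: l1_ext => n; rewrite !cf_lc; ring.
    have := pn_l1lc 1 y 1 (l1lc 1 x (-1) y); rewrite Rabs_R1 /l1d; lra.
  have := H a b; have := H b a; rewrite (l1d_sym b a) => ? ?.
  by apply: Rabs_le; split; lra.
Qed.

(** Coordinatewise convergence with convergence of norms is norm convergence in l1 (Riesz, Scheffe):
    the terms [|u_n - x_n|] tend to 0 and are dominated by [|u_n| + |x_n|], whose sums converge. *)
Lemma cv_l1 (u : nat -> l1) (x : l1) : cv u x <-> is_lim_seq (fun k => l1d (u k) x) 0.
Proof.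
  split.
  - move=> [Hc Hs].
    have := series_pratt (fun k n => Rabs (cf (u k) n - cf x n))
      (fun k n => Rabs (cf (u k) n) + Rabs (cf x n)) (fun _ => 0)
      (fun n => Rabs (cf x n) + Rabs (cf x n)).
    case.
    + move=> k i; split; first exact: Rabs_pos.
      rewrite -(Rabs_Ropp (cf x i)); exact: Rabs_triang.
    + move=> k; exact: (ex_series_plus _ _ (l1_abs (u k)) (l1_abs x)).
    + exact: (ex_series_plus _ _ (l1_abs x) (l1_abs x)).
    + move=> i; apply/lim_dist; apply: is_lim_seq_ext (proj1 (lim_dist _ _) (Hc i)) => k.
      by rewrite Rminus_0_r Rabs_Rabsolu.
    + move=> i; apply: is_lim_seq_plus'; last exact: is_lim_seq_const.
      exact: (is_lim_seq_abs _ _ (Hc i)).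
    + rewrite Series_plus; [|exact: l1_abs|exact: l1_abs].
      apply: (is_lim_seq_ext (fun k => pn (u k) + pn x)).
        by move=> k; rewrite Series_plus //; exact: l1_abs.
      apply: is_lim_seq_plus'; [exact: Hs | exact: is_lim_seq_const].
    move=> _; rewrite series_const0; apply: is_lim_seq_ext => k.
    rewrite /l1d pn_l1; apply: Series_ext => n; rewrite cf_lc; f_equal; ring.
  - move=> H; split.
    + move=> i; apply: (lim_squeeze _ _ _ 0 _ H) => k _; exact: l1d_coord.
    + apply: (lim_squeeze _ _ _ 0 _ H) => k _; exact: (l1d_pn (u k) x).
Qed.

Lemma l1lc_cont (u v : nat -> l1) (x y : l1) (c d : R) :
  cv u x -> cv v y -> cv (fun k => l1lc c (u k) d (v k)) (l1lc c x d y).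
Proof.
  move=> /cv_l1 H1 /cv_l1 H2; apply/cv_l1.
  apply: (lim_squeeze _ (fun k => Rabs c * l1d (u k) x + Rabs d * l1d (v k) y) _ 0); last first.
    by apply: lim_plus0; exact: lim_scal0.
  move=> k _; rewrite Rminus_0_r Rabs_pos_eq; last exact: l1d_ge0.
  rewrite /l1d.
  have -> : l1lc 1 (l1lc c (u k) d (v k)) (-1) (l1lc c x d y) =
    l1lc c (l1lc 1 (u k) (-1) x) d (l1lc 1 (v k) (-1) y).
    by apply: l1_ext => n; rewrite !cf_lc; ring.
  exact: pn_l1lc.
Qed.

(** The limit is taken coordinate by coordinate, and the bounds pass to it through partial sums. The
    coordinate limits are part of the conclusion because [selection] derives homogeneity from their
    uniqueness. *)
Lemma l1_complete (A : nat -> l1) (C : R) :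
  (forall K, l1d (A (S K)) (A K) <= C * (/ 2) ^ K) ->
  exists a : l1, (forall K, l1d a (A K) <= 2 * C * (/ 2) ^ K) /\
    (forall n, is_lim_seq (fun K => cf (A K) n) (cf a n)).
Proof.
  move=> HA.
  have HC : 0 <= C by have := HA O; have := l1d_ge0 (A 1%nat) (A O); rewrite /=; lra.
  have Hpow K : 0 < (/ 2) ^ K by apply: pow_lt; lra.
  (* The exact value of the finite geometric sum; the subtracted term is what lets the induction on
     [m] close. *)
  have HAm K m : l1d (A (K + m)%nat) (A K) <= 2 * C * (/ 2) ^ K - 2 * C * (/ 2) ^ (K + m).
    elim: m => [|m IH]; first by rewrite Nat.add_0_r l1d_refl; lra.
    have := l1d_tri (A (K + S m)%nat) (A (K + m)%nat) (A K).
    have := HA (K + m)%nat; rewrite -Nat.add_succ_r.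
    have -> : (/ 2) ^ (K + S m) = / 2 * (/ 2) ^ (K + m) by rewrite Nat.add_succ_r.
    lra.
  have HAm' K m : (K <= m)%nat -> l1d (A m) (A K) <= 2 * C * (/ 2) ^ K.
    move=> Hm; have := HAm K (m - K)%nat.
    have -> : (K + (m - K))%nat = m by lia.
    have := Hpow m; nra.
  have Hlim n : ex_finite_lim_seq (fun K => cf (A K) n).
    apply/ex_lim_seq_cauchy_corr => eps.
    move/lim_eps: (lim_geom0 (2 * C)) => /(_ (eps / 2)).
    have He := cond_pos eps.
    case=> [|N HN]; first lra.
    have := HN N (Nat.le_refl N); rewrite Rminus_0_r => /Rabs_def2 [HN' _].
    exists N => p q Hp Hq.
    have := l1d_coord (A p) (A N) n; have := l1d_coord (A q) (A N) n.
    have := HAm' N p Hp; have := HAm' N q Hq.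
    have := Rabs_triang (cf (A p) n - cf (A N) n) (- (cf (A q) n - cf (A N) n)).
    rewrite Rabs_Ropp.
    have -> : cf (A p) n - cf (A N) n + - (cf (A q) n - cf (A N) n) = cf (A p) n - cf (A q) n by ring.
    lra.
  pose a n := real (Lim_seq (fun K => cf (A K) n)).
  have Ha n : is_lim_seq (fun K => cf (A K) n) (a n) by apply: Lim_seq_correct'.
  have Hsum K N : sum_n (fun n => Rabs (a n - cf (A K) n)) N <= 2 * C * (/ 2) ^ K.
    have L : is_lim_seq (fun m => sum_n (fun n => Rabs (cf (A (m + K)%nat) n - cf (A K) n)) N)
        (sum_n (fun n => Rabs (a n - cf (A K) n)) N).
      apply: lim_sum_n => n.
      apply: (is_lim_seq_abs _ (a n - cf (A K) n)); apply: is_lim_seq_minus'; last exact: is_lim_seq_const.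
      exact: (proj1 (is_lim_seq_incr_n (fun m => cf (A m) n) K _) (Ha n)).
    apply: (is_lim_seq_le _ (fun _ => 2 * C * (/ 2) ^ K) _ (2 * C * (/ 2) ^ K) _ L (is_lim_seq_const _)) => m.
    apply: Rle_trans (HAm' K (m + K)%nat ltac:(lia)).
    have := l1_partial (l1lc 1 (A (m + K)%nat) (-1) (A K)) N.
    rewrite /l1d; have -> // : (fun n => Rabs (cf (A (m + K)%nat) n - cf (A K) n)) =
       (fun n => Rabs (cf (l1lc 1 (A (m + K)%nat) (-1) (A K)) n)).
    apply: functional_extensionality => n; rewrite cf_lc; f_equal; ring.
  have Hs K := series_pos_bound _ _ (fun n => Rabs_pos _) (Hsum K).
  have Habs : ex_series (fun n => Rabs (a n)).
    apply: (ex_series_le_pos _ (fun n => Rabs (a n - cf (A O) n) + Rabs (cf (A O) n))).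
    - move=> n; split; first exact: Rabs_pos.
      apply: Rle_trans (Rabs_triang _ _); right; f_equal; ring.
    - exact: (ex_series_plus _ _ (proj1 (Hs O)) (l1_abs (A O))).
  exists (exist _ (a : nat -> realn) Habs : l1); split; last exact: Ha.
  move=> K; apply: Rle_trans (proj2 (Hs K)); right; rewrite /l1d pn_l1.
  by apply: Series_ext => n; rewrite cf_lc; f_equal; rewrite /cf /=; ring.
Qed.

(** * Continuous functions vanishing at 0, with the oscillation norm *)

Definition clamp (x : R) : R := Rmax 0 (Rmin 1 x).

Lemma clamp_bounds (x : R) : 0 <= clamp x <= 1.
Proof.
  rewrite /clamp; split; first exact: Rmax_l.
  apply: Rmax_lub; [lra | exact: Rmin_l].
Qed.

Lemma clamp_id (x : R) : 0 <= x <= 1 -> clamp x = x.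
Proof. by move=> [H0 H1]; rewrite /clamp Rmin_right // Rmax_right. Qed.

Lemma clamp_low (x : R) : x <= 0 -> clamp x = 0.
Proof. by move=> H; rewrite /clamp Rmin_right; [rewrite Rmax_left | lra]. Qed.

Lemma clamp_high (x : R) : 1 <= x -> clamp x = 1.
Proof. by move=> H; rewrite /clamp Rmin_left; [rewrite Rmax_right; lra | lra]. Qed.

Lemma clamp_idem (x : R) : clamp (clamp x) = clamp x.
Proof. exact: clamp_id (clamp_bounds x). Qed.

Lemma clamp_le (x y : R) : x <= y -> clamp x <= clamp y.
Proof.
  move=> H; rewrite /clamp; apply: Rle_max_compat_l; exact: Rle_min_compat_l.
Qed.

Lemma clamp_lip (x y : R) : Rabs (clamp x - clamp y) <= Rabs (x - y).
Proof.
  wlog H : x y / y <= x.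
    move=> W; case: (Rle_dec y x) => H; first exact: W.
    rewrite Rabs_minus_sym (Rabs_minus_sym x); apply: W; lra.
  rewrite !Rabs_pos_eq; [|lra|have := clamp_le y x H; lra].
  case: (Rle_dec x 0) => Hx0; first by rewrite !clamp_low; lra.
  case: (Rle_dec 1 y) => Hy1; first by rewrite !clamp_high; lra.
  case: (Rle_dec 0 y) => Hy0; case: (Rle_dec x 1) => Hx1.
  - by rewrite !clamp_id; lra.
  - by rewrite (clamp_high x) ?(clamp_id y); lra.
  - by rewrite (clamp_low y) ?(clamp_id x); lra.
  - by rewrite (clamp_low y) ?(clamp_high x); lra.
Qed.

Lemma cont_eps (f : R -> R) (x : R) :
  (forall eps, 0 < eps -> exists delta, 0 < delta /\
     forall y, Rabs (y - x) < delta -> Rabs (f y - f x) < eps) <-> continuity_pt f x.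
Proof.
  split=> H.
  - apply/continuity_pt_locally => eps; case: (H eps (cond_pos eps)) => d [Hd HH].
    exists (mkposreal d Hd) => y Hy; exact: HH.
  - move=> eps He; move/continuity_pt_locally: H => /(_ (mkposreal eps He)) [d Hd].
    exists d; split; first exact: cond_pos.
    move=> y Hy; exact: Hd.
Qed.

Lemma clamp_cont (x : R) : continuity_pt clamp x.
Proof.
  apply/cont_eps => eps He; exists eps; split => // y Hy.
  exact: Rle_lt_trans (clamp_lip _ _) Hy.
Qed.

Lemma cont_comp (f g : R -> R) (x : R) :
  continuity_pt f x -> continuity_pt g (f x) -> continuity_pt (fun s => g (f s)) x.
Proof. exact: continuity_pt_comp. Qed.

Lemma cont_lc (c d : R) (f g : R -> R) (x : R) :
  continuity_pt f x -> continuity_pt g x -> continuity_pt (fun s => c * f s + d * g s) x.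
Proof.
  move=> Hf Hg; apply: (continuity_pt_plus (fun s => c * f s) (fun s => d * g s));
  exact: continuity_pt_scal.
Qed.

Lemma cont_unif (f : R -> R) (x : R) :
  (forall eps, 0 < eps -> exists g, continuity_pt g x /\ forall y, Rabs (f y - g y) <= eps) ->
  continuity_pt f x.
Proof.
  move=> H; apply/cont_eps => eps He.
  case: (H (eps / 4)); first lra.
  move=> g [/cont_eps Hg Hfg].
  case: (Hg (eps / 4)); first lra.
  move=> d [Hd HH]; exists d; split => // y Hy.
  have := HH y Hy; have := Hfg y; have := Hfg x.
  move=> /Rabs_le_between ? /Rabs_le_between ? /Rabs_def2 ?; apply: Rabs_def1; lra.
Qed.

(** A function on [0,1] is represented by its extension to the line that is constant on either side.
    Continuity on all of R then applies, and equality of representatives is equality on [0,1]. *)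
Definition based (f : R -> R) : Prop :=
  (forall x, continuity_pt f x) /\ (forall x, f x = f (clamp x)) /\ f 0 = 0.

Lemma clamped_bounded (f : R -> R) :
  (forall x, continuity_pt f x) -> (forall x, f x = f (clamp x)) -> bounded_above f.
Proof.
  move=> Hc Hf.
  have [M [HM _]] := continuity_ab_maj f 0 1 ltac:(lra) (fun c _ => Hc c).
  exists (f M) => x; rewrite Hf; exact: HM (clamp_bounds x).
Qed.

Definition osc (f : R -> R) : R := supr f + supr (fun x => - f x).

Definition bounded (f : R -> R) : Prop :=
  bounded_above f /\ bounded_above (fun x => - f x).

Lemma osc_ge (f : R -> R) (x y : R) : bounded f -> f x - f y <= osc f.
Proof.
  move=> [H1 H2]; have := supr_ub f H1 x; have := supr_ub _ H2 y; rewrite /osc /=; lra.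
Qed.

Lemma osc_le (f : R -> R) (M : R) : (forall x y, f x - f y <= M) -> osc f <= M.
Proof.
  move=> H; suff: supr f <= M - supr (fun x => - f x) by rewrite /osc; lra.
  apply: (supr_le f 0) => x; suff: supr (fun y => - f y) <= M - f x by lra.
  apply: (supr_le _ 0) => y; have := H x y; lra.
Qed.

Lemma based_bounded (f : R -> R) : based f -> bounded f.
Proof.
  move=> [Hc [Hf _]]; split; first exact: clamped_bounded.
  apply: clamped_bounded => x; last by rewrite Hf.
  exact: continuity_pt_opp.
Qed.

Lemma based_lc (c : R) (f : R -> R) (d : R) (g : R -> R) :
  based f -> based g -> based (fun s => c * f s + d * g s).
Proof.
  move=> [Hf1 [Hf2 Hf3]] [Hg1 [Hg2 Hg3]]; split; [|split].
  - move=> x; exact: cont_lc.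
  - by move=> x; rewrite Hf2 Hg2.
  - rewrite Hf3 Hg3; ring.
Qed.

Definition bspace := {f : R -> R | based f}.
Definition ev (x : bspace) (s : R) : R := proj1_sig x s.
Arguments ev : simpl never.
Definition nrm (x : bspace) : R := osc (ev x).

Lemma b_ext (x y : bspace) : (forall s, ev x s = ev y s) -> x = y.
Proof. move=> H; apply: sig_ext; exact: functional_extensionality. Qed.

Lemma ev_bounded (x : bspace) : bounded (ev x).
Proof. exact: based_bounded (proj2_sig x). Qed.

Lemma ev0 (x : bspace) : ev x 0 = 0.
Proof. by case: (proj2_sig x) => _ []. Qed.

Lemma ev_clamp (x : bspace) (s : R) : ev x s = ev x (clamp s).
Proof. by case: (proj2_sig x) => _ [H _]; exact: H. Qed.

Lemma ev_cont (x : bspace) (s : R) : continuity_pt (ev x) s.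
Proof. by case: (proj2_sig x) => H _; exact: H. Qed.

Lemma nrm_diff (x : bspace) (s t : R) : Rabs (ev x s - ev x t) <= nrm x.
Proof.
  have := osc_ge (ev x) s t (ev_bounded x); have := osc_ge (ev x) t s (ev_bounded x).
  rewrite -/(nrm x) => ? ?; apply: Rabs_le; lra.
Qed.

Lemma nrm_ev (x : bspace) (s : R) : Rabs (ev x s) <= nrm x.
Proof. have := nrm_diff x s 0; by rewrite ev0 Rminus_0_r. Qed.

Lemma nrm_ge0 (x : bspace) : 0 <= nrm x.
Proof. exact: Rle_trans (Rabs_pos _) (nrm_ev x 0). Qed.

Lemma nrm_le (x : bspace) (M : R) : (forall s t, ev x s - ev x t <= M) -> nrm x <= M.
Proof. exact: osc_le. Qed.

Lemma nrm_le_sup (x : bspace) (M : R) : (forall s, Rabs (ev x s) <= M) -> nrm x <= 2 * M.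
Proof.
  move=> H; apply: nrm_le => s t; have /Rabs_le_between := H s; have /Rabs_le_between := H t; lra.
Qed.

Definition blc (c : R) (x : bspace) (d : R) (y : bspace) : bspace :=
  exist _ (fun s => c * ev x s + d * ev y s) (based_lc c _ d _ (proj2_sig x) (proj2_sig y)).

Lemma ev_lc (c : R) (x : bspace) (d : R) (y : bspace) (s : R) :
  ev (blc c x d y) s = c * ev x s + d * ev y s.
Proof. by []. Qed.

Lemma nrm_lc (c : R) (x : bspace) (d : R) (y : bspace) :
  nrm (blc c x d y) <= Rabs c * nrm x + Rabs d * nrm y.
Proof.
  apply: nrm_le => s t; rewrite !ev_lc.
  have -> : c * ev x s + d * ev y s - (c * ev x t + d * ev y t) =
    c * (ev x s - ev x t) + d * (ev y s - ev y t) by ring.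
  apply: Rle_trans (Rle_abs _) _; apply: Rle_trans (lc_abs_bound _ _ _ _) _.
  have := Rmult_le_compat_l _ _ _ (Rabs_pos c) (nrm_diff x s t).
  have := Rmult_le_compat_l _ _ _ (Rabs_pos d) (nrm_diff y s t); lra.
Qed.

Definition bzero : bspace.
Proof.
  exists (fun _ => 0); split; [|split] => //.
  move=> x; apply: continuity_pt_const => ? ? //.
Defined.

Lemma ev_bzero (s : R) : ev bzero s = 0.
Proof. by []. Qed.

Lemma nrm_bzero : nrm bzero = 0.
Proof.
  apply: Rle_antisym (nrm_ge0 _); apply: nrm_le => s t; rewrite /ev /=; lra.
Qed.

Lemma nrm_eq0 (x : bspace) : nrm x = 0 -> x = bzero.
Proof.
  move=> H; apply: b_ext => s; rewrite [RHS]/ev /=.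
  have := nrm_ev x s; rewrite H => Hs; apply: Rabs_eq_0; have := Rabs_pos (ev x s); lra.
Qed.

(* This single inequality implies homogeneity, [p bzero = 0] and [0 <= p]. *)
Definition seminorm (p : bspace -> R) : Prop :=
  forall c x d y, p (blc c x d y) <= Rabs c * p x + Rabs d * p y.

Section Seminorm.
Variable p : bspace -> R.
Hypothesis Hp : seminorm p.

Lemma sn_zero : p bzero = 0.
Proof.
  have H := Hp 0 bzero 0 bzero; rewrite Rabs_R0 in H.
  have E : blc 0 bzero 0 bzero = bzero by apply: b_ext => s; rewrite ev_lc /ev /=; ring.
  have H' := Hp 1 bzero 1 bzero; rewrite Rabs_R1 in H'.
  have E' : blc 1 bzero 1 bzero = bzero by apply: b_ext => s; rewrite ev_lc /ev /=; ring.
  rewrite E in H; rewrite E' in H'; lra.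
Qed.

Lemma sn_ge0 (x : bspace) : 0 <= p x.
Proof.
  have H := Hp 1 x (-1) x.
  have E : blc 1 x (-1) x = bzero by apply: b_ext => s; rewrite ev_lc [RHS]/ev /=; ring.
  rewrite E sn_zero Rabs_R1 Rabs_Ropp Rabs_R1 in H; lra.
Qed.

Lemma sn_scal (c : R) (x : bspace) : p (blc c x 0 bzero) = Rabs c * p x.
Proof.
  have H d y : p (blc d y 0 bzero) <= Rabs d * p y.
    by have := Hp d y 0 bzero; rewrite sn_zero; lra.
  apply: Rle_antisym; first exact: H.
  case: (Req_dec c 0) => [->|Hc]; first by rewrite Rabs_R0 Rmult_0_l; exact: sn_ge0.
  have := H (/ c) (blc c x 0 bzero).
  have -> : blc (/ c) (blc c x 0 bzero) 0 bzero = x.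
    by apply: b_ext => s; rewrite !ev_lc {2 3}/ev /=; field.
  have Hc' := Rabs_pos_lt c Hc.
  rewrite Rabs_inv => H'; apply: (Rmult_le_reg_l (/ Rabs c)); first exact: Rinv_0_lt_compat.
  rewrite -Rmult_assoc Rinv_l; lra.
Qed.

Lemma sn_sub_tri (x y z : bspace) : p (blc 1 x (-1) z) <= p (blc 1 x (-1) y) + p (blc 1 y (-1) z).
Proof.
  have -> : blc 1 x (-1) z = blc 1 (blc 1 x (-1) y) 1 (blc 1 y (-1) z).
    by apply: b_ext => s; rewrite !ev_lc; ring.
  have := Hp 1 (blc 1 x (-1) y) 1 (blc 1 y (-1) z); rewrite Rabs_R1; lra.
Qed.

Lemma sn_sub_sym (x y : bspace) : p (blc 1 x (-1) y) = p (blc 1 y (-1) x).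
Proof.
  have -> : blc 1 y (-1) x = blc (-1) (blc 1 x (-1) y) 0 bzero.
    by apply: b_ext => s; rewrite !ev_lc; ring.
  rewrite sn_scal Rabs_Ropp Rabs_R1; ring.
Qed.

Lemma sn_le_sub (x y : bspace) : p x <= p y + p (blc 1 x (-1) y).
Proof.
  have {1}-> : x = blc 1 y 1 (blc 1 x (-1) y) by apply: b_ext => s; rewrite !ev_lc; ring.
  have := Hp 1 y 1 (blc 1 x (-1) y); rewrite Rabs_R1; lra.
Qed.

Lemma sn_sub_abs (x y : bspace) : Rabs (p x - p y) <= p (blc 1 x (-1) y).
Proof.
  have := sn_le_sub x y; have := sn_le_sub y x; rewrite (sn_sub_sym y x) => ? ?.
  apply: Rabs_le; lra.
Qed.

Lemma sn_sub_refl (x : bspace) : p (blc 1 x (-1) x) = 0.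
Proof.
  rewrite -sn_zero; f_equal; apply: b_ext => s; rewrite ev_lc [RHS]/ev /=; ring.
Qed.

End Seminorm.

Definition bd (x y : bspace) : R := nrm (blc 1 x (-1) y).

Lemma bd_ev (x y : bspace) (s : R) : Rabs (ev x s - ev y s) <= bd x y.
Proof.
  have := nrm_ev (blc 1 x (-1) y) s; rewrite ev_lc => H.
  by replace (ev x s - ev y s) with (1 * ev x s + -1 * ev y s) by ring.
Qed.

Lemma blc_cont (u v : nat -> bspace) (x y : bspace) (c d : R) :
  is_lim_seq (fun k => bd (u k) x) 0 -> is_lim_seq (fun k => bd (v k) y) 0 ->
  is_lim_seq (fun k => bd (blc c (u k) d (v k)) (blc c x d y)) 0.
Proof.
  move=> H1 H2.
  apply: (lim_squeeze _ (fun k => Rabs c * bd (u k) x + Rabs d * bd (v k) y) _ 0); last first.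
    by apply: lim_plus0; exact: lim_scal0.
  move=> k _; rewrite Rminus_0_r Rabs_pos_eq; last exact: nrm_ge0.
  rewrite /bd.
  have -> : blc 1 (blc c (u k) d (v k)) (-1) (blc c x d y) =
    blc c (blc 1 (u k) (-1) x) d (blc 1 (v k) (-1) y).
    by apply: b_ext => s; rewrite !ev_lc; ring.
  exact: nrm_lc.
Qed.

Definition bscal (c : R) (x : bspace) : bspace := blc c x 0 bzero.

Lemma bscal_bscal (c d : R) (x : bspace) : bscal c (bscal d x) = bscal (c * d) x.
Proof. apply: b_ext => s; rewrite !ev_lc ev_bzero; ring. Qed.

Lemma bscal_1 (x : bspace) : bscal 1 x = x.
Proof. apply: b_ext => s; rewrite !ev_lc ev_bzero; ring. Qed.

Lemma bscal_cont (c : nat -> R) (d : R) (u : nat -> bspace) (x : bspace) :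
  is_lim_seq c d -> is_lim_seq (fun k => bd (u k) x) 0 ->
  is_lim_seq (fun k => bd (bscal (c k) (u k)) (bscal d x)) 0.
Proof.
  move=> L Hu.
  apply: (lim_squeeze _ (fun k => Rabs (c k) * bd (u k) x + nrm x * Rabs (c k - d)) _ 0).
  - move=> k _; rewrite Rminus_0_r Rabs_pos_eq; last exact: nrm_ge0.
    rewrite /bd /bscal.
    have -> : blc 1 (blc (c k) (u k) 0 bzero) (-1) (blc d x 0 bzero) =
        blc (c k) (blc 1 (u k) (-1) x) (c k - d) x.
      by apply: b_ext => s; rewrite !ev_lc; ring.
    have := nrm_lc (c k) (blc 1 (u k) (-1) x) (c k - d) x; lra.
  - apply: lim_plus0; last by apply: lim_scal0; exact: (proj1 (lim_dist c d) L).
    replace (Finite 0) with (Finite (Rabs d * 0)) by (f_equal; ring).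
    apply: is_lim_seq_mult' => //; exact: (is_lim_seq_abs c d).
Qed.

Definition bnspace : nspace.
Proof.
  refine (NSpace (CSpace bspace (fun u x => is_lim_seq (fun k => bd (u k) x) 0)) nrm nrm_ge0 _).
  move=> u x H; apply: (lim_squeeze _ _ _ 0 _ H) => k _; exact: (sn_sub_abs _ nrm_lc).
Defined.

Lemma series_tail_bound (b c : nat -> R) (N : nat) :
  (forall n, Rabs (b n) <= c n) -> ex_series c ->
  Rabs (Series b - sum_n b N) <= Series c - sum_n c N.
Proof.
  move=> Hb Hc.
  have Habs : ex_series (fun n => Rabs (b n)).
    by apply: ex_series_le_pos Hc => n; split; [exact: Rabs_pos | exact: Hb].
  have Hs : ex_series b by exact: ex_series_Rabs.
  have Hm m : Rabs (sum_n b (m + N) - sum_n b N) <= sum_n c (m + N) - sum_n c N.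
    elim: m => [|m IH]; first by rewrite /= !Rminus_diag Rabs_R0; right.
    rewrite /= !sum_Sn /plus /=.
    have -> : sum_n b (m + N) + b (S (m + N)) - sum_n b N =
      (sum_n b (m + N) - sum_n b N) + b (S (m + N)) by ring.
    apply: Rle_trans (Rabs_triang _ _) _; have := Hb (S (m + N)); lra.
  have L1 : is_lim_seq (fun m => Rabs (sum_n b (m + N) - sum_n b N)) (Rabs (Series b - sum_n b N)).
    apply: (is_lim_seq_abs _ (Series b - sum_n b N)).
    apply: is_lim_seq_minus'; last exact: is_lim_seq_const.
    exact: (proj1 (is_lim_seq_incr_n (sum_n b) N _) (series_lim b Hs)).
  have L2 : is_lim_seq (fun m => sum_n c (m + N) - sum_n c N) (Series c - sum_n c N).
    apply: is_lim_seq_minus'; last exact: is_lim_seq_const.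
    exact: (proj1 (is_lim_seq_incr_n (sum_n c) N _) (series_lim c Hc)).
  exact: (is_lim_seq_le _ _ _ _ Hm L1 L2).
Qed.

(** * The operator from l1 to the function space given by a bounded sequence of functions *)

Definition nbounded (E : nat -> bspace) (B : R) : Prop := forall n, nrm (E n) <= B.

Lemma lin_term_bound (E : nat -> bspace) (B : R) (a : l1) (s : R) (n : nat) :
  nbounded E B -> Rabs (cf a n * ev (E n) s) <= B * Rabs (cf a n).
Proof.
  move=> HE; rewrite Rabs_mult Rmult_comm; apply: Rmult_le_compat_r; first exact: Rabs_pos.
  exact: Rle_trans (nrm_ev _ _) (HE n).
Qed.

Lemma lin_ex (E : nat -> bspace) (B : R) (a : l1) (s : R) :
  nbounded E B -> ex_series (fun n => cf a n * ev (E n) s).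
Proof.
  move=> HE; apply: ex_series_Rabs; apply: (ex_series_le_pos _ (fun n => B * Rabs (cf a n))).
  - move=> n; split; [exact: Rabs_pos | exact: lin_term_bound].
  - exact: (ex_series_scal_l B _ (l1_abs a)).
Qed.

(** Weierstrass test: the tails are bounded, uniformly in the point, by those of [B * |a_n|]. *)
Lemma lin_based (E : nat -> bspace) (B : R) (a : l1) :
  nbounded E B -> based (fun s => Series (fun n => cf a n * ev (E n) s)).
Proof.
  move=> HE; split; [|split].
  - move=> x; apply: cont_unif => eps He.
    have HBa := ex_series_scal_l B _ (l1_abs a).
    move/lim_eps: (series_lim _ HBa) => /(_ eps He) [N HN].
    exists (fun s => sum_n (fun n => cf a n * ev (E n) s) N); split.
    + elim: {HN} N => [|N IH].
      * apply: (continuity_pt_ext (fun s => cf a O * ev (E O) s)).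
          by move=> s; rewrite sum_O.
        apply: continuity_pt_scal; exact: ev_cont.
      * apply: (continuity_pt_ext (fun s => sum_n (fun n => cf a n * ev (E n) s) N + cf a (S N) * ev (E (S N)) s)).
          by move=> s; rewrite sum_Sn.
        apply: (continuity_pt_plus (fun s => sum_n (fun n => cf a n * ev (E n) s) N)) => //.
        apply: continuity_pt_scal; exact: ev_cont.
    + move=> s; apply: Rle_trans (series_tail_bound _ (fun n => B * Rabs (cf a n)) N _ HBa) _.
        by move=> n; exact: lin_term_bound.
      have := HN N (Nat.le_refl N) => /Rabs_def2 [_ H]; apply: Rlt_le.
      change (- eps < sum_n (fun n => B * Rabs (cf a n)) N - Series (fun n => B * Rabs (cf a n))) in H.
      lra.
  - move=> x; apply: Series_ext => n; by rewrite ev_clamp.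
  - rewrite -[RHS]series_const0; apply: Series_ext => n; rewrite ev0; ring.
Qed.

(** The case distinction keeps the bound on [E] out of the arguments; for bounded [E] the default is
    never taken ([ev_lin]). *)
Definition lin (E : nat -> bspace) (a : l1) : bspace :=
  match excluded_middle_informative (based (fun s => Series (fun n => cf a n * ev (E n) s))) with
  | left H => exist _ _ H
  | right _ => bzero
  end.

Lemma ev_lin (E : nat -> bspace) (B : R) (a : l1) (s : R) :
  nbounded E B -> ev (lin E a) s = Series (fun n => cf a n * ev (E n) s).
Proof.
  move=> HE; rewrite /lin; case: excluded_middle_informative => // H.
  by case: H; exact: lin_based HE.
Qed.

Lemma nrm_lin (E : nat -> bspace) (B : R) (a : l1) :
  nbounded E B -> nrm (lin E a) <= B * pn a.
Proof.
  move=> HE; apply: nrm_le => s t; rewrite !(ev_lin E B) //.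
  rewrite -Series_minus; [|exact: lin_ex HE|exact: lin_ex HE].
  rewrite pn_l1 -Series_scal_l; apply: Rle_trans (Rle_abs _) _.
  have Hb n : Rabs (cf a n * ev (E n) s - cf a n * ev (E n) t) <= B * Rabs (cf a n).
    have -> : cf a n * ev (E n) s - cf a n * ev (E n) t = cf a n * (ev (E n) s - ev (E n) t) by ring.
    rewrite Rabs_mult Rmult_comm; apply: Rmult_le_compat_r; first exact: Rabs_pos.
    exact: Rle_trans (nrm_diff _ _ _) (HE n).
  have HB := ex_series_scal_l B _ (l1_abs a).
  have Hx : ex_series (fun n => Rabs (cf a n * ev (E n) s - cf a n * ev (E n) t)).
    by apply: ex_series_le_pos HB => n; split; [exact: Rabs_pos | exact: Hb].
  apply: Rle_trans (Series_Rabs _ Hx) _; apply: Series_le => // n.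
  split; [exact: Rabs_pos | exact: Hb].
Qed.

Lemma lin_lc (E : nat -> bspace) (B : R) (c : R) (a : l1) (d : R) (b : l1) :
  nbounded E B -> lin E (l1lc c a d b) = blc c (lin E a) d (lin E b).
Proof.
  move=> HE; apply: b_ext => s; rewrite ev_lc !(ev_lin E B) //.
  rewrite -!Series_scal_l -Series_plus.
  - apply: Series_ext => n; rewrite cf_lc; ring.
  - exact: (ex_series_scal_l c _ (lin_ex E B a s HE)).
  - exact: (ex_series_scal_l d _ (lin_ex E B b s HE)).
Qed.

(** * A copy of l1 *)

(* [tau] maps both [0,1/3] and [2/3,1] onto [0,1], and [psi] is [1] on the former and [-1]
   on the latter: the functions [psi o tau^n] take all sign patterns, as the Rademacher
   functions do. *)
Definition tau (s : R) : R := clamp (3 * s) - clamp (3 * s - 1) + clamp (3 * s - 2).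
Definition psi (s : R) : R := 1 - 2 * clamp (3 * s - 1).

Fixpoint tau_iter (n : nat) (s : R) : R :=
  match n with O => s | S m => tau_iter m (tau s) end.

Lemma tau_left (u : R) : 0 <= u <= 1 -> tau (u / 3) = u /\ psi (u / 3) = 1.
Proof.
  move=> Hu; rewrite /tau /psi.
  have -> : 3 * (u / 3) = u by field.
  by rewrite clamp_id // !(clamp_low (u - _)); lra.
Qed.

Lemma tau_right (u : R) : 0 <= u <= 1 -> tau ((2 + u) / 3) = u /\ psi ((2 + u) / 3) = -1.
Proof.
  move=> Hu; rewrite /tau /psi.
  have -> : 3 * ((2 + u) / 3) = 2 + u by field.
  rewrite !(clamp_high (2 + u)) ?(clamp_high (2 + u - 1)) ?(clamp_id (2 + u - 2)); lra.
Qed.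

Lemma tau_psi_clamp (s : R) : tau s = tau (clamp s) /\ psi s = psi (clamp s).
Proof.
  rewrite /tau /psi; case: (Rle_dec s 0) => H0.
    by rewrite (clamp_low s) // !clamp_low; lra.
  case: (Rle_dec 1 s) => H1; last by rewrite (clamp_id s); lra.
  by rewrite (clamp_high s) // !clamp_high; lra.
Qed.

Lemma tau_cont (s : R) : continuity_pt tau s.
Proof.
  have H c : continuity_pt (fun s => clamp (3 * s - c)) s.
    apply: (cont_comp (fun s => 3 * s - c)); last exact: clamp_cont.
    apply: (continuity_pt_minus (fun s => 3 * s) (fun _ => c)).
      apply: continuity_pt_scal; exact: continuity_pt_id.
    by apply: continuity_pt_const.
  apply: (continuity_pt_ext (fun s => clamp (3 * s - 0) - clamp (3 * s - 1) + clamp (3 * s - 2))).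
    by move=> t; rewrite Rminus_0_r.
  apply: (continuity_pt_plus (fun s => clamp (3 * s - 0) - clamp (3 * s - 1))) => //.
  exact: (continuity_pt_minus (fun s => clamp (3 * s - 0))).
Qed.

Lemma psi_cont (s : R) : continuity_pt psi s.
Proof.
  apply: (continuity_pt_minus (fun _ => 1)); first by apply: continuity_pt_const.
  apply: continuity_pt_scal.
  apply: (cont_comp (fun s => 3 * s - 1)); last exact: clamp_cont.
  apply: (continuity_pt_minus (fun s => 3 * s) (fun _ => 1)).
    apply: continuity_pt_scal; exact: continuity_pt_id.
  by apply: continuity_pt_const.
Qed.

Lemma tau_iter_cont (n : nat) (s : R) : continuity_pt (tau_iter n) s.
Proof.
  elim: n s => [|n IH] s /=; first exact: continuity_pt_id.
  apply: (cont_comp tau); [exact: tau_cont | exact: IH].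
Qed.

Lemma psi_bounds (s : R) : -1 <= psi s <= 1.
Proof. rewrite /psi; have := clamp_bounds (3 * s - 1); lra. Qed.

Lemma tau_iter0 (n : nat) : tau_iter n 0 = 0.
Proof.
  elim: n => [|n IH] //=; have [H _] := tau_left 0 ltac:(lra).
  by have -> : tau 0 = 0 by rewrite -[X in tau X](Rdiv_0_l 3).
Qed.

Lemma psi0 : psi 0 = 1.
Proof. by rewrite /psi clamp_low; lra. Qed.

Lemma rho_based (n : nat) : based (fun s => psi (tau_iter n s) - 1).
Proof.
  split; [|split].
  - move=> s; apply: (continuity_pt_minus (fun s => psi (tau_iter n s)) (fun _ => 1)).
      apply: (cont_comp (tau_iter n)); [exact: tau_iter_cont | exact: psi_cont].
    by apply: continuity_pt_const.
  - move=> s; case: n => [|n] /=; first by rewrite {1}(proj2 (tau_psi_clamp s)).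
    by rewrite {1}(proj1 (tau_psi_clamp s)).
  - rewrite tau_iter0 psi0; ring.
Qed.

(** Since [tau] fixes 0 and [psi] is 1 there, subtracting 1 puts the function in the space; the
    oscillation does not see the shift. *)
Definition rho (n : nat) : bspace := exist _ _ (rho_based n).

Lemma ev_rho (n : nat) (s : R) : ev (rho n) s = psi (tau_iter n s) - 1.
Proof. by []. Qed.

Lemma rho_nbounded : nbounded rho 2.
Proof.
  move=> n; apply: nrm_le => s t; rewrite !ev_rho.
  have := psi_bounds (tau_iter n s); have := psi_bounds (tau_iter n t); lra.
Qed.

(** A point [u] realizing the shifted pattern is pulled back through the left or the right branch of
    [tau], according to the first sign. [tau_iter] applies [tau] innermost so that the first sign is
    read at the point and the others at its image. *)
Lemma psi_patterns (N : nat) (e : nat -> R) :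
  (forall n, e n = 1 \/ e n = -1) ->
  exists s, 0 <= s <= 1 /\ forall n, (n <= N)%nat -> psi (tau_iter n s) = e n.
Proof.
  elim: N e => [|N IH] e He.
  - case: (He O) => E.
    + exists 0; split; first lra.
      move=> n Hn; have -> : n = O by lia.
      by rewrite E /= psi0.
    + exists 1; split; first lra.
      move=> n Hn; have -> : n = O by lia.
      by rewrite E /= /psi clamp_high; lra.
  - have [u [Hu H]] := IH (fun n => e (S n)) (fun n => He (S n)).
    case: (He O) => E.
    + have [H1 H2] := tau_left u Hu.
      exists (u / 3); split; first lra.
      move=> [|n] Hn /=; first by rewrite H2 E.
      by rewrite H1; apply: H; lia.
    + have [H1 H2] := tau_right u Hu.
      exists ((2 + u) / 3); split; first lra.
      move=> [|n] Hn /=; first by rewrite H2 E.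
      by rewrite H1; apply: H; lia.
Qed.

(** Points realizing the signs of [a] and the opposite signs up to [N] make the values differ by
    [2 |a_n|] in each of the leading terms, so the oscillation is at least about [2 * pn a]. *)
Lemma rho_lower (a : l1) : pn a <= nrm (lin rho a).
Proof.
  suff : 2 * pn a <= nrm (lin rho a) by have := pn_ge0 a; lra.
  (* Of the factor 4, two come from the leading terms falling short of [2 * pn a], and two from the
     uncontrolled tail, each of whose terms may be as low as [- 2 |a_n|]. *)
  apply: (le_of_lim _ _ (fun N => 4 * (pn a - sum_n (fun n => Rabs (cf a n)) N))); last first.
    apply: lim_scal0.
    replace (Finite 0) with (Finite (pn a - pn a)) by (f_equal; ring).
    apply: is_lim_seq_minus'; first exact: is_lim_seq_const.
    exact: (series_lim _ (l1_abs a)).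
  move=> N; pose e n := match excluded_middle_informative (0 <= cf a n) with left _ => 1 | right _ => -1 end.
  have He n : e n = 1 \/ e n = -1 by rewrite /e; case: excluded_middle_informative; auto.
  have He' n : - e n = 1 \/ - e n = -1 by case: (He n) => ->; [right | left]; ring.
  have Hea n : cf a n * e n = Rabs (cf a n).
    rewrite /e; case: excluded_middle_informative => [H|/Rnot_le_lt H].
    - rewrite Rabs_pos_eq; lra.
    - rewrite Rabs_left; lra.
  have [s [_ Hs]] := psi_patterns N e He.
  have [t [_ Ht]] := psi_patterns N (fun n => - e n) He'.
  pose b n := cf a n * ev (rho n) s - cf a n * ev (rho n) t.
  have Hb n : Rabs (b n) <= 2 * Rabs (cf a n).
    rewrite /b -Rmult_minus_distr_l Rabs_mult Rmult_comm.
    apply: Rmult_le_compat_r; first exact: Rabs_pos.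
    exact: Rle_trans (nrm_diff _ _ _) (rho_nbounded n).
  have H2 := ex_series_scal_l 2 _ (l1_abs a).
  have /Rabs_le_between [Hlow _] := series_tail_bound b _ N Hb H2.
  have Hn : Series b <= nrm (lin rho a).
    have := nrm_diff (lin rho a) s t; rewrite !(ev_lin rho 2); try exact: rho_nbounded.
    rewrite -Series_minus; try exact: lin_ex rho_nbounded.
    exact: Rle_trans (Rle_abs _).
  have Hr (x y : R) : x * (y - 1) - x * (- y - 1) = 2 * (x * y) by ring.
  have Hsum : sum_n b N = 2 * sum_n (fun n => Rabs (cf a n)) N.
    rewrite -sum_n_scal.
    apply: sum_n_ext_loc => n Hn'; rewrite /b !ev_rho Hs // Ht // -Hea. exact: Hr.
  have Hsum2 : sum_n (fun n => 2 * Rabs (cf a n)) N = 2 * sum_n (fun n => Rabs (cf a n)) N.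
    exact: sum_n_scal.
  rewrite Hsum Hsum2 Series_scal_l -pn_l1 in Hlow; lra.
Qed.

(** * Separability *)

(** The tent of height 1 on [-1,1], written as a difference so that its integer translates telescope
    to a partition of unity. *)
Definition hat (u : R) : R := clamp (u + 1) - clamp u.

Lemma hat_ge0 (u : R) : 0 <= hat u.
Proof. rewrite /hat; have := clamp_le u (u + 1); lra. Qed.

Lemma hat_support (u : R) : 1 <= Rabs u -> hat u = 0.
Proof.
  rewrite /hat => H; case: (Rle_dec 0 u) => Hu.
  - by rewrite Rabs_pos_eq // in H; rewrite !clamp_high; lra.
  - by rewrite Rabs_left in H; rewrite ?clamp_low; lra.
Qed.

Lemma hat_sum (v : R) (n : nat) :
  sum_n (fun i => hat (v - INR i)) n = clamp (v + 1) - clamp (v - INR n) :> R.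
Proof.
  elim: n => [|n IH]; first by rewrite sum_O /hat /= Rminus_0_r.
  rewrite sum_Sn IH /plus /hat S_INR /=.
  have -> : v - (INR n + 1) + 1 = v - INR n by ring.
  ring.
Qed.

Lemma hat_partition (s : R) (N : nat) :
  sum_n (fun i => hat (INR N * clamp s - INR i)) N = 1 :> R.
Proof.
  have Hs := clamp_bounds s; have HN := pos_INR N.
  rewrite hat_sum clamp_high; last by have := Rmult_le_pos _ _ HN (proj1 Hs); lra.
  rewrite clamp_low; [ring | nra].
Qed.

(** A signed multiple of [1 / N], the sign being coded by a difference of naturals: the data of an
    interpolant is a finite list of pairs of naturals, hence countable. *)
Definition grid_value (N : nat) (L : list (nat * nat)) (i : nat) : R :=
  (INR (fst (nth i L (O, O))) - INR (snd (nth i L (O, O)))) / INR N.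

Definition interp (N : nat) (q : nat -> R) (s : R) : R :=
  sum_n (fun i => q i * hat (INR N * clamp s - INR i)) N.

Lemma hat_cont (N i : nat) (s : R) : continuity_pt (fun s => hat (INR N * clamp s - INR i)) s.
Proof.
  have H c : continuity_pt (fun s => clamp (INR N * clamp s - c)) s.
    apply: (cont_comp (fun s => INR N * clamp s - c)); last exact: clamp_cont.
    apply: (continuity_pt_minus (fun s => INR N * clamp s) (fun _ => c)).
      apply: continuity_pt_scal; exact: clamp_cont.
    by apply: continuity_pt_const.
  apply: (continuity_pt_ext (fun s => clamp (INR N * clamp s - (INR i - 1)) - clamp (INR N * clamp s - INR i))).
    by move=> t; rewrite /hat; do 2 f_equal; ring.
  exact: (continuity_pt_minus (fun s => clamp (INR N * clamp s - (INR i - 1)))).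
Qed.

Lemma interp_cont (N : nat) (q : nat -> R) (s : R) : continuity_pt (interp N q) s.
Proof.
  suff H n : continuity_pt (fun s => sum_n (fun i => q i * hat (INR N * clamp s - INR i)) n) s.
    exact: H.
  elim: n => [|n IH].
  - apply: (continuity_pt_ext (fun s => q O * hat (INR N * clamp s - INR 0))).
      by move=> t; rewrite sum_O.
    apply: continuity_pt_scal; exact: hat_cont.
  - apply: (continuity_pt_ext (fun s => sum_n (fun i => q i * hat (INR N * clamp s - INR i)) n +
      q (S n) * hat (INR N * clamp s - INR (S n)))).
      by move=> t; rewrite sum_Sn.
    apply: (continuity_pt_plus (fun s => sum_n _ n)) => //.
    apply: continuity_pt_scal; exact: hat_cont.
Qed.

Lemma interp_based (N : nat) (q : nat -> R) : based (fun s => interp N q s - interp N q 0).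
Proof.
  split; [|split].
  - move=> s; apply: (continuity_pt_minus (interp N q) (fun _ => interp N q 0)).
      exact: interp_cont.
    by apply: continuity_pt_const.
  - by move=> s; rewrite /interp clamp_idem.
  - ring.
Qed.

Definition binterp (N : nat) (q : nat -> R) : bspace := exist _ _ (interp_based N q).

(** The interpolant is a convex combination of the values [q i], and the weights vanish at every
    node at distance [1 / N] or more, so only nearby nodes have to be compared with [x s]. *)
Lemma interp_error (N : nat) (q : nat -> R) (x : R -> R) (e : R) (s : R) :
  (forall i, (i <= N)%nat -> Rabs (INR N * clamp s - INR i) < 1 -> Rabs (x s - q i) <= e) ->
  Rabs (x s - interp N q s) <= e.
Proof.
  move=> H.
  have E1 := hat_partition s N.
  have Hn n : (n <= N)%nat -> Rabs (x s * sum_n (fun i => hat (INR N * clamp s - INR i)) n -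
      sum_n (fun i => q i * hat (INR N * clamp s - INR i)) n) <=
      e * sum_n (fun i => hat (INR N * clamp s - INR i)) n.
    have Hterm i : (i <= N)%nat -> Rabs ((x s - q i) * hat (INR N * clamp s - INR i)) <=
        e * hat (INR N * clamp s - INR i).
      move=> Hi; case: (Rle_dec 1 (Rabs (INR N * clamp s - INR i))) => Hc.
        by rewrite (hat_support _ Hc) !Rmult_0_r Rabs_R0; right.
      rewrite Rabs_mult (Rabs_pos_eq (hat _)); last exact: hat_ge0.
      apply: Rmult_le_compat_r; [exact: hat_ge0 | apply: H => //; lra].
    elim: n => [|n IH] Hn.
      rewrite !sum_O; have := Hterm O Hn.
      by rewrite Rmult_minus_distr_r.
    rewrite !sum_Sn /plus /=; have := Hterm (S n) Hn; have := IH ltac:(lia).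
    set A := sum_n _ n; set B := sum_n _ n; set h := hat _ => H1 H2.
    have -> : x s * (A + h) - (B + q (S n) * h) = (x s * A - B) + (x s - q (S n)) * h by ring.
    apply: Rle_trans (Rabs_triang _ _) _; lra.
  have := Hn N (Nat.le_refl N); by rewrite E1 !Rmult_1_r.
Qed.

Lemma grid_round (N : nat) (v : R) :
  (0 < N)%nat -> exists p : nat * nat, Rabs (v - (INR (fst p) - INR (snd p)) / INR N) <= / INR N.
Proof.
  move=> HN; have HN' : 0 < INR N by apply: lt_0_INR.
  have [H1 H2] := archimed (v * INR N).
  (* Positive and negative part of an integer: [Z.to_nat] cuts negative numbers off at 0, so at
     least one entry is 0. *)
  exists (Z.to_nat (up (v * INR N)), Z.to_nat (- up (v * INR N))) => /=.
  have -> : INR (Z.to_nat (up (v * INR N))) - INR (Z.to_nat (- up (v * INR N))) = IZR (up (v * INR N)).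
    rewrite !INR_IZR_INZ -minus_IZR; f_equal; lia.
  have -> : v - IZR (up (v * INR N)) / INR N = (v * INR N - IZR (up (v * INR N))) * / INR N.
    by field; lra.
  rewrite Rabs_mult (Rabs_pos_eq (/ INR N)); last by left; exact: Rinv_0_lt_compat.
  rewrite -{2}(Rmult_1_l (/ INR N)); apply: Rmult_le_compat_r; first by left; exact: Rinv_0_lt_compat.
  apply: Rabs_le; lra.
Qed.

Lemma inv_nat_small (e : R) : 0 < e -> exists N, (0 < N)%nat /\ / INR N < e.
Proof.
  move=> He; have [N [H1 H2]] := archimed_cor1 e He; by exists N.
Qed.

(** Uniform continuity and rounding of the nodal values cost [e / 4] each; the resulting uniform
    error [e / 2] doubles in the oscillation norm. *)
Lemma interp_dense (x : bspace) (e : R) :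
  0 < e -> exists N L, bd x (binterp N (grid_value N L)) <= e.
Proof.
  move=> He.
  have He8 : 0 < e / 4 by lra.
  have [d Hd] := Heine_cor2 (fun s _ => ev_cont x s : continuity_pt (ev x) s) (mkposreal _ He8) : { d : posreal | forall s t, 0 <= s <= 1 -> 0 <= t <= 1 -> Rabs (s - t) < d -> Rabs (ev x s - ev x t) < e / 4 }.
  have [N [HN HNe]] := inv_nat_small (Rmin d (e / 4)) (Rmin_pos _ _ (cond_pos d) He8).
  have HNd : / INR N < d := Rlt_le_trans _ _ _ HNe (Rmin_l _ _).
  have HN4 : / INR N < e / 4 := Rlt_le_trans _ _ _ HNe (Rmin_r _ _).
  have HN' : 0 < INR N by apply: lt_0_INR.
  pose p i := constructive_indefinite_description _ (grid_round N (ev x (INR i / INR N)) HN).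
  exists N, (map (fun i => proj1_sig (p i)) (seq 0 (S N))).
  set L := map _ _.
  have HL i : (i <= N)%nat -> Rabs (ev x (INR i / INR N) - grid_value N L i) <= e / 4.
    move=> Hi; apply: Rle_trans (Rlt_le _ _ HN4).
    have E : nth i L (O, O) = proj1_sig (p i).
      rewrite (nth_indep L _ (proj1_sig (p O))); last by rewrite length_map length_seq; lia.
      by rewrite /L (map_nth (fun i => proj1_sig (p i))) seq_nth //; lia.
    rewrite /grid_value E; exact: proj2_sig (p i).
  have Herr s : Rabs (ev x s - interp N (grid_value N L) s) <= e / 2.
    apply: interp_error => i Hi Hs.
    have Hin : Rabs (ev x (clamp s) - ev x (INR i / INR N)) < e / 4.
      apply: Hd; first exact: clamp_bounds.
      - split; first by apply: Rdiv_le_0_compat => //; exact: pos_INR.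
        apply/(Rle_div_l _ _ _ HN'); rewrite Rmult_1_l; apply: le_INR; exact: Hi.
      - have -> : clamp s - INR i / INR N = (INR N * clamp s - INR i) * / INR N by field; lra.
        rewrite Rabs_mult (Rabs_pos_eq (/ INR N)); last by left; exact: Rinv_0_lt_compat.
        apply: Rlt_trans HNd; rewrite -{2}(Rmult_1_l (/ INR N)).
        apply: Rmult_lt_compat_r => //; exact: Rinv_0_lt_compat.
    rewrite -ev_clamp in Hin; have := HL i Hi.
    have := Rabs_triang (ev x s - ev x (INR i / INR N)) (ev x (INR i / INR N) - grid_value N L i).
    have -> : ev x s - ev x (INR i / INR N) + (ev x (INR i / INR N) - grid_value N L i) =
      ev x s - grid_value N L i by ring.
    lra.
  apply: nrm_le => s t; rewrite !ev_lc.
  have Hev r : ev (binterp N (grid_value N L)) r = interp N (grid_value N L) r - interp N (grid_value N L) 0 by [].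
  rewrite !Hev.
  have /Rabs_le_between := Herr s; have /Rabs_le_between := Herr t; lra.
Qed.

Fixpoint decode (l n : nat) : list (nat * nat) :=
  match l with
  | O => nil
  | S m => of_nat (fst (of_nat n)) :: decode m (snd (of_nat n))
  end.

Lemma decode_surj (L : list (nat * nat)) : exists n, decode (length L) n = L.
Proof.
  elim: L => [|p L [n Hn]]; first by exists O.
  exists (to_nat (to_nat p, n)).
  change (of_nat (fst (of_nat (to_nat (to_nat p, n)))) ::
    decode (length L) (snd (of_nat (to_nat (to_nat p, n)))) = p :: L).
  by rewrite !cancel_of_to Hn.
Qed.

Definition grid_element (n : nat) : bspace :=
  let (N, m) := of_nat n in let (l, c) := of_nat m in binterp N (grid_value N (decode l c)).

Lemma grid_element_surj (N : nat) (L : list (nat * nat)) :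
  exists n, grid_element n = binterp N (grid_value N L).
Proof.
  have [c Hc] := decode_surj L.
  exists (to_nat (N, to_nat (length L, c))); by rewrite /grid_element !cancel_of_to Hc.
Qed.

(** The ball has radius 2, not 1, because of the later use in a quotient: a class at distance 1 need
    not have a representative of norm 1, but it has one of norm below 3/2. *)
Lemma dense_sequence : exists D : nat -> bspace, nbounded D 2 /\
  forall x e, 0 < e -> nrm x < 2 -> exists n, bd x (D n) < e.
Proof.
  pose D n := match Rle_dec (nrm (grid_element n)) 2 with
    left _ => grid_element n | right _ => bzero end.
  exists D; split.
  - move=> n; rewrite /D; case: Rle_dec => // _; rewrite nrm_bzero; lra.
  - move=> x e He Hx.
    (* Approximating also within [2 - nrm x] keeps the grid element inside the ball, where [D] does
       not replace it by zero. *)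
    have Hm : 0 < Rmin e (2 - nrm x) by apply: Rmin_pos; lra.
    have [N [L HL]] := interp_dense x (Rmin e (2 - nrm x) / 2) ltac:(lra).
    have H1 := Rmin_l e (2 - nrm x); have H2 := Rmin_r e (2 - nrm x).
    have [n Hn] := grid_element_surj N L.
    exists n; rewrite /D Hn; case: Rle_dec => [_|Hc]; first lra.
    exfalso; apply: Hc.
    have := sn_le_sub _ nrm_lc (binterp N (grid_value N L)) x.
    rewrite (sn_sub_sym _ nrm_lc) -/(bd _ _); lra.
Qed.

(** * Continuous selections *)

Section Selection.
Variable p : bspace -> R.
Hypothesis Hp : seminorm p.
Hypothesis Hpn : forall x, p x <= nrm x.

Fixpoint fin_lin (E : nat -> bspace) (a : l1) (N : nat) : bspace :=
  match N with
  | O => blc (cf a O) (E O) 0 bzero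
  | S n => blc 1 (fin_lin E a n) (cf a (S n)) (E (S n))
  end.

Lemma ev_fin_lin (E : nat -> bspace) (a : l1) (N : nat) (s : R) :
  ev (fin_lin E a N) s = sum_n (fun n => cf a n * ev (E n) s) N.
Proof.
  elim: N => [|N IH]; first by rewrite sum_O /= ev_lc; ring.
  by rewrite sum_Sn /= ev_lc IH Rmult_1_l.
Qed.

Lemma sn_fin_lin (E : nat -> bspace) (a : l1) (N : nat) :
  p (fin_lin E a N) <= sum_n (fun n => Rabs (cf a n) * p (E n)) N.
Proof.
  elim: N => [|N IH].
    by rewrite sum_O /=; have := Hp (cf a O) (E O) 0 bzero; rewrite Rabs_R0; lra.
  rewrite sum_Sn /plus /=.
  have := Hp 1 (fin_lin E a N) (cf a (S N)) (E (S N)); rewrite Rabs_R1; lra.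
Qed.

Lemma sn_lin_ex (E : nat -> bspace) (B : R) (a : l1) :
  nbounded E B -> ex_series (fun n => Rabs (cf a n) * p (E n)).
Proof.
  move=> HE; apply: (ex_series_le_pos _ (fun n => B * Rabs (cf a n))).
  - move=> n; have := Rabs_pos (cf a n); have := sn_ge0 p Hp (E n).
    have := Hpn (E n); have := HE n => *; split; first by apply: Rmult_le_pos.
    rewrite Rmult_comm; apply: Rmult_le_compat_r => //; lra.
  - exact: (ex_series_scal_l B _ (l1_abs a)).
Qed.

(** The inequality holds for finite sums by subadditivity and passes to the limit because [p <= nrm]
    makes the seminorm of the tails vanish. *)
Lemma sn_lin (E : nat -> bspace) (B : R) (a : l1) :
  nbounded E B -> p (lin E a) <= Series (fun n => Rabs (cf a n) * p (E n)).
Proof.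
  move=> HE.
  have HB := ex_series_scal_l B _ (l1_abs a).
  apply: (le_of_lim _ _ (fun N => Series (fun n => B * Rabs (cf a n)) - sum_n (fun n => B * Rabs (cf a n)) N)); last first.
    replace (Finite 0) with (Finite (Series (fun n => B * Rabs (cf a n)) - Series (fun n => B * Rabs (cf a n)))) by (f_equal; ring).
    apply: is_lim_seq_minus'; [exact: is_lim_seq_const | exact: series_lim].
  move=> N; have H1 := sn_fin_lin E a N.
  have H2 : sum_n (fun n => Rabs (cf a n) * p (E n)) N <= Series (fun n => Rabs (cf a n) * p (E n)).
    apply: series_pos_partial; last exact: sn_lin_ex HE.
    move=> n; apply: Rmult_le_pos; [exact: Rabs_pos | exact: sn_ge0].
  have H3 := sn_le_sub p Hp (lin E a) (fin_lin E a N).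
  have H4 := Hpn (blc 1 (lin E a) (-1) (fin_lin E a N)).
  have H5 : nrm (blc 1 (lin E a) (-1) (fin_lin E a N)) <=
      Series (fun n => B * Rabs (cf a n)) - sum_n (fun n => B * Rabs (cf a n)) N.
    apply: nrm_le => s t; rewrite !ev_lc !(ev_lin E B) // !ev_fin_lin.
    pose b n := cf a n * ev (E n) s - cf a n * ev (E n) t.
    have Hb n : Rabs (b n) <= B * Rabs (cf a n).
      rewrite /b -Rmult_minus_distr_l Rabs_mult Rmult_comm.
      apply: Rmult_le_compat_r; first exact: Rabs_pos.
      exact: Rle_trans (nrm_diff _ _ _) (HE n).
    have := series_tail_bound b _ N Hb HB.
    have -> : sum_n b N = sum_n (fun n => cf a n * ev (E n) s) N - sum_n (fun n => cf a n * ev (E n) t) N.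
      elim: N {H1 H2 H3 H4} => [|N IH]; first by rewrite !sum_O.
      rewrite !sum_Sn IH /plus /= /b; lra.
    rewrite Series_minus; [|exact: lin_ex HE|exact: lin_ex HE].
    move/Rabs_le_between; lra.
  lra.
Qed.

Variable D : nat -> bspace.
Hypothesis HD : nbounded D 2.
Hypothesis Hdense : forall x, 0 < p x -> exists n, p (blc 1 x (- p x) (D n)) < p x / 2.

Definition defect (x : bspace) (n : nat) : bspace := blc 1 x (- p x) (D n).

(* Positive exactly when [p x * D n] approximates [x] up to [p x / 2]; the convex
   combination with these weights, times [p x], is then as close to [x]. *)
Definition weight (x : bspace) (n : nat) : R :=
  (/ 2) ^ n * ((p x - 2 * p (defect x n) + Rabs (p x - 2 * p (defect x n))) / 2).

Lemma weight_bounds (x : bspace) (n : nat) : 0 <= weight x n <= p x * (/ 2) ^ n.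
Proof.
  rewrite /weight; have H2 := half_pow_pos n.
  have H := sn_ge0 p Hp (defect x n); have H' := sn_ge0 p Hp x.
  set y := p x - _; have Hy : y <= p x by rewrite /y; lra.
  have Hr : 0 <= (y + Rabs y) / 2 <= p x.
    by case: (Rle_dec 0 y) => Hy0; [rewrite Rabs_pos_eq | rewrite Rabs_left]; lra.
  split; nra.
Qed.

Lemma weight_ex (x : bspace) : ex_series (weight x).
Proof.
  apply: (ex_series_le_pos _ (fun n => p x * (/ 2) ^ n)); first exact: weight_bounds.
  exact: (ex_series_scal_l (p x) _ half_pow_series).
Qed.

Definition total (x : bspace) : R := Series (weight x).

Lemma total_pos (x : bspace) : 0 < p x -> 0 < total x.
Proof.
  move=> Hx; have [n Hn] := Hdense x Hx.
  apply: (Rlt_le_trans _ (weight x n)); last first.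
    apply: series_pos_term (weight_ex x) => m; by case: (weight_bounds x m).
  rewrite /weight -/(defect x n) in Hn *.
  apply: Rmult_lt_0_compat; first exact: half_pow_pos.
  rewrite Rabs_pos_eq; lra.
Qed.

(* [0] when [p x = 0], where [total x = 0] too. *)
Definition coeff (x : bspace) (n : nat) : R := p x * (weight x n / total x).

Lemma coeff_ge0 (x : bspace) (n : nat) : 0 <= coeff x n.
Proof.
  case: (sn_ge0 p Hp x) => [Hx|Hx]; last by rewrite /coeff -Hx; lra.
  apply: Rmult_le_pos; first lra.
  apply: Rdiv_le_0_compat; [by case: (weight_bounds x n) | exact: total_pos].
Qed.

Lemma coeff_ex (x : bspace) : ex_series (fun n => Rabs (coeff x n)).
Proof.
  apply: (ex_series_eq (fun n => (p x * / total x) * weight x n)).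
    by move=> n; rewrite Rabs_pos_eq; [rewrite /coeff /Rdiv; ring | exact: coeff_ge0].
  exact: (ex_series_scal_l (p x * / total x) _ (weight_ex x)).
Qed.

Definition first_approx (x : bspace) : l1 := exist _ (coeff x : nat -> realn) (coeff_ex x).

Lemma cf_first_approx (x : bspace) (n : nat) : cf (first_approx x) n = coeff x n.
Proof. by []. Qed.

Lemma pn_first_approx (x : bspace) : pn (first_approx x) = p x.
Proof.
  rewrite pn_l1 (Series_ext _ (fun n => (p x * / total x) * weight x n)); last first.
    by move=> n; rewrite Rabs_pos_eq; [rewrite cf_first_approx /coeff /Rdiv; ring | exact: coeff_ge0].
  rewrite Series_scal_l -/(total x).
  case: (sn_ge0 p Hp x) => [Hx|<-]; last by ring.
  field; have := total_pos x Hx; lra.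
Qed.

Definition remainder (x : bspace) (a : l1) : bspace := blc 1 x (-1) (lin D a).

Lemma first_approx_contract (x : bspace) : p (remainder x (first_approx x)) <= p x / 2.
Proof.
  case: (sn_ge0 p Hp x) => [Hx|Hx]; last first.
    have := Hp 1 x (-1) (lin D (first_approx x)).
    have := Hpn (lin D (first_approx x)); have := nrm_lin D 2 (first_approx x) HD.
    rewrite pn_first_approx -Hx Rabs_Ropp Rabs_R1 /remainder; lra.
  have HW := total_pos x Hx.
  have Hlex : ex_series (fun n => Rabs (weight x n / total x)).
    apply: (ex_series_eq (fun n => / total x * weight x n)).
      move=> n; rewrite Rabs_pos_eq; first by rewrite /Rdiv; ring.
      apply: Rdiv_le_0_compat => //; by case: (weight_bounds x n).
    exact: (ex_series_scal_l (/ total x) _ (weight_ex x)).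
  have [lam Hlam] := mk_l1_abs _ Hlex.
  have Hlam0 n : 0 <= cf lam n.
    by rewrite Hlam; apply: Rdiv_le_0_compat => //; case: (weight_bounds x n).
  have Hlex' : ex_series (cf lam).
    by apply: ex_series_ext (l1_abs lam) => n; rewrite Rabs_pos_eq.
  have Hsum : Series (cf lam) = 1.
    rewrite (Series_ext _ (fun n => / total x * weight x n)); last by move=> n; rewrite Hlam /Rdiv; ring.
    rewrite Series_scal_l -/(total x); field; lra.
  have HE : nbounded (defect x) (nrm x + 2 * p x).
    move=> n; have := nrm_lc 1 x (- p x) (D n); rewrite Rabs_R1 Rabs_Ropp Rabs_pos_eq; last lra.
    have := HD n; rewrite /defect => H1 H2; have := nrm_ge0 (D n); nra.
  (* The normalized weights [lam] sum to 1, so [x] is their combination of copies of [x], and the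
     remainder is the same combination of the defects. A defect with seminorm above [p x / 2] has
     weight 0. *)
  have -> : remainder x (first_approx x) = lin (defect x) lam.
    apply: b_ext => s; rewrite ev_lc (ev_lin D 2) // (ev_lin (defect x) _ _ _ HE).
    rewrite [RHS](Series_ext _ (fun n => cf lam n * ev x s - cf (first_approx x) n * ev (D n) s)); last first.
      by move=> n; rewrite /defect ev_lc Hlam cf_first_approx /coeff; ring.
    rewrite Series_minus; [|exact: ex_series_scal_r|exact: lin_ex HD].
    rewrite Series_scal_r Hsum; ring.
  apply: Rle_trans (sn_lin _ _ _ HE) _.
  have -> : p x / 2 = Series (fun n => cf lam n * (p x / 2)) by rewrite Series_scal_r Hsum; ring.
  apply: Series_le; last exact: ex_series_scal_r.
  move=> n; rewrite Rabs_pos_eq //; split.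
    apply: Rmult_le_pos => //; exact: sn_ge0.
  case: (Rle_dec (p (defect x n)) (p x / 2)) => Hc; first exact: Rmult_le_compat_l.
  have -> : cf lam n = 0; last by lra.
  rewrite Hlam /weight Rabs_left1; [rewrite /Rdiv; ring | lra].
Qed.

Lemma defect_cont (u : nat -> bspace) (x : bspace) (n : nat) :
  is_lim_seq (fun k => p (blc 1 (u k) (-1) x)) 0 ->
  is_lim_seq (fun k => p (defect (u k) n)) (p (defect x n)).
Proof.
  (* One from the change of [x], and [p (D n) <= 2] times the change of the factor [p x]. *)
  move=> H; apply: (lim_squeeze _ (fun k => 3 * p (blc 1 (u k) (-1) x)) _ 0); last exact: lim_scal0.
  move=> k _; apply: Rle_trans (sn_sub_abs p Hp _ _) _.
  have -> : blc 1 (defect (u k) n) (-1) (defect x n) =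
      blc 1 (blc 1 (u k) (-1) x) (p x - p (u k)) (D n).
    by apply: b_ext => s; rewrite /defect !ev_lc; ring.
  have := Hp 1 (blc 1 (u k) (-1) x) (p x - p (u k)) (D n).
  rewrite Rabs_R1 Rabs_minus_sym.
  have := sn_sub_abs p Hp (u k) x; have := Rabs_pos (p (u k) - p x).
  have := Hpn (D n); have := HD n; have := sn_ge0 p Hp (D n); nra.
Qed.

Lemma sn_cont (u : nat -> bspace) (x : bspace) :
  is_lim_seq (fun k => p (blc 1 (u k) (-1) x)) 0 -> is_lim_seq (fun k => p (u k)) (p x).
Proof.
  move=> H; apply: (lim_squeeze _ _ _ 0 _ H) => k _; exact: sn_sub_abs.
Qed.

Lemma weight_cont (u : nat -> bspace) (x : bspace) (n : nat) :
  is_lim_seq (fun k => p (blc 1 (u k) (-1) x)) 0 ->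
  is_lim_seq (fun k => weight (u k) n) (weight x n).
Proof.
  move=> H; rewrite /weight.
  have L : is_lim_seq (fun k => p (u k) - 2 * p (defect (u k) n)) (p x - 2 * p (defect x n)).
    apply: is_lim_seq_minus'; first exact: sn_cont.
    exact: (is_lim_seq_scal_l _ 2 _ (defect_cont u x n H)).
  apply: (is_lim_seq_scal_l _ ((/ 2) ^ n) (Finite _)).
  apply: (is_lim_seq_scal_r _ (/ 2) (Finite _)).
  apply: is_lim_seq_plus' => //; exact: (is_lim_seq_abs _ _ L).
Qed.

Lemma total_cont (u : nat -> bspace) (x : bspace) :
  is_lim_seq (fun k => p (blc 1 (u k) (-1) x)) 0 ->
  is_lim_seq (fun k => total (u k)) (total x).
Proof.
  move=> H; have L := sn_cont u x H.
  apply: (proj2 (series_pratt (fun k => weight (u k)) (fun k n => p (u k) * (/ 2) ^ n) _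
    (fun n => p x * (/ 2) ^ n) _ _ _ _ _ _)).
  - move=> k i; exact: weight_bounds.
  - move=> k; exact: (ex_series_scal_l (p (u k)) _ half_pow_series).
  - exact: (ex_series_scal_l (p x) _ half_pow_series).
  - move=> i; exact: weight_cont.
  - move=> i; exact: (is_lim_seq_scal_r _ ((/ 2) ^ i) (Finite _)).
  - rewrite Series_scal_l.
    apply: (is_lim_seq_ext (fun k => p (u k) * Series (fun n => (/ 2) ^ n))).
      by move=> k; rewrite Series_scal_l.
    exact: (is_lim_seq_scal_r _ (Series (fun n => (/ 2) ^ n)) (Finite _)).
Qed.

(** The norms converge because they equal [p]. For the coordinates, dividing by [total x] is
    harmless when [p x > 0]; when [p x = 0] every coordinate is squeezed by the norm, which tends to
    0. *)
Lemma first_approx_cont (u : nat -> bspace) (x : bspace) :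
  is_lim_seq (fun k => p (blc 1 (u k) (-1) x)) 0 ->
  cv (fun k => first_approx (u k)) (first_approx x).
Proof.
  move=> H; have L := sn_cont u x H; split; last first.
    change (is_lim_seq (fun k => pn (first_approx (u k))) (pn (first_approx x))).
    rewrite pn_first_approx; apply: is_lim_seq_ext L => k; by rewrite pn_first_approx.
  move=> n; change (is_lim_seq (fun k => coeff (u k) n) (coeff x n)).
  case: (sn_ge0 p Hp x) => [Hx|Hx].
  - apply: is_lim_seq_mult' => //; apply: is_lim_seq_div'.
    + exact: weight_cont.
    + exact: total_cont.
    + have := total_pos x Hx; lra.
  - rewrite -Hx in L; apply: (lim_squeeze _ _ _ 0 _ L) => k _.
    have -> : coeff x n = 0 by rewrite /coeff -Hx; ring.
    rewrite Rminus_0_r -(pn_first_approx (u k)); exact: (l1_coord (first_approx (u k)) n).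
Qed.

Lemma first_approx_scal (c : R) (x : bspace) :
  0 < c -> first_approx (blc c x 0 bzero) = l1lc c (first_approx x) 0 l1zero.
Proof.
  move=> Hc.
  have Ep : p (blc c x 0 bzero) = c * p x by rewrite sn_scal // Rabs_pos_eq; lra.
  have Ed n : p (defect (blc c x 0 bzero) n) = c * p (defect x n).
    have -> : defect (blc c x 0 bzero) n = blc c (defect x n) 0 bzero.
      by apply: b_ext => s; rewrite /defect Ep !ev_lc; ring.
    rewrite sn_scal // Rabs_pos_eq; lra.
  have Ew n : weight (blc c x 0 bzero) n = c * weight x n.
    rewrite /weight Ep Ed.
    have -> : c * p x - 2 * (c * p (defect x n)) = c * (p x - 2 * p (defect x n)) by ring.
    rewrite Rabs_mult (Rabs_pos_eq c); [rewrite /Rdiv; ring | lra].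
  have Et : total (blc c x 0 bzero) = c * total x.
    by rewrite /total -Series_scal_l; apply: Series_ext.
  apply: l1_ext => n; rewrite cf_lc !cf_first_approx cf_l1zero /coeff Ep Ew Et.
  (* When the total vanishes, both sides are 0 by the convention [/ 0 = 0]. *)
  case: (Req_dec (total x) 0) => Ht.
    rewrite Ht Rmult_0_r /Rdiv Rinv_0; ring.
  field; split; lra.
Qed.

(** Successive correction as in the open mapping theorem: each step adds coefficients of norm equal
    to the seminorm of the current remainder and halves that seminorm, so the sequence is
    geometrically Cauchy. *)
Fixpoint approx (x : bspace) (K : nat) : l1 :=
  match K with
  | O => l1zero
  | S n => l1lc 1 (approx x n) 1 (first_approx (remainder x (approx x n)))
  end.

Lemma remainder_zero (x : bspace) : remainder x l1zero = x.
Proof.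
  apply: b_ext => s; rewrite /remainder ev_lc (ev_lin D 2) //.
  rewrite (Series_ext _ (fun _ => 0)); last by move=> n; rewrite cf_l1zero; ring.
  rewrite series_const0; ring.
Qed.

Lemma remainder_plus (x : bspace) (a b : l1) :
  remainder x (l1lc 1 a 1 b) = remainder (remainder x a) b.
Proof.
  rewrite /remainder (lin_lc D 2) //; apply: b_ext => s; rewrite !ev_lc; ring.
Qed.

Lemma approx_remainder (x : bspace) (K : nat) : p (remainder x (approx x K)) <= p x * (/ 2) ^ K.
Proof.
  elim: K => [|K IH] /=; first by rewrite remainder_zero; lra.
  rewrite remainder_plus; apply: Rle_trans (first_approx_contract _) _; lra.
Qed.

Lemma approx_step (x : bspace) (K : nat) : l1d (approx x (S K)) (approx x K) <= p x * (/ 2) ^ K.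
Proof.
  apply: Rle_trans (approx_remainder x K); right; rewrite -pn_first_approx /l1d.
  apply: (f_equal (@pn l1)); apply: l1_ext => n; rewrite cf_lc [approx x (S K)]/= cf_lc; ring.
Qed.

Lemma remainder_cont (u : nat -> bspace) (x : bspace) (a : nat -> l1) (b : l1) :
  is_lim_seq (fun k => p (blc 1 (u k) (-1) x)) 0 -> cv a b ->
  is_lim_seq (fun k => p (blc 1 (remainder (u k) (a k)) (-1) (remainder x b))) 0.
Proof.
  move=> H /cv_l1 Ha.
  apply: (lim_squeeze _ (fun k => p (blc 1 (u k) (-1) x) + 2 * l1d (a k) b) _ 0); last first.
    by apply: lim_plus0 => //; exact: lim_scal0.
  move=> k _; rewrite Rminus_0_r Rabs_pos_eq; last exact: sn_ge0.
  have -> : blc 1 (remainder (u k) (a k)) (-1) (remainder x b) =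
      blc 1 (blc 1 (u k) (-1) x) (-1) (lin D (l1lc 1 (a k) (-1) b)).
    by rewrite (lin_lc D 2) //; apply: b_ext => s; rewrite /remainder !ev_lc; ring.
  have := Hp 1 (blc 1 (u k) (-1) x) (-1) (lin D (l1lc 1 (a k) (-1) b)).
  rewrite Rabs_Ropp Rabs_R1.
  have := Hpn (lin D (l1lc 1 (a k) (-1) b)).
  have := nrm_lin D 2 (l1lc 1 (a k) (-1) b) HD; rewrite -/(l1d (a k) b); lra.
Qed.

Lemma approx_cont (u : nat -> bspace) (x : bspace) (K : nat) :
  is_lim_seq (fun k => p (blc 1 (u k) (-1) x)) 0 ->
  cv (fun k => approx (u k) K) (approx x K).
Proof.
  move=> H; elim: K => [|K IH].
    apply/cv_l1; apply: (is_lim_seq_ext (fun _ => 0)); last exact: is_lim_seq_const.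
    by move=> k; rewrite l1d_refl.
  apply: l1lc_cont => //; apply: first_approx_cont; exact: remainder_cont.
Qed.

Lemma approx_scal (c : R) (x : bspace) (K : nat) :
  0 < c -> approx (blc c x 0 bzero) K = l1lc c (approx x K) 0 l1zero.
Proof.
  move=> Hc; elim: K => [|K IH] /=; first by apply: l1_ext => n; rewrite cf_lc cf_l1zero; ring.
  have -> : remainder (blc c x 0 bzero) (approx (blc c x 0 bzero) K) =
      blc c (remainder x (approx x K)) 0 bzero.
    rewrite IH /remainder (lin_lc D 2) //; apply: b_ext => s; rewrite !ev_lc.
    rewrite ev_bzero; ring.
  rewrite first_approx_scal // IH; apply: l1_ext => n; rewrite !cf_lc; ring.
Qed.

(** Bartle-Graves: [lin D], read modulo the kernel of [p], gets a right inverse that is continuous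
    for [p] and positively homogeneous. Every finite stage has both properties; continuity survives
    the limit by local uniformity. *)
Theorem selection : exists s : bspace -> l1,
  (forall x, p (remainder x (s x)) = 0) /\
  (forall u x, is_lim_seq (fun k => p (blc 1 (u k) (-1) x)) 0 -> cv (fun k => s (u k)) (s x)) /\
  (forall c x, 0 <= c -> s (blc c x 0 bzero) = l1lc c (s x) 0 l1zero).
Proof.
  pose s x := proj1_sig (constructive_indefinite_description _ (l1_complete (approx x) (p x) (approx_step x))).
  have Hs x : (forall K, l1d (s x) (approx x K) <= 2 * p x * (/ 2) ^ K) /\
    (forall n, is_lim_seq (fun K => cf (approx x K) n) (cf (s x) n)).
    exact: (proj2_sig (constructive_indefinite_description _ (l1_complete (approx x) (p x) (approx_step x)))).
  exists s; split; [|split].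
  - move=> x; apply: Rle_antisym (sn_ge0 p Hp _).
    (* One from the remainder of the stage [K], and four from the image of [s x - approx x K]: its
       norm is at most [2 * p x * (/ 2) ^ K], and [lin D] at most doubles norms. *)
    apply: (le_of_lim _ _ (fun K => (5 * p x) * (/ 2) ^ K)); last exact: lim_geom0.
    move=> K; have -> : s x = l1lc 1 (approx x K) 1 (l1lc 1 (s x) (-1) (approx x K)).
      by apply: l1_ext => n; rewrite !cf_lc; ring.
    rewrite remainder_plus {1}/remainder.
    set a := l1lc 1 (s x) _ _.
    have := Hp 1 (remainder x (approx x K)) (-1) (lin D a).
    rewrite Rabs_Ropp Rabs_R1; have := approx_remainder x K.
    have := Hpn (lin D a); have := nrm_lin D 2 a HD; have [H _] := Hs x.
    have := H K; rewrite /l1d -/a; lra.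
  - move=> u x H; apply/cv_l1/lim_eps => eps He.
    have L := sn_cont u x H.
    (* Both tails, at [x] and at [u k], are at most [2 * (p x + 1) * (/ 2) ^ K] once
       [p (u k) < p x + 1]; a single stage [K] therefore serves all late [k]. *)
    have [K HK] : exists K, (4 * (p x + 1)) * (/ 2) ^ K < eps / 2.
      move/lim_eps: (lim_geom0 (4 * (p x + 1))) => /(_ (eps / 2)) [|K HK]; first lra.
      exists K; have /Rabs_def2 := HK K (Nat.le_refl K); lra.
    move/lim_eps: L => /(_ 1 Rlt_0_1) [N1 HN1].
    move/cv_l1/lim_eps: (approx_cont u x K H) => /(_ (eps / 2)) [|N2 HN2]; first lra.
    exists (Nat.max N1 N2) => k Hk.
    have /Rabs_def2 [H1 _] := HN1 k ltac:(lia).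
    have /Rabs_def2 [H2 _] := HN2 k ltac:(lia).
    rewrite Rminus_0_r Rabs_pos_eq; last exact: l1d_ge0.
    have := l1d_tri (s (u k)) (approx (u k) K) (s x).
    have := l1d_tri (approx (u k) K) (approx x K) (s x).
    rewrite (l1d_sym (approx x K) (s x)).
    have [H3 _] := Hs (u k); have [H4 _] := Hs x.
    have := H3 K; have := H4 K; have := half_pow_pos K; nra.
  - move=> c x [Hc|<-].
    + apply: l1_ext => n; have [_ H1] := Hs x; have [_ H2] := Hs (blc c x 0 bzero).
      have L : is_lim_seq (fun K => cf (approx (blc c x 0 bzero) K) n) (c * cf (s x) n + 0 * cf l1zero n).
        apply: (is_lim_seq_ext (fun K => c * cf (approx x K) n + 0 * cf l1zero n)).
          by move=> K; rewrite approx_scal.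
        apply: is_lim_seq_plus'; last exact: is_lim_seq_const.
        exact: (is_lim_seq_scal_l _ c (Finite _)).
      rewrite cf_lc.
      have := is_lim_seq_unique _ _ L; have := is_lim_seq_unique _ _ (H2 n) => -> E.
      by inversion E.
    (* [approx_scal] covers positive factors. For the factor 0, the error bound at stage 0 already
       forces the norm to be 0. *)
    + have [H _] := Hs (blc 0 x 0 bzero).
      have Hn : pn (s (blc 0 x 0 bzero)) <= 0.
        have := H O; rewrite sn_scal // Rabs_R0 pow_O /l1d [approx _ O]/=.
        have -> : l1lc 1 (s (blc 0 x 0 bzero)) (-1) l1zero = s (blc 0 x 0 bzero).
          by apply: l1_ext => n; rewrite cf_lc cf_l1zero; ring.
        lra.
      apply: l1_ext => n; rewrite pn_l1_eq0; last by apply: Rle_antisym => //; exact: pn_ge0.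
      rewrite cf_lc cf_l1zero; ring.
Qed.

End Selection.

(** * The function space is isomorphic to l1 *)

(** Just enough structure for radial arguments: scaling by nonnegative factors, a single point of
    norm 0, and convergence to that point tested by the norm alone. Unlike a vector space structure,
    it passes to the nonlinear subsets [nsub] stable under scaling. *)
Record cone (A : nspace) := Cone {
  sc : R -> A -> A;
  sc_pn : forall c x, 0 <= c -> pn (sc c x) = c * pn x;
  sc_sc : forall c d x, 0 <= c -> 0 <= d -> sc c (sc d x) = sc (c * d) x;
  sc_1 : forall x, sc 1 x = x;
  sc_cont : forall (c : nat -> R) (d : R) u x, (forall k, 0 <= c k) -> is_lim_seq c d -> cv u x ->
    cv (fun k => sc (c k) (u k)) (sc d x);
  cone_apex : forall x y : A, pn x = 0 -> pn y = 0 -> x = y;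
  cv_apex : forall (u : nat -> A) x, is_lim_seq (fun k => pn (u k)) 0 -> pn x = 0 -> cv u x }.
Arguments sc {_} _ _ _.
Arguments sc_pn {_} _ _ _ _.
Arguments sc_sc {_} _ _ _ _ _ _.
Arguments sc_1 {_} _ _.
Arguments sc_cont {_} _ _ _ _ _ _ _ _.
Arguments cone_apex {_} _ _ _ _ _.
Arguments cv_apex {_} _ _ _ _ _.

Definition homogeneous {A B : nspace} (CA : cone A) (CB : cone B) (f : A -> B) : Prop :=
  forall c a, 0 <= c -> f (sc CA c a) = sc CB c (f a).

Section Radial.
Variables (A B : nspace) (CA : cone A) (CB : cone B) (f : A -> B) (g : B -> A).
Hypothesis Hgf : forall a, g (f a) = a.
Hypothesis Hf : seq_cont f.
Hypothesis Hfh : homogeneous CA CB f.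

Definition radial (a : A) : B := sc CB (pn a / pn (f a)) (f a).

(** Scaling by 0 sends every point to the apex, so a homogeneous map preserves the apex; injectivity
    gives the converse. *)
Lemma homogeneous_apex (a : A) : pn a = 0 <-> pn (f a) = 0.
Proof.
  have H0 x : pn (sc CA 0 x) = 0 by rewrite sc_pn; lra.
  have H0' x : pn (sc CB 0 x) = 0 by rewrite sc_pn; lra.
  split=> H.
  - have -> : a = sc CA 0 a by apply: (cone_apex CA).
    by rewrite Hfh //; lra.
  - have E : f a = f (sc CA 0 a) by rewrite Hfh; [apply: (cone_apex CB) | lra].
    by rewrite -(Hgf a) E Hgf H0.
Qed.

Lemma radial_factor_ge0 (a : A) : 0 <= pn a / pn (f a).
Proof.
  case: (pn_ge0 (f a)) => H; last by rewrite -H /Rdiv Rinv_0; lra.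
  apply: Rdiv_le_0_compat => //; exact: pn_ge0.
Qed.

Lemma pn_radial (a : A) : pn (radial a) = pn a.
Proof.
  rewrite /radial sc_pn; last exact: radial_factor_ge0.
  case: (Req_dec (pn (f a)) 0) => H; last by field.
  rewrite (proj2 (homogeneous_apex a) H); rewrite H; lra.
Qed.

Lemma radial_cont : seq_cont radial.
Proof.
  move=> u x Hu; case: (pn_ge0 x) => Hx.
  - rewrite /radial; apply: (sc_cont CB (fun k => pn (u k) / pn (f (u k))) (pn x / pn (f x)) (fun k => f (u k)) (f x)).
    + move=> k; exact: radial_factor_ge0.
    + apply: is_lim_seq_div'; [exact: pn_cont | apply: pn_cont; exact: Hf |].
      move/homogeneous_apex; lra.
    + exact: Hf.
  (* At the apex the factor [pn a / pn (f a)] may fail to converge, but norms are preserved and tend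
     to 0, which suffices there. *)
  - apply: (cv_apex CB); last by rewrite pn_radial.
    rewrite Hx; apply: is_lim_seq_ext (pn_cont _ _ Hu) => k; by rewrite pn_radial.
Qed.

End Radial.

Lemma radial_inverse (A B : nspace) (CA : cone A) (CB : cone B) (f : A -> B) (g : B -> A) (a : A) :
  (forall a, g (f a) = a) -> (forall b, f (g b) = b) ->
  homogeneous CA CB f -> homogeneous CB CA g ->
  radial B A CA g (radial A B CB f a) = a.
Proof.
  move=> Hgf Hfg Hf Hg.
  have P1 := pn_radial A B CA CB f g Hgf Hf.
  have P2 := pn_radial B A CB CA g f Hfg Hg.
  case: (pn_ge0 a) => Ha; last by apply: (cone_apex CA) => //; rewrite P2 P1.
  have Hfa : pn (f a) <> 0 by move/(homogeneous_apex A B CA CB f g Hgf Hf); lra.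
  have Hfa' : 0 < pn (f a) by have := pn_ge0 (f a); lra.
  have Hl : 0 < pn a / pn (f a) by apply: Rdiv_lt_0_compat.
  have Hl0 := Rlt_le _ _ Hl.
  rewrite {1}/radial P1 {1 2}/radial Hg // Hgf sc_pn // sc_sc //; last first.
    by left; apply: Rdiv_lt_0_compat => //; apply: Rmult_lt_0_compat.
  rewrite -[RHS](sc_1 CA); f_equal; field; lra.
Qed.

Lemma iso_of_homogeneous (A B : nspace) (CA : cone A) (CB : cone B) (f : A -> B) (g : B -> A) :
  (forall a, g (f a) = a) -> (forall b, f (g b) = b) -> seq_cont f -> seq_cont g ->
  homogeneous CA CB f -> iso A B.
Proof.
  move=> Hgf Hfg Cf Cg Hf.
  have Hg : homogeneous CB CA g by move=> c b Hc; rewrite -{1}(Hfg b) -Hf // Hgf.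
  exists (radial A B CB f), (radial B A CA g); split; [|split; [|split; [|split]]].
  - move=> a; exact: radial_inverse.
  - move=> b; exact: radial_inverse.
  - exact: (radial_cont A B CA CB f g).
  - exact: (radial_cont B A CB CA g f).
  - exact: (pn_radial A B CA CB f g).
Qed.

Section ConeSub.
Variables (A : nspace) (C : cone A) (P : A -> Prop).
Hypothesis HP : forall c x, 0 <= c -> P x -> P (sc C c x).

(* Scaling is only meaningful for nonnegative factors; other factors act trivially. *)
Definition sub_sc (c : R) (x : nsub A P) : nsub A P :=
  match Rle_dec 0 c with
  | left Hc => exist _ (sc C c (proj1_sig x)) (HP c _ Hc (proj2_sig x))
  | right _ => x
  end.

Lemma sub_scE (c : R) (x : nsub A P) : 0 <= c -> proj1_sig (sub_sc c x) = sc C c (proj1_sig x).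
Proof. by move=> Hc; rewrite /sub_sc; case: Rle_dec. Qed.

Definition cone_sub : cone (nsub A P).
Proof.
  refine (Cone (nsub A P) sub_sc _ _ _ _ _ _).
  - move=> c x Hc; rewrite /pn /= sub_scE //; exact: (sc_pn C).
  - move=> c d x Hc Hd; apply: sig_ext; rewrite !sub_scE //; last exact: Rmult_le_pos.
    exact: (sc_sc C).
  - move=> x; apply: sig_ext; rewrite sub_scE; [exact: (sc_1 C) | lra].
  - move=> c d u x Hc L Hu.
    have Hd : 0 <= d.
      exact: (lim_ge0 c).
    rewrite /cv /= sub_scE //.
    have -> : (fun k => proj1_sig (sub_sc (c k) (u k))) = (fun k => sc C (c k) (proj1_sig (u k))).
      by apply: functional_extensionality => k; rewrite sub_scE.
    exact: (sc_cont C).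
  - move=> x y Hx Hy; apply: sig_ext; exact: (cone_apex C).
  - move=> u x Hu Hx; exact: (cv_apex C).
Defined.

Lemma sc_cone_sub (c : R) (x : nsub A P) :
  0 <= c -> proj1_sig (sc cone_sub c x) = sc C c (proj1_sig x).
Proof. exact: sub_scE. Qed.

End ConeSub.

Definition cone_prod (A B : nspace) (CA : cone A) (CB : cone B) : cone (dprod A B).
Proof.
  refine (Cone (dprod A B) (fun c x => (sc CA c (fst x), sc CB c (snd x))) _ _ _ _ _ _).
  - move=> c [x y] Hc; rewrite /pn /= !sc_pn //; ring.
  - by move=> c d [x y] Hc Hd /=; rewrite !sc_sc.
  - by move=> [x y] /=; rewrite !sc_1.
  - move=> c d u x Hc L [H1 H2]; split; exact: sc_cont.
  - move=> [x y] [x' y']; rewrite /pn /=.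
    have := pn_ge0 x; have := pn_ge0 y; have := pn_ge0 x'; have := pn_ge0 y' => *.
    by f_equal; [apply: (cone_apex CA) | apply: (cone_apex CB)]; lra.
  - move=> u [x y]; rewrite /pn /= => Hu Hx.
    have Hx0 := pn_ge0 x; have Hy0 := pn_ge0 y; split.
    + apply: (cv_apex CA); last by rewrite /=; lra.
      apply: (lim_squeeze _ _ _ 0 _ Hu) => k _.
      have := pn_ge0 (fst (u k)); have := pn_ge0 (snd (u k)) => *.
      rewrite Rminus_0_r Rabs_pos_eq //; lra.
    + apply: (cv_apex CB); last by rewrite /=; lra.
      apply: (lim_squeeze _ _ _ 0 _ Hu) => k _.
      have := pn_ge0 (fst (u k)); have := pn_ge0 (snd (u k)) => *.
      rewrite Rminus_0_r Rabs_pos_eq //; lra.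
Defined.

Lemma pn_l1_scal (c : R) (x : l1) : 0 <= c -> pn (l1lc c x 0 l1zero) = c * pn x.
Proof.
  move=> Hc; rewrite !pn_l1 -Series_scal_l; apply: Series_ext => n.
  rewrite cf_lc cf_l1zero Rmult_0_r Rplus_0_r Rabs_mult (Rabs_pos_eq c) //.
Qed.

Definition cone_l1 : cone l1.
Proof.
  refine (Cone l1 (fun c x => l1lc c x 0 l1zero) pn_l1_scal _ _ _ _ _).
  - move=> c d x _ _; apply: l1_ext => n; rewrite !cf_lc cf_l1zero; ring.
  - move=> x; apply: l1_ext => n; rewrite cf_lc cf_l1zero; ring.
  - move=> c d u x Hc L Hu.
    have Hd : 0 <= d.
      exact: (lim_ge0 c).
    split.
    + move=> n; apply: is_lim_seq_plus'; last exact: is_lim_seq_const.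
      apply: is_lim_seq_mult' => //; case: Hu => Hu _; exact: Hu.
    + change (is_lim_seq (fun k => pn (l1lc (c k) (u k) 0 l1zero)) (pn (l1lc d x 0 l1zero))).
      rewrite pn_l1_scal //; apply: (is_lim_seq_ext (fun k => c k * pn (u k))).
        by move=> k; rewrite pn_l1_scal.
      apply: is_lim_seq_mult' => //; exact: pn_cont.
  - move=> x y Hx Hy; apply: l1_ext => n; by rewrite !pn_l1_eq0.
  - move=> u x Hu Hx; apply/cv_l1; apply: is_lim_seq_ext Hu => k.
    rewrite /l1d; apply: (f_equal (@pn l1)); apply: l1_ext => n.
    rewrite cf_lc (pn_l1_eq0 x Hx); ring.
Defined.

Lemma nrm_scal (c : R) (x : bspace) : 0 <= c -> nrm (blc c x 0 bzero) = c * nrm x.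
Proof. by move=> Hc; rewrite (sn_scal nrm nrm_lc) Rabs_pos_eq. Qed.

Definition cone_b : cone bnspace.
Proof.
  refine (Cone bnspace (fun c x => blc c x 0 bzero) nrm_scal _ _ _ _ _).
  - move=> c d x _ _; apply: b_ext => s; rewrite !ev_lc ev_bzero; ring.
  - move=> x; apply: b_ext => s; rewrite !ev_lc ev_bzero; ring.
  - move=> c d u x Hc L Hu; exact: bscal_cont.
  - by move=> x y /nrm_eq0 -> /nrm_eq0 ->.
  - move=> u x Hu /nrm_eq0 ->; apply: is_lim_seq_ext Hu => k; rewrite /bd /pn /=.
    f_equal; apply: b_ext => s; rewrite ev_lc ev_bzero; ring.
Defined.

Lemma lin_scal (E : nat -> bspace) (B : R) (c : R) (a : l1) :
  nbounded E B -> lin E (l1lc c a 0 l1zero) = blc c (lin E a) 0 bzero.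
Proof.
  move=> HE; rewrite (lin_lc E B) //; apply: b_ext => s.
  rewrite !ev_lc (ev_lin E B l1zero) // ev_bzero; ring.
Qed.

Lemma cv_l1_unique (a b : l1) : cv (fun _ => a) b -> a = b.
Proof.
  move=> /cv_l1 H; have E := is_lim_seq_unique _ _ H; rewrite Lim_seq_const in E.
  apply: l1_ext => n; have := l1d_coord a b n; have -> : l1d a b = 0 by inversion E.
  move=> Hn; have := Rabs_pos (cf a n - cf b n) => ?.
  have : cf a n - cf b n = 0 by apply: Rabs_eq_0; lra.
  lra.
Qed.

Lemma lin_cont (E : nat -> bspace) (B : R) (u : nat -> l1) (x : l1) :
  nbounded E B -> cv u x -> is_lim_seq (fun k => bd (lin E (u k)) (lin E x)) 0.
Proof.
  move=> HE /cv_l1 Hu.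
  apply: (lim_squeeze _ (fun k => B * l1d (u k) x) _ 0); last exact: lim_scal0.
  move=> k _; rewrite Rminus_0_r Rabs_pos_eq; last exact: nrm_ge0.
  rewrite /bd -(lin_lc E B) //; exact: nrm_lin.
Qed.

Section Factors.
Variable D : nat -> bspace.
Hypothesis HD : nbounded D 2.
Hypothesis Hdense : forall x e, 0 < e -> nrm x < 2 -> exists n, bd x (D n) < e.

(** The scale [d] is kept apart from [nrm x]: in the quotient it is the distance of a class to 0,
    smaller in general than the norm of the chosen representative. *)
Lemma scaled_dense (x : bspace) (d : R) :
  0 < d -> nrm x < 2 * d -> exists n, nrm (blc 1 x (- d) (D n)) < d / 4.
Proof.
  move=> Hd Hx.
  have Hy : nrm (blc (/ d) x 0 bzero) < 2.
    rewrite (sn_scal nrm nrm_lc) Rabs_inv Rabs_pos_eq; last lra.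
    apply: (Rmult_lt_reg_l d) => //; rewrite -Rmult_assoc Rinv_r; lra.
  have [n Hn] := Hdense (blc (/ d) x 0 bzero) (1 / 4) ltac:(lra) Hy.
  exists n; have -> : blc 1 x (- d) (D n) = blc d (blc 1 (blc (/ d) x 0 bzero) (-1) (D n)) 0 bzero.
    apply: b_ext => s; rewrite !ev_lc; field; lra.
  rewrite (sn_scal nrm nrm_lc) -/(bd _ _) Rabs_pos_eq; nra.
Qed.

(** The section [s] splits the operator: [a] corresponds to its image and to [a - s (lin D a)],
    which lies in the kernel. Both directions are homogeneous, so rescaling applies. *)
Lemma iso_l1_b_kernel : iso l1 (dprod bnspace (nsub l1 (fun a => lin D a = bzero))).
Proof.
  have Hd x : 0 < nrm x -> exists n, nrm (blc 1 x (- nrm x) (D n)) < nrm x / 2.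
    move=> Hx; have [n Hn] := scaled_dense x (nrm x) Hx ltac:(lra); exists n; lra.
  have [s [S1 [S2 S3]]] := selection nrm nrm_lc (fun x => Rle_refl _) D HD Hd.
  have Hs x : lin D (s x) = x.
    have E := nrm_eq0 _ (S1 x); apply: b_ext => t.
    have : ev (remainder D x (s x)) t = 0 by rewrite E.
    rewrite /remainder ev_lc; lra.
  set K := nsub l1 _.
  have HK a : lin D (l1lc 1 a (-1) (s (lin D a))) = bzero.
    rewrite (lin_lc D 2) // Hs; apply: b_ext => t; rewrite ev_lc ev_bzero; ring.
  have HKc c (a : l1) : 0 <= c -> lin D a = bzero -> lin D (sc cone_l1 c a) = bzero.
    move=> _ Ha; change (lin D (l1lc c a 0 l1zero) = bzero); rewrite (lin_scal D 2) // Ha.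
    apply: b_ext => t; rewrite ev_lc ev_bzero; ring.
  pose f (a : l1) : dprod bnspace K := (lin D a, exist _ _ (HK a)).
  pose g (z : dprod bnspace K) : l1 := l1lc 1 (proj1_sig (snd z)) 1 (s (fst z)).
  have Hg z : lin D (g z) = fst z.
    rewrite /g (lin_lc D 2) // Hs (proj2_sig (snd z)).
    apply: b_ext => t; rewrite ev_lc ev_bzero; ring.
  apply: (iso_of_homogeneous l1 _ cone_l1 (cone_prod _ _ cone_b (cone_sub l1 cone_l1 _ HKc)) f g).
  - move=> a; apply: l1_ext => n; rewrite /g /f /fst /snd /proj1_sig !cf_lc; ring.
  - move=> z; apply: pair_ext; first exact: Hg.
    apply: sig_ext; have E := Hg z; case: z E => x [k Hk] E.
    change (lin D (l1lc 1 k 1 (s x)) = x) in E.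
    change (l1lc 1 (l1lc 1 k 1 (s x)) (-1) (s (lin D (l1lc 1 k 1 (s x)))) = k).
    rewrite E; apply: l1_ext => n; rewrite !cf_lc; ring.
  - move=> u x Hu; have L := lin_cont D 2 u x HD Hu; split => //.
    apply: l1lc_cont => //; exact: S2.
  - move=> u x [H1 H2]; apply: l1lc_cont => //; exact: S2.
  - move=> c a Hc.
    have E := lin_scal D 2 c a HD.
    apply: pair_ext; first exact: E.
    apply: sig_ext; rewrite [RHS](sc_cone_sub l1 cone_l1 _ HKc c (snd (f a)) Hc).
    change (l1lc 1 (l1lc c a 0 l1zero) (-1) (s (lin D (l1lc c a 0 l1zero))) =
      l1lc c (l1lc 1 a (-1) (s (lin D a))) 0 l1zero).
    apply: l1_ext => n; rewrite E S3 // !cf_lc cf_l1zero; ring.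
Qed.

(** The quotient seminorm modulo the copy of l1: an infimum, written as a negated supremum. *)
Definition dist_l1 (x : bspace) : R := - supr (fun a => - nrm (remainder rho x a)).

Lemma dist_l1_le (x : bspace) (a : l1) : dist_l1 x <= nrm (remainder rho x a).
Proof.
  have Hb : bounded_above (fun a => - nrm (remainder rho x a)).
    by exists 0 => b; have := nrm_ge0 (remainder rho x b); lra.
  have := supr_ub _ Hb a; rewrite /dist_l1; lra.
Qed.

Lemma dist_l1_approx (x : bspace) (e : R) :
  0 < e -> exists a, nrm (remainder rho x a) < dist_l1 x + e.
Proof.
  move=> He; have [a Ha] := supr_approx (fun a => - nrm (remainder rho x a)) l1zero
    (supr (fun a => - nrm (remainder rho x a)) - e) ltac:(lra).
  exists a; rewrite /dist_l1; lra.
Qed.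

Lemma remainder_lc (c d : R) (x y : bspace) (a b : l1) :
  remainder rho (blc c x d y) (l1lc c a d b) = blc c (remainder rho x a) d (remainder rho y b).
Proof.
  rewrite /remainder (lin_lc rho 2); last exact: rho_nbounded.
  apply: b_ext => s; rewrite !ev_lc; ring.
Qed.

Lemma dist_l1_seminorm : seminorm dist_l1.
Proof.
  move=> c x d y.
  apply: (le_of_lim _ _ (fun k => (Rabs c + Rabs d) * (/ 2) ^ k)); last exact: lim_geom0.
  move=> k; have Hk := half_pow_pos k.
  have [a Ha] := dist_l1_approx x _ Hk; have [b Hb] := dist_l1_approx y _ Hk.
  apply: Rle_trans (dist_l1_le _ (l1lc c a d b)) _.
  rewrite remainder_lc; apply: Rle_trans (nrm_lc _ _ _ _) _.
  have := Rabs_pos c; have := Rabs_pos d; nra.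
Qed.

Lemma dist_l1_nrm (x : bspace) : dist_l1 x <= nrm x.
Proof.
  have := dist_l1_le x l1zero; rewrite remainder_zero //; exact: rho_nbounded.
Qed.

Lemma lin_rho_bound (a b : l1) : l1d a b <= bd (lin rho a) (lin rho b).
Proof.
  rewrite /bd -(lin_lc rho 2); last exact: rho_nbounded.
  exact: rho_lower.
Qed.

Lemma lin_rho_inj (a b : l1) : lin rho a = lin rho b -> a = b.
Proof.
  move=> E; apply: cv_l1_unique; apply/cv_l1.
  have H := lin_rho_bound a b; rewrite E in H.
  have H0 : bd (lin rho b) (lin rho b) = 0 by exact: sn_sub_refl nrm_lc _.
  have -> : l1d a b = 0 by apply: Rle_antisym; [lra | exact: l1d_ge0].
  exact: is_lim_seq_const.
Qed.

(** The copy of l1 is closed: by the lower bound for [lin rho], coefficients whose images approach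
    [x] are Cauchy. *)
Lemma dist_l1_zero (x : bspace) : dist_l1 x = 0 -> exists a, x = lin rho a.
Proof.
  move=> Hx; pose A k := proj1_sig (constructive_indefinite_description _ (dist_l1_approx x _ (half_pow_pos k))).
  have HA k : nrm (remainder rho x (A k)) < (/ 2) ^ k.
    have := proj2_sig (constructive_indefinite_description _ (dist_l1_approx x _ (half_pow_pos k))).
    by rewrite -/(A k) Hx Rplus_0_l.
  have Hb k : bd x (lin rho (A k)) < (/ 2) ^ k by exact: HA.
  have [a [Ha _]] : exists a : l1, (forall K, l1d a (A K) <= 2 * 2 * (/ 2) ^ K) /\
    (forall n, is_lim_seq (fun K => cf (A K) n) (cf a n)).
    apply: l1_complete => K; apply: Rle_trans (lin_rho_bound _ _) _.
    have := sn_sub_tri nrm nrm_lc (lin rho (A (S K))) x (lin rho (A K)).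
    rewrite (sn_sub_sym nrm nrm_lc _ x) -!/(bd _ _); have := Hb K; have := Hb (S K).
    rewrite /=; have := half_pow_pos K; lra.
  exists a.
  suff E : bd x (lin rho a) = 0.
    apply: b_ext => s; have := bd_ev x (lin rho a) s; rewrite E => H.
    have : ev x s - ev (lin rho a) s = 0.
      by apply: Rabs_eq_0; have := Rabs_pos (ev x s - ev (lin rho a) s); lra.
    lra.
  apply: Rle_antisym; last exact: nrm_ge0.
  (* One from [x] to the image of [A k], and [2 * 4] from there to the image of the limit, since
     [lin rho] at most doubles norms. *)
  apply: (le_of_lim _ _ (fun k => 9 * (/ 2) ^ k)); last exact: lim_geom0.
  move=> k; have := sn_sub_tri nrm nrm_lc x (lin rho (A k)) (lin rho a).
  rewrite -!/(bd _ _).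
  have : bd (lin rho (A k)) (lin rho a) <= 2 * l1d (A k) a.
    by rewrite /bd -(lin_lc rho 2); [apply: nrm_lin |]; exact: rho_nbounded.
  rewrite l1d_sym; have := Ha k; have := Hb k; lra.
Qed.

(** The factor [W] is a continuous cross-section of the quotient by the copy of l1: [lin D (s x)] is
    the chosen representative of the class of [x], and [x] minus it lies in the copy, with
    coefficients [j x]. *)
Lemma iso_b_l1_factor : exists W : nspace, iso bnspace (dprod l1 W).
Proof.
  have Hd x : 0 < dist_l1 x -> exists n, dist_l1 (blc 1 x (- dist_l1 x) (D n)) < dist_l1 x / 2.
    (* A representative of norm below 3/2 of the distance, which is within the radius 2 of the dense
       sequence after scaling. *)
    move=> Hx; have [a Ha] := dist_l1_approx x (dist_l1 x / 2) ltac:(lra).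
    have [n Hn] := scaled_dense (remainder rho x a) (dist_l1 x) Hx ltac:(lra).
    exists n; apply: Rle_lt_trans (dist_l1_le _ a) _.
    have -> : remainder rho (blc 1 x (- dist_l1 x) (D n)) a = blc 1 (remainder rho x a) (- dist_l1 x) (D n).
      by apply: b_ext => s; rewrite /remainder !ev_lc; ring.
    lra.
  have [s [S1 [S2 S3]]] := selection dist_l1 dist_l1_seminorm dist_l1_nrm D HD Hd.
  pose W := nsub bnspace (fun x => lin D (s x) = x).
  (* Continuity for the seminorm, applied to a constant sequence, makes [s] constant on classes.
     Hence representatives are fixed points of [lin D o s]. *)
  have Sinv x y : dist_l1 (blc 1 x (-1) y) = 0 -> s x = s y.
    move=> E; apply: cv_l1_unique; apply: S2; rewrite E; exact: is_lim_seq_const.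
  have HW x : lin D (s (lin D (s x))) = lin D (s x).
    f_equal; apply: Sinv; rewrite (sn_sub_sym _ dist_l1_seminorm); exact: S1.
  have HWc c (x : bnspace) : 0 <= c -> lin D (s x) = x -> lin D (s (sc cone_b c x)) = sc cone_b c x.
    move=> Hc Hx; change (lin D (s (blc c x 0 bzero)) = blc c x 0 bzero); by rewrite S3 // (lin_scal D 2) // Hx.
  pose j x := proj1_sig (constructive_indefinite_description _ (dist_l1_zero _ (S1 x))).
  have Hj x : lin rho (j x) = remainder D x (s x).
    by rewrite -(proj2_sig (constructive_indefinite_description _ (dist_l1_zero _ (S1 x)))).
  exists W.
  pose f (x : bnspace) : dprod l1 W := (j x, exist _ _ (HW x)).
  pose g (z : dprod l1 W) : bnspace := blc 1 (lin rho (fst z)) 1 (proj1_sig (snd z)).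
  have Sg z : s (g z) = s (proj1_sig (snd z)).
    apply: Sinv; apply: Rle_antisym; last exact: sn_ge0 dist_l1_seminorm _.
    apply: Rle_trans (dist_l1_le _ (fst z)) _.
    have -> : remainder rho (blc 1 (g z) (-1) (proj1_sig (snd z))) (fst z) = bzero.
      apply: b_ext => t; rewrite /remainder /g !ev_lc ev_bzero; ring.
    by rewrite nrm_bzero; right.
  have Hscal c x : 0 <= c -> remainder D (blc c x 0 bzero) (s (blc c x 0 bzero)) =
      blc c (remainder D x (s x)) 0 bzero.
    move=> Hc; rewrite /remainder S3 // (lin_scal D 2) //.
    apply: b_ext => t; rewrite !ev_lc !ev_bzero; ring.
  apply: (iso_of_homogeneous bnspace _ cone_b (cone_prod _ _ cone_l1 (cone_sub bnspace cone_b _ HWc)) f g).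
  - move=> x; change (blc 1 (lin rho (j x)) 1 (lin D (s x)) = x).
    apply: b_ext => t; rewrite ev_lc Hj /remainder ev_lc; ring.
  - move=> z; apply: pair_ext.
    + apply: lin_rho_inj; rewrite [fst (f (g z))]/= Hj /remainder Sg (proj2_sig (snd z)).
      case: z => a [w Hw]; change (blc 1 (blc 1 (lin rho a) 1 w) (-1) w = lin rho a).
      apply: b_ext => t; rewrite !ev_lc; ring.
    + apply: sig_ext; change (lin D (s (g z)) = proj1_sig (snd z)); rewrite Sg.
      exact: proj2_sig (snd z).
  - move=> u x Hu.
    have Hu' : is_lim_seq (fun k => dist_l1 (blc 1 (u k) (-1) x)) 0.
      apply: (lim_squeeze _ _ _ 0 _ Hu) => k _; rewrite Rminus_0_r Rabs_pos_eq.
        exact: dist_l1_nrm.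
      exact: sn_ge0 dist_l1_seminorm _.
    have L := lin_cont D 2 _ _ HD (S2 u x Hu').
    split => //; apply/cv_l1.
    have Lr := blc_cont u _ x _ 1 (-1) Hu L.
    apply: (lim_squeeze _ _ _ 0 _ Lr) => k _; rewrite Rminus_0_r Rabs_pos_eq; last exact: l1d_ge0.
    apply: Rle_trans (lin_rho_bound _ _) _; rewrite !Hj; by right.
  - move=> u x [H1 H2]; apply: blc_cont => //; apply: (lin_cont rho 2) => //; exact: rho_nbounded.
  - move=> c x Hc; apply: pair_ext.
    + change (j (blc c x 0 bzero) = l1lc c (j x) 0 l1zero).
      apply: lin_rho_inj; rewrite Hj Hscal // (lin_scal rho 2); last exact: rho_nbounded.
      by rewrite Hj.
    + apply: sig_ext; rewrite [RHS](sc_cone_sub bnspace cone_b _ HWc c (snd (f x)) Hc).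
      change (lin D (s (blc c x 0 bzero)) = blc c (lin D (s x)) 0 bzero).
      by rewrite S3 // (lin_scal D 2).
Qed.

End Factors.

Theorem iso_b_l1 : iso bnspace l1.
Proof.
  have [D [HD Hdense]] := dense_sequence.
  have [W HW] := iso_b_l1_factor D HD Hdense.
  apply: (iso_decomposition l1 bnspace _ W dsum_real_flatten _ HW).
  exact: iso_sym _ _ (iso_l1_b_kernel D HD Hdense).
Qed.

(** * The sphere of the suspension *)

(* Pointwise limit as [t -> 0]: the indicator of [(0, 1]], which is not continuous. *)
Definition ramp (t s : R) : R := clamp s / (clamp s + t).

Lemma ramp_bounds (t s : R) : 0 <= t -> 0 <= ramp t s <= 1.
Proof.
  move=> Ht; have [H0 H1] := clamp_bounds s; rewrite /ramp.
  case: H0 => H0; last by rewrite -H0 /Rdiv; lra.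
  have Hp : 0 < clamp s + t by lra.
  split; first by apply: Rdiv_le_0_compat; lra.
  apply/(Rle_div_l _ _ _ Hp); lra.
Qed.

Lemma ramp_based (t : R) : 0 < t -> based (ramp t).
Proof.
  move=> Ht; split; [|split].
  - move=> x; apply: (continuity_pt_div clamp (fun s => clamp s + t)).
    + exact: clamp_cont.
    + apply: (continuity_pt_plus clamp (fun _ => t)); first exact: clamp_cont.
      by apply: continuity_pt_const.
    + have := clamp_bounds x; lra.
  - by move=> x; rewrite /ramp clamp_idem.
  - by rewrite /ramp clamp_low ?Rdiv_0_l; lra.
Qed.

Definition bramp (t : R) : bspace :=
  match Rlt_dec 0 t with
  | left H => exist _ _ (ramp_based t H)
  | right _ => bzero
  end.

Lemma ev_bramp (t s : R) : 0 < t -> ev (bramp t) s = ramp t s.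
Proof. by move=> Ht; rewrite /bramp; case: Rlt_dec. Qed.

Lemma nrm_bramp (t : R) : nrm (bramp t) <= 1.
Proof.
  rewrite /bramp; case: Rlt_dec => Ht; last by rewrite nrm_bzero; lra.
  apply: nrm_le => s r; have := ramp_bounds t s (Rlt_le _ _ Ht); have := ramp_bounds t r (Rlt_le _ _ Ht).
  rewrite /ev /=; lra.
Qed.

Lemma ramp_diff (t u s : R) : 0 <= t -> 0 <= u -> 0 < clamp s ->
  ramp t s - ramp u s = clamp s * (u - t) / ((clamp s + t) * (clamp s + u)).
Proof. move=> Ht Hu Hs; rewrite /ramp; field; lra. Qed.

(** With the weight, the difference is [u - t] times two quotients [s / (s + t)] and [s / (s + u)],
    both at most 1; no singularity is left at [t = 0]. *)
Lemma ramp_lip (t u s : R) :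
  0 <= t -> 0 <= u -> clamp s * Rabs (ramp t s - ramp u s) <= Rabs (t - u).
Proof.
  move=> Ht Hu; have [H0 H1] := clamp_bounds s; case: H0 => H0; last first.
    by rewrite -H0 Rmult_0_l; exact: Rabs_pos.
  rewrite ramp_diff // -{1}(Rabs_pos_eq (clamp s)); last lra.
  rewrite -Rabs_mult.
  have -> : clamp s * (clamp s * (u - t) / ((clamp s + t) * (clamp s + u))) =
     (clamp s / (clamp s + t)) * (clamp s / (clamp s + u)) * (u - t) by field; lra.
  have := ramp_bounds t s Ht; have := ramp_bounds u s Hu; rewrite /ramp.
  set a := clamp s / _; set b := clamp s / (clamp s + u) => Hb Ha.
  rewrite Rabs_mult (Rabs_minus_sym t) -{2}(Rmult_1_l (Rabs (u - t))).
  apply: Rmult_le_compat_r; first exact: Rabs_pos.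
  rewrite Rabs_pos_eq; nra.
Qed.

(** In the norm of the space the Lipschitz constant blows up as [u] tends to 0, as it must, the
    limit being outside the space; continuity at each positive parameter is enough. *)
Lemma bramp_lip (t u : R) : 0 < t -> 0 < u -> bd (bramp t) (bramp u) <= 2 * (Rabs (t - u) / u).
Proof.
  move=> Ht Hu; apply: nrm_le_sup => s; rewrite ev_lc !ev_bramp //.
  have -> : 1 * ramp t s + -1 * ramp u s = ramp t s - ramp u s by ring.
  have [H0 H1] := clamp_bounds s; case: H0 => H0; last first.
    rewrite /ramp -H0 /Rdiv !Rmult_0_l Rminus_diag Rabs_R0.
    apply: Rdiv_le_0_compat => //; exact: Rabs_pos.
  rewrite ramp_diff; [|lra|lra|lra].
  have -> : clamp s * (u - t) / ((clamp s + t) * (clamp s + u)) =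
      (clamp s / (clamp s + t)) * ((u - t) / (clamp s + u)) by field; lra.
  have := ramp_bounds t s ltac:(lra); rewrite /ramp; set a := clamp s / _ => Ha.
  rewrite Rabs_mult (Rabs_pos_eq a); last lra.
  rewrite /Rdiv Rabs_mult (Rabs_minus_sym t) Rabs_inv (Rabs_pos_eq (clamp s + u)); last lra.
  have Hi : / (clamp s + u) <= / u by apply: Rinv_le_contravar; lra.
  have Hi0 : 0 < / (clamp s + u) by apply: Rinv_0_lt_compat; lra.
  have Hv := Rabs_pos (u - t).
  have : Rabs (u - t) * / (clamp s + u) <= Rabs (u - t) * / u by apply: Rmult_le_compat_l.
  have : 0 <= Rabs (u - t) * / (clamp s + u) by nra.
  nra.
Qed.

Definition wgap (y : bspace) (t s : R) : R := clamp s * Rabs (ev y s - ramp t s).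

(* Half the weak norm [x |-> sup_s s * |x s|] of [y - ramp t]; unlike [bramp], it makes
   sense, and is Lipschitz, down to [t = 0]. *)
Definition gap (y : bspace) (t : R) : R := supr (wgap y t) / 2.

Definition weak (x : bspace) : R := supr (fun s => clamp s * Rabs (ev x s)) / 2.

Lemma wgap_bound (y : bspace) (t s : R) : 0 <= t -> wgap y t s <= nrm y + 1.
Proof.
  move=> Ht; have Hc := clamp_bounds s; have Hr := ramp_bounds t s Ht; have Hn := nrm_ev y s.
  have Ha : Rabs (ev y s - ramp t s) <= nrm y + 1.
    apply: Rle_trans (Rabs_triang _ _) _; rewrite Rabs_Ropp (Rabs_pos_eq (ramp t s)); lra.
  rewrite /wgap; have := Rabs_pos (ev y s - ramp t s); nra.
Qed.

Lemma wgap_bounded (y : bspace) (t : R) : 0 <= t -> bounded_above (wgap y t).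
Proof. move=> Ht; exists (nrm y + 1) => s; exact: wgap_bound. Qed.

Lemma weak_bounded (x : bspace) : bounded_above (fun s => clamp s * Rabs (ev x s)).
Proof.
  exists (nrm x) => s; have := clamp_bounds s; have := nrm_ev x s; have := Rabs_pos (ev x s); nra.
Qed.

Lemma gap_le (y z : bspace) (t u : R) : 0 <= t -> 0 <= u ->
  gap y t <= gap z u + (bd y z + Rabs (t - u)) / 2.
Proof.
  move=> Ht Hu; suff : supr (wgap y t) <= supr (wgap z u) + (bd y z + Rabs (t - u)).
    by rewrite /gap; lra.
  apply: (supr_le _ 0) => s; have H1 := supr_ub _ (wgap_bounded z u Hu) s.
  suff : wgap y t s <= wgap z u s + (bd y z + Rabs (t - u)) by lra.
  have Hc := clamp_bounds s; have H2 := ramp_lip t u s Ht Hu; have H3 := bd_ev y z s.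
  rewrite /wgap.
  have Htri : Rabs (ev y s - ramp t s) <=
     Rabs (ev z s - ramp u s) + Rabs (ev y s - ev z s) + Rabs (ramp t s - ramp u s).
    have -> : ev y s - ramp t s = (ev z s - ramp u s) + (ev y s - ev z s) + - (ramp t s - ramp u s) by ring.
    apply: Rle_trans (Rabs_triang _ _) _; rewrite Rabs_Ropp.
    apply: Rplus_le_compat_r; exact: Rabs_triang.
  have := Rmult_le_compat_l _ _ _ (proj1 Hc) Htri.
  have : clamp s * Rabs (ev y s - ev z s) <= bd y z by have := Rabs_pos (ev y s - ev z s); nra.
  lra.
Qed.

Lemma gap_lip (y z : bspace) (t u : R) : 0 <= t -> 0 <= u ->
  Rabs (gap y t - gap z u) <= (bd y z + Rabs (t - u)) / 2.
Proof.
  move=> Ht Hu; have := gap_le y z t u Ht Hu; have := gap_le z y u t Hu Ht.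
  have -> : bd z y = bd y z by exact: sn_sub_sym nrm_lc _ _.
  rewrite (Rabs_minus_sym u) => ? ?; apply: Rabs_le; lra.
Qed.

Lemma bd_refl (x : bspace) : bd x x = 0.
Proof. exact: sn_sub_refl nrm_lc _. Qed.

(** Here the limit of the ramps lies outside the space: near 0 a continuous [y] with [y 0 = 0] stays
    below 1, while [ramp 0] equals 1 at every positive point. *)
Lemma gap0_pos (y : bspace) : 0 < gap y 0.
Proof.
  have [d [Hd H]] := proj2 (cont_eps (ev y) 0) (ev_cont y 0) 1 Rlt_0_1.
  have Hm : 0 < Rmin (d / 2) 1 by apply: Rmin_pos; lra.
  have H1 := Rmin_l (d / 2) 1; have H2 := Rmin_r (d / 2) 1.
  set s := Rmin (d / 2) 1 in Hm H1 H2.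
  have Hs : Rabs (ev y s) < 1.
    by have := H s; rewrite ev0 !Rminus_0_r; apply; rewrite Rabs_pos_eq; lra.
  have := supr_ub _ (wgap_bounded y 0 (Rle_refl 0)) s.
  rewrite /gap /wgap /ramp clamp_id; last lra.
  rewrite Rplus_0_r Rdiv_diag; last lra.
  move=> Hsup.
  have : 0 < s * Rabs (ev y s - 1).
    apply: Rmult_lt_0_compat => //; apply: Rabs_pos_lt; have := Rle_abs (ev y s); lra.
  lra.
Qed.

(** Inverting [push] means recovering [t = weak x] from [y = x + ramp t], that is, solving
    [t = gap y t]. The function [t - gap y t] is negative at 0, and positive at [nrm y + 2], where
    the gap is at most [(nrm y + 1) / 2]. *)
Lemma gap_root (y : bspace) : exists t, 0 < t /\ t = gap y t.
Proof.
  (* [Rabs] extends the function continuously to negative [t], as this form of the intermediate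
     value theorem wants continuity on the whole line. *)
  have Hc : continuity (fun t => t - gap y (Rabs t)).
    move=> t; apply/cont_eps => eps He; exists (eps / 2); split; first lra.
    move=> u Hu; have := gap_lip y y (Rabs u) (Rabs t) (Rabs_pos _) (Rabs_pos _).
    rewrite bd_refl; have H1 := Rabs_triang_inv2 u t => H2.
    have -> : u - gap y (Rabs u) - (t - gap y (Rabs t)) =
      (u - t) + - (gap y (Rabs u) - gap y (Rabs t)) by ring.
    apply: Rle_lt_trans (Rabs_triang _ _) _; rewrite Rabs_Ropp; lra.
  have Hn := nrm_ge0 y; have H0 := gap0_pos y.
  have Hb : gap y (nrm y + 2) <= (nrm y + 1) / 2.
    rewrite /gap; apply: Rmult_le_compat_r; first lra.
    apply: (supr_le _ 0) => s; apply: wgap_bound; lra.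
  have [|||t [Ht E]] := IVT (fun t => t - gap y (Rabs t)) 0 (nrm y + 2) Hc.
  - lra.
  - rewrite Rabs_R0; lra.
  - rewrite Rabs_pos_eq; lra.
  rewrite Rabs_pos_eq in E; last lra.
  exists t; split; last lra.
  case: (proj1 Ht) => // Et; rewrite -Et in E; lra.
Qed.

Definition root (y : bspace) : R :=
  proj1_sig (constructive_indefinite_description _ (gap_root y)).

Lemma root_spec (y : bspace) : 0 < root y /\ root y = gap y (root y).
Proof. exact: (proj2_sig (constructive_indefinite_description _ (gap_root y))). Qed.

(** The factor 1/2 in [gap] makes it a contraction in [t], so half of [|t - u|] is absorbed on the
    left. With [y = z] this is uniqueness of the root, in general its continuity. *)
Lemma fixed_lip (y z : bspace) (t u : R) :
  0 < t -> 0 < u -> t = gap y t -> u = gap z u -> Rabs (t - u) <= bd y z.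
Proof.
  move=> Ht Hu Et Eu; have := gap_lip y z t u ltac:(lra) ltac:(lra).
  rewrite -Et -Eu; lra.
Qed.

Lemma weak_gap (y x : bspace) (t : R) :
  0 < t -> (forall s, ev x s = ev y s - ramp t s) -> weak x = gap y t.
Proof.
  by move=> Ht E; rewrite /weak /gap; f_equal; apply: supr_ext => s; rewrite E.
Qed.

Lemma weak_pos (x : bspace) : 0 < nrm x -> 0 < weak x.
Proof.
  move=> Hx.
  have [s Hs] : exists s, ev x s <> 0.
    apply: NNPP => Hn; have E : x = bzero.
      by apply: b_ext => s; rewrite ev_bzero; apply: NNPP => Hs; apply: Hn; exists s.
    rewrite E nrm_bzero in Hx; lra.
  have Hc : 0 < clamp s.
    case: (proj1 (clamp_bounds s)) => // E; case: Hs; by rewrite ev_clamp -E ev0.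
  have H := supr_ub _ (weak_bounded x) s; rewrite /weak.
  have := Rmult_lt_0_compat _ _ Hc (Rabs_pos_lt _ Hs); rewrite /= in H; lra.
Qed.

Lemma weak_lip (x y : bspace) : Rabs (weak x - weak y) <= bd x y.
Proof.
  have H (u v : bspace) : weak u <= weak v + bd u v.
    suff : supr (fun s => clamp s * Rabs (ev u s)) <= supr (fun s => clamp s * Rabs (ev v s)) + 2 * bd u v.
      by rewrite /weak; lra.
    apply: (supr_le _ 0) => s; have H1 := supr_ub _ (weak_bounded v) s; have Hc := clamp_bounds s.
    have H2 := bd_ev u v s; rewrite /= in H1.
    have H3 : Rabs (ev u s) <= Rabs (ev v s) + Rabs (ev u s - ev v s).
      by have := Rabs_triang (ev v s) (ev u s - ev v s); rewrite Rplus_minus.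
    have := Rabs_pos (ev u s - ev v s); nra.
  have := H x y; have := H y x.
  have -> : bd y x = bd x y by exact: sn_sub_sym nrm_lc _ _.
  move=> ? ?; apply: Rabs_le; lra.
Qed.

Definition push (x : bspace) : bspace := blc 1 x 1 (bramp (weak x)).
Definition pull (y : bspace) : bspace := blc 1 y (-1) (bramp (root y)).

Lemma weak_pull (y : bspace) : weak (pull y) = root y.
Proof.
  have [H1 H2] := root_spec y; rewrite [RHS]H2; apply: weak_gap => // s.
  rewrite /pull ev_lc ev_bramp //; ring.
Qed.

Lemma push_pull (y : bspace) : push (pull y) = y.
Proof.
  rewrite /push weak_pull; apply: b_ext => s; rewrite !ev_lc; ring.
Qed.

Lemma pull_push (x : bspace) : 0 < nrm x -> pull (push x) = x.
Proof.
  move=> Hx; have Hw := weak_pos x Hx.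
  have E : root (push x) = weak x.
    have [H1 H2] := root_spec (push x).
    have H3 : weak x = gap (push x) (weak x).
      apply: weak_gap => // s; rewrite /push ev_lc ev_bramp //; ring.
    have := fixed_lip _ _ _ _ H1 Hw H2 H3; rewrite bd_refl => H4.
    have := Rabs_pos (root (push x) - weak x) => ?.
    have : root (push x) - weak x = 0 by apply: Rabs_eq_0; lra.
    lra.
  rewrite /pull E; apply: b_ext => s; rewrite /push !ev_lc; ring.
Qed.

Lemma nrm_pull_pos (y : bspace) : 0 < nrm (pull y).
Proof.
  case: (nrm_ge0 (pull y)) => // H.
  have [H1 _] := root_spec y; have H2 := weak_pull y.
  have E : weak (pull y) <= 0.
    rewrite /weak; suff : supr (fun s => clamp s * Rabs (ev (pull y) s)) <= 0 by lra.
    apply: (supr_le _ 0) => s; have := nrm_ev (pull y) s; rewrite -H.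
    have := clamp_bounds s; have := Rabs_pos (ev (pull y) s); nra.
  lra.
Qed.

(** With [nrm_push], this is the bounded displacement that gives continuity at the point at
    infinity. *)
Lemma nrm_pull (y : bspace) : nrm y - 1 <= nrm (pull y).
Proof.
  have := sn_le_sub nrm nrm_lc y (bramp (root y)); have := nrm_bramp (root y); rewrite /pull; lra.
Qed.

Lemma nrm_push (x : bspace) : nrm x - 1 <= nrm (push x).
Proof.
  have := nrm_lc 1 (push x) (-1) (bramp (weak x)).
  have -> : blc 1 (push x) (-1) (bramp (weak x)) = x.
    by apply: b_ext => s; rewrite /push !ev_lc; ring.
  rewrite Rabs_Ropp Rabs_R1; have := nrm_bramp (weak x); lra.
Qed.

Lemma bramp_cont (t : nat -> R) (u : R) :
  is_lim_seq t u -> 0 < u -> is_lim_seq (fun k => bd (bramp (t k)) (bramp u)) 0.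
Proof.
  move=> Ht Hu; have [N HN] := lim_eventually_gt t u 0 Ht Hu.
  apply: (lim_squeeze _ (fun k => 2 * / u * Rabs (t k - u)) _ N).
  - move=> k Hk; rewrite Rminus_0_r Rabs_pos_eq; last exact: nrm_ge0.
    apply: Rle_trans (bramp_lip _ _ (HN k Hk) Hu) _; right; rewrite /Rdiv; ring.
  - apply: lim_scal0; exact: (proj1 (lim_dist t u) Ht).
Qed.

Lemma pull_cont (u : nat -> bspace) (y : bspace) :
  is_lim_seq (fun k => bd (u k) y) 0 -> is_lim_seq (fun k => bd (pull (u k)) (pull y)) 0.
Proof.
  move=> H; apply: blc_cont => //; apply: bramp_cont; last by case: (root_spec y).
  apply: (lim_squeeze _ _ _ 0 _ H) => k _.
  by case: (root_spec (u k)) => ? ?; case: (root_spec y) => ? ?; apply: fixed_lip.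
Qed.

Lemma push_cont (u : nat -> bspace) (x : bspace) :
  0 < nrm x ->
  is_lim_seq (fun k => bd (u k) x) 0 -> is_lim_seq (fun k => bd (push (u k)) (push x)) 0.
Proof.
  move=> Hx H; apply: blc_cont => //; apply: bramp_cont; last exact: weak_pos.
  apply: (lim_squeeze _ _ _ 0 _ H) => k _; exact: weak_lip.
Qed.

(** * Inversion, stereographic projection and their composite with the deletion of 0 *)

Definition invert (x : bspace) : bspace := bscal (/ (nrm x * nrm x)) x.

Lemma nrm_invert (x : bspace) : 0 < nrm x -> nrm (invert x) = / nrm x.
Proof.
  move=> Hx; rewrite /invert nrm_scal; first by field; lra.
  left; apply: Rinv_0_lt_compat; nra.
Qed.

Lemma invert_invert (x : bspace) : 0 < nrm x -> invert (invert x) = x.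
Proof.
  move=> Hx; rewrite {1}/invert nrm_invert // /invert bscal_bscal -[RHS]bscal_1.
  f_equal; field; lra.
Qed.

Lemma nrm_cont (u : nat -> bspace) (x : bspace) :
  is_lim_seq (fun k => bd (u k) x) 0 -> is_lim_seq (fun k => nrm (u k)) (nrm x).
Proof. exact: (@pn_cont bnspace u x). Qed.

Lemma invert_cont (u : nat -> bspace) (x : bspace) :
  0 < nrm x ->
  is_lim_seq (fun k => bd (u k) x) 0 -> is_lim_seq (fun k => bd (invert (u k)) (invert x)) 0.
Proof.
  move=> Hx H; apply: bscal_cont => //.
  have L := nrm_cont u x H.
  apply: (is_lim_seq_ext (fun k => 1 / (nrm (u k) * nrm (u k)))).
    by move=> k; rewrite /Rdiv Rmult_1_l.
  have -> : / (nrm x * nrm x) = 1 / (nrm x * nrm x) by rewrite /Rdiv Rmult_1_l.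
  apply: is_lim_seq_div'; [exact: is_lim_seq_const | exact: is_lim_seq_mult' | nra].
Qed.

Definition suspension : cspace := sphere (dprod realn bnspace).
Definition height (z : suspension) : R := fst (proj1_sig z).
Definition girth (z : suspension) : bspace := snd (proj1_sig z).

Lemma suspension_eq (z : suspension) : Rabs (height z) + nrm (girth z) = 1.
Proof. exact: (proj2_sig z). Qed.

Lemma suspension_ext (z w : suspension) :
  height z = height w -> girth z = girth w -> z = w.
Proof. move=> H1 H2; apply: sig_ext; exact: pair_ext. Qed.

Lemma height_bounds (z : suspension) : -1 <= height z <= 1.
Proof.
  have := suspension_eq z; have := nrm_ge0 (girth z) => H1 H2.
  have : Rabs (height z) <= 1 by lra.
  by move/Rabs_le_between.
Qed.

(* Stereographic projection from the pole [(-1, 0)]: the image of [(s, y)] has norm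
   [(1 - s) / (1 + s)]. *)
Definition stereo_factor (s : R) : R := (1 + Rabs s) / ((1 + s) * (1 + s)).

Definition stereo (z : suspension) : bspace := bscal (stereo_factor (height z)) (girth z).

Lemma nrm_stereo (z : suspension) :
  -1 < height z -> nrm (stereo z) = (1 - height z) / (1 + height z).
Proof.
  move=> Hz; have E := suspension_eq z; have Ha := Rabs_pos (height z).
  rewrite /stereo /stereo_factor nrm_scal; last first.
    by apply: Rdiv_le_0_compat; [lra | nra].
  (* The numerator [1 + |s|] of the factor completes this to [1 - s * s], from which one [1 + s]
     cancels. *)
  have -> : nrm (girth z) = 1 - Rabs (height z) by lra.
  have E2 : Rabs (height z) * Rabs (height z) = height z * height z.
    by rewrite -Rabs_mult Rabs_pos_eq //; nra.
  have -> : (1 + Rabs (height z)) / ((1 + height z) * (1 + height z)) * (1 - Rabs (height z)) =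
    (1 - Rabs (height z) * Rabs (height z)) / ((1 + height z) * (1 + height z)) by field; lra.
  rewrite E2; field; lra.
Qed.

(** The same Moebius map that gives the norm of the projection: it is its own inverse. *)
Definition unheight (r : R) : R := (1 - r) / (1 + r).

Lemma unheight_bounds (r : R) : 0 <= r -> -1 < unheight r <= 1.
Proof.
  move=> Hr; rewrite /unheight.
  have -> : (1 - r) / (1 + r) = -1 + 2 * / (1 + r) by field; lra.
  have H := Rinv_0_lt_compat (1 + r) ltac:(lra).
  have : / (1 + r) <= / 1 by apply: Rinv_le_contravar; lra.
  rewrite Rinv_1; lra.
Qed.

Definition unstereo_pair (y : bspace) : R * bspace :=
  (unheight (nrm y), bscal (/ stereo_factor (unheight (nrm y))) y).

Lemma stereo_factor_pos (s : R) : -1 < s -> 0 < stereo_factor s.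
Proof.
  move=> Hs; have := Rabs_pos s => ?; apply: Rdiv_lt_0_compat; first lra.
  apply: Rmult_lt_0_compat; lra.
Qed.

Lemma unstereo_sphere (y : bspace) :
  pn (unstereo_pair y : dprod realn bnspace) = 1.
Proof.
  have Hr := nrm_ge0 y; have Hb := unheight_bounds _ Hr.
  have Hf := stereo_factor_pos _ (proj1 Hb).
  change (Rabs (unheight (nrm y)) + nrm (bscal (/ stereo_factor (unheight (nrm y))) y) = 1).
  rewrite nrm_scal; last by left; exact: Rinv_0_lt_compat.
  have Ey : nrm y = (1 - unheight (nrm y)) / (1 + unheight (nrm y)).
    by rewrite /unheight; field; lra.
  move: Ey Hb Hf; set s := unheight _ => Ey Hb Hf.
  rewrite Ey /stereo_factor.
  have E2 : Rabs s * Rabs s = s * s by rewrite -Rabs_mult Rabs_pos_eq //; nra.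
  have Ha := Rabs_pos s.
  have -> : / ((1 + Rabs s) / ((1 + s) * (1 + s))) * ((1 - s) / (1 + s)) =
    (1 - s * s) / (1 + Rabs s) by field; lra.
  rewrite -E2; field; lra.
Qed.

Definition unstereo (y : bspace) : suspension := exist _ _ (unstereo_sphere y).

Lemma stereo_unstereo (y : bspace) : stereo (unstereo y) = y.
Proof.
  have [Hb _] := unheight_bounds _ (nrm_ge0 y).
  have Hf := stereo_factor_pos _ Hb.
  change (bscal (stereo_factor (unheight (nrm y))) (bscal (/ stereo_factor (unheight (nrm y))) y) = y).
  rewrite bscal_bscal Rinv_r; [exact: bscal_1 | lra].
Qed.

Lemma unstereo_stereo (z : suspension) : -1 < height z -> unstereo (stereo z) = z.
Proof.
  move=> Hz; have Hf := stereo_factor_pos _ Hz.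
  have E : unheight (nrm (stereo z)) = height z.
    rewrite nrm_stereo // /unheight; field; lra.
  apply: suspension_ext; first exact: E.
  change (bscal (/ stereo_factor (unheight (nrm (stereo z)))) (stereo z) = girth z).
  rewrite E /stereo bscal_bscal Rinv_l; [exact: bscal_1 | lra].
Qed.

Lemma stereo_factor_cont (c : nat -> R) (s : R) :
  -1 < s -> is_lim_seq c s -> is_lim_seq (fun k => stereo_factor (c k)) (stereo_factor s).
Proof.
  move=> Hs L; have L1 : is_lim_seq (fun k => 1 + c k) (1 + s).
    by apply: is_lim_seq_plus' => //; exact: is_lim_seq_const.
  apply: is_lim_seq_div'; last by nra.
  - apply: is_lim_seq_plus'; first exact: is_lim_seq_const.
    exact: (is_lim_seq_abs c s).
  - exact: is_lim_seq_mult'.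
Qed.

Lemma stereo_cont (u : nat -> suspension) (z : suspension) :
  -1 < height z -> cv u z -> is_lim_seq (fun k => bd (stereo (u k)) (stereo z)) 0.
Proof.
  move=> Hz [H1 H2]; apply: bscal_cont => //; exact: stereo_factor_cont.
Qed.

Lemma unstereo_cont (u : nat -> bspace) (y : bspace) :
  is_lim_seq (fun k => bd (u k) y) 0 -> cv (fun k => unstereo (u k)) (unstereo y).
Proof.
  move=> H; have L := nrm_cont u y H; have Hr := nrm_ge0 y.
  have L2 : is_lim_seq (fun k => unheight (nrm (u k))) (unheight (nrm y)).
    apply: is_lim_seq_div'; last lra.
    - apply: is_lim_seq_minus' => //; exact: is_lim_seq_const.
    - apply: is_lim_seq_plus' => //; exact: is_lim_seq_const.
  split; first exact: L2.
  apply: bscal_cont => //.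
  have [Hb _] := unheight_bounds _ Hr; have Hf := stereo_factor_pos _ Hb.
  apply: (is_lim_seq_ext (fun k => 1 / stereo_factor (unheight (nrm (u k))))).
    by move=> k; rewrite /Rdiv Rmult_1_l.
  have -> : / stereo_factor (unheight (nrm y)) = 1 / stereo_factor (unheight (nrm y)).
    by rewrite /Rdiv Rmult_1_l.
  apply: is_lim_seq_div'; [exact: is_lim_seq_const | exact: stereo_factor_cont | lra].
Qed.

Definition flatten_sphere (z : suspension) : bspace :=
  match Req_dec_T (height z) (-1) with
  | left _ => bzero
  | right _ => invert (pull (stereo z))
  end.

Lemma south_sphere : pn ((-1, bzero) : dprod realn bnspace) = 1.
Proof.
  change (Rabs (-1) + nrm bzero = 1); rewrite nrm_bzero Rabs_Ropp Rabs_R1; ring.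
Qed.

Definition south : suspension := exist _ _ south_sphere.

Definition round_sphere (x : bspace) : suspension :=
  match Req_dec_T (nrm x) 0 with
  | left _ => south
  | right _ => unstereo (push (invert x))
  end.

Lemma round_flatten (z : suspension) : round_sphere (flatten_sphere z) = z.
Proof.
  have Hb := height_bounds z; rewrite /flatten_sphere; case: Req_dec_T => Hz.
  - rewrite /round_sphere nrm_bzero; case: Req_dec_T => // _.
    have E := suspension_eq z; rewrite Hz Rabs_Ropp Rabs_R1 in E.
    apply: suspension_ext; first by rewrite Hz.
    by rewrite (nrm_eq0 (girth z)) //; lra.
  - have Hp := nrm_pull_pos (stereo z).
    have Hi := Rinv_0_lt_compat _ Hp.
    rewrite /round_sphere nrm_invert //; case: Req_dec_T => [?|_]; first lra.
    rewrite invert_invert // push_pull unstereo_stereo //; lra.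
Qed.

Lemma flatten_round (x : bspace) : flatten_sphere (round_sphere x) = x.
Proof.
  have Hn := nrm_ge0 x; rewrite /round_sphere; case: Req_dec_T => Hx.
  - rewrite /flatten_sphere; case: Req_dec_T => [_|[]] //; by rewrite (nrm_eq0 x Hx).
  - have Hx' : 0 < nrm x by lra.
    rewrite /flatten_sphere; case: Req_dec_T => Hz.
      have [] := unheight_bounds _ (nrm_ge0 (push (invert x))).
      change (unheight (nrm (push (invert x))) = -1) in Hz; lra.
    rewrite stereo_unstereo pull_push ?invert_invert // nrm_invert //.
    exact: Rinv_0_lt_compat.
Qed.

Lemma bd_bzero (x : bspace) : bd x bzero = nrm x.
Proof. by rewrite /bd; f_equal; apply: b_ext => s; rewrite ev_lc ev_bzero; ring. Qed.

Lemma flatten_cont : @seq_cont suspension bnspace flatten_sphere.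
Proof.
  move=> u z Hu; have [H1 H2] := Hu.
  change (is_lim_seq (fun k => height (u k)) (height z)) in H1.
  change (is_lim_seq (fun k => bd (flatten_sphere (u k)) (flatten_sphere z)) 0).
  have Hb := height_bounds z; rewrite {2}/flatten_sphere; case: Req_dec_T => Hz.
  (* For [s < - 1/2] the projection has norm at least [1 + 1 / (1 + s)]; [pull] loses at most 1, so
     after inversion the norm is at most [1 + s], which tends to 0. *)
  - have [N HN] : exists N, forall n, (N <= n)%nat -> height (u n) < - / 2.
      move/lim_eps: H1 => /(_ (/ 2)) [|N HN]; first lra.
      exists N => n Hn; have /Rabs_def2 := HN n Hn; lra.
    have L : is_lim_seq (fun k => height (u k) + 1) 0.
      replace (Finite 0) with (Finite (height z + 1)) by (f_equal; lra).
      apply: is_lim_seq_plus' => //; exact: is_lim_seq_const.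
    apply: (lim_squeeze _ _ _ N _ L) => k Hk.
    have Hk2 := HN k Hk; have Hbk := height_bounds (u k).
    rewrite Rminus_0_r bd_bzero Rabs_pos_eq; last exact: nrm_ge0.
    rewrite /flatten_sphere; case: Req_dec_T => Hs; first by rewrite nrm_bzero; lra.
    have Hp := nrm_pull_pos (stereo (u k)).
    rewrite nrm_invert //; have := nrm_pull (stereo (u k)); rewrite nrm_stereo; last lra.
    set s := height (u k) in Hk2 Hbk Hs *.
    have -> : (1 - s) / (1 + s) - 1 = (- 2 * s) * / (1 + s) by field; lra.
    move=> H.
    have Hs1 : 0 < 1 + s by lra.
    have Hi := Rinv_0_lt_compat _ Hs1.
    have H' : / (1 + s) <= nrm (pull (stereo (u k))) by nra.
    have := Rinv_le_contravar _ _ Hi H'; rewrite Rinv_inv; lra.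
  - have Hz' : -1 < height z by lra.
    have [N HN] := lim_eventually_gt _ _ _ H1 Hz'.
    have L := invert_cont _ _ (nrm_pull_pos (stereo z)) (pull_cont _ _ (stereo_cont u z Hz' Hu)).
    apply: (is_lim_seq_ext_loc _ _ _ _ L); exists N => k Hk.
    rewrite /flatten_sphere; case: Req_dec_T => // E; have := HN k Hk; lra.
Qed.

Lemma round_cont : @seq_cont bnspace suspension round_sphere.
Proof.
  move=> u x Hu; change (is_lim_seq (fun k => bd (u k) x) 0) in Hu.
  have Hn := nrm_ge0 x; rewrite {2}/round_sphere; case: Req_dec_T => Hx.
  - have L : is_lim_seq (fun k => 2 * nrm (u k)) 0.
      by apply: lim_scal0; rewrite -Hx; exact: nrm_cont.
    (* The height above the pole is [2 / (1 + r)], where [r], the norm of [push (invert y)], is at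
       least [1 / nrm y - 1]. *)
    have Hh y : 0 <= height (round_sphere y) + 1 <= 2 * nrm y.
      have Hy := nrm_ge0 y; rewrite /round_sphere; case: Req_dec_T => E.
        by rewrite /height /= E; lra.
      have Hy' : 0 < nrm y by lra.
      change (0 <= unheight (nrm (push (invert y))) + 1 <= 2 * nrm y).
      have Hr := nrm_ge0 (push (invert y)).
      have H1 := nrm_push (invert y); rewrite nrm_invert // in H1.
      have -> : unheight (nrm (push (invert y))) + 1 = 2 * / (1 + nrm (push (invert y))).
        by rewrite /unheight; field; lra.
      have Hi := Rinv_0_lt_compat _ Hy'.
      have : / (1 + nrm (push (invert y))) <= / / nrm y by apply: Rinv_le_contravar; lra.
      rewrite Rinv_inv; have := Rinv_0_lt_compat (1 + nrm (push (invert y))) ltac:(lra); lra.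
    split.
    + apply: (lim_squeeze _ _ _ 0 _ L) => k _.
      change (Rabs (height (round_sphere (u k)) - -1) <= 2 * nrm (u k)).
      have := Hh (u k) => ?; rewrite Rabs_pos_eq; lra.
    + apply: (lim_squeeze _ _ _ 0 _ L) => k _.
      rewrite Rminus_0_r Rabs_pos_eq; last exact: nrm_ge0.
      change (bd (girth (round_sphere (u k))) bzero <= 2 * nrm (u k)).
      rewrite bd_bzero; have := suspension_eq (round_sphere (u k)).
      have := Hh (u k); have := Rle_abs (- height (round_sphere (u k))); rewrite Rabs_Ropp; lra.
  - have Hx' : 0 < nrm x by lra.
    have Hi : 0 < nrm (invert x) by rewrite nrm_invert //; exact: Rinv_0_lt_compat.
    have [N HN] := lim_eventually_gt _ _ _ (nrm_cont u x Hu) Hx'.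
    have [L1 L2] := unstereo_cont _ _ (push_cont _ _ Hi (invert_cont u x Hx' Hu)).
    have E k : (N <= k)%nat -> unstereo (push (invert (u k))) = round_sphere (u k).
      move=> Hk; rewrite /round_sphere; case: Req_dec_T => // E; have := HN k Hk; lra.
    split.
    + apply: (is_lim_seq_ext_loc _ _ _ _ L1); exists N => k Hk; by rewrite -E.
    + apply: (is_lim_seq_ext_loc _ _ _ _ L2); exists N => k Hk; by rewrite -E.
Qed.

Theorem suspension_homeo : homeo suspension bnspace.
Proof.
  exists flatten_sphere, round_sphere; split; [|split; [|split]].
  - exact: round_flatten.
  - exact: flatten_round.
  - exact: flatten_cont.
  - exact: round_cont.
Qed.

(** * Continuous surjections and the Hilbert space *)

Definition mspace {A : Type} (d : A -> A -> R) : cspace :=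
  CSpace A (fun u x => is_lim_seq (fun k => d x (u k)) 0).

Lemma metric_continuous_of_seq {A B : Type} (dA : A -> A -> R) (dB : B -> B -> R) (h : A -> B) :
  (forall a a', 0 <= dA a a') -> @seq_cont (mspace dA) (mspace dB) h -> metric_continuous dA dB h.
Proof.
  move=> HA Hh a eps He; apply: NNPP => Hn.
  have Hex (n : nat) : exists a', dA a a' < (/ 2) ^ n /\ ~ dB (h a) (h a') < eps.
    apply: NNPP => Hn'; apply: Hn; exists ((/ 2) ^ n); split; first exact: half_pow_pos.
    by move=> a' Ha'; apply: NNPP => Hb; apply: Hn'; exists a'.
  pose u n := proj1_sig (constructive_indefinite_description _ (Hex n)).
  have Hu n : dA a (u n) < (/ 2) ^ n /\ ~ dB (h a) (h (u n)) < eps.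
    exact: (proj2_sig (constructive_indefinite_description _ (Hex n))).
  have L : is_lim_seq (fun n => dA a (u n)) 0.
    apply: (lim_squeeze _ (fun n => 1 * (/ 2) ^ n) _ 0); last exact: lim_geom0.
    move=> n _; have [H _] := Hu n; rewrite Rminus_0_r Rabs_pos_eq //; lra.
  have /lim_eps /(_ eps He) [N HN] : is_lim_seq (fun n => dB (h a) (h (u n))) 0 by exact: Hh.
  have [_] := Hu N; apply; have /Rabs_def2 := HN N (Nat.le_refl N); lra.
Qed.

Lemma metric_homeomorphic_of_homeo {A B : Type} (dA : A -> A -> R) (dB : B -> B -> R) :
  (forall a a', 0 <= dA a a') -> (forall b b', 0 <= dB b b') ->
  homeo (mspace dA) (mspace dB) -> metric_homeomorphic dA dB.
Proof.
  move=> HA HB [f [g [H1 [H2 [H3 H4]]]]]; exists f, g; do !split => //;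
  exact: metric_continuous_of_seq.
Qed.

Definition toI (s : R) : I01 := exist _ (clamp s) (clamp_bounds s).

Lemma toI_ival (p : I01) : toI (ival p) = p.
Proof. by apply: sig_ext => /=; apply: clamp_id; exact: (proj2_sig p). Qed.

Lemma ival_bounds (p : I01) : 0 <= ival p <= 1.
Proof. exact: (proj2_sig p). Qed.

Lemma ival_inj (p q : I01) : ival p = ival q -> p = q.
Proof. exact: sig_ext. Qed.

Definition val (f : SI) (s : R) : R := ival (proj1_sig f (toI s)).

Lemma val_bounds (f : SI) (s : R) : 0 <= val f s <= 1.
Proof. exact: ival_bounds. Qed.

Lemma val_cont (f : SI) (s : R) : continuity_pt (val f) s.
Proof.
  apply/cont_eps => eps He; case: (proj2_sig f) => Hc _.
  have [d [Hd H]] := Hc (toI s) eps He.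
  exists d; split => // t Ht; apply: H; exact: Rle_lt_trans (clamp_lip _ _) Ht.
Qed.

Lemma val_surj (f : SI) (y : R) : 0 <= y <= 1 -> exists s, val f s = y.
Proof.
  move=> Hy; case: (proj2_sig f) => _ Hs; have [p Hp] := Hs (exist _ y Hy).
  by exists (ival p); rewrite /val toI_ival Hp.
Qed.

Lemma val_ext (f g : SI) : (forall s, val f s = val g s) -> f = g.
Proof.
  move=> H; apply: sig_ext; apply: functional_extensionality => p.
  apply: ival_inj; have := H (ival p); by rewrite /val toI_ival.
Qed.

Lemma base_based (f : SI) : based (fun s => val f s - val f 0).
Proof.
  split; [|split].
  - move=> s; apply: (continuity_pt_minus (val f) (fun _ => val f 0)); first exact: val_cont.
    by apply: continuity_pt_const.
  - move=> s; rewrite /val; do 3 f_equal; apply: ival_inj => /=; by rewrite clamp_idem.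
  - ring.
Qed.

Definition base (f : SI) : bspace := exist _ _ (base_based f).

Lemma ev_base (f : SI) (s : R) : ev (base f) s = val f s - val f 0.
Proof. by []. Qed.

Lemma nrm_base (f : SI) : nrm (base f) = 1.
Proof.
  apply: Rle_antisym.
  - apply: nrm_le => s t; rewrite !ev_base; have := val_bounds f s; have := val_bounds f t; lra.
  - have [s Hs] := val_surj f 1 ltac:(lra); have [t Ht] := val_surj f 0 ltac:(lra).
    have := nrm_diff (base f) s t; rewrite !ev_base Hs Ht.
    have := Rle_abs (1 - val f 0 - (0 - val f 0)); lra.
Qed.

(** Minus the minimum. For [x = f - f 0] with [f] onto [0,1] it recovers the subtracted value
    [f 0]. *)
Definition depth (x : bspace) : R := supr (fun s => - ev x s).

Lemma depth_ub (x : bspace) (s : R) : - ev x s <= depth x.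
Proof. by apply: (supr_ub (fun s => - ev x s)); case: (ev_bounded x). Qed.

Lemma depth_lip (x y : bspace) : Rabs (depth x - depth y) <= bd x y.
Proof.
  have H u v : depth u <= depth v + bd u v.
    apply: (supr_le _ 0) => s; have := depth_ub v s; have /Rabs_le_between := bd_ev u v s; lra.
  have := H x y; have := H y x.
  have -> : bd y x = bd x y by exact: sn_sub_sym nrm_lc _ _.
  move=> ? ?; apply: Rabs_le; lra.
Qed.

Lemma lift_bounds (x : bspace) (s : R) : 0 <= ev x s + depth x <= nrm x.
Proof.
  have := depth_ub x s; have H : ev x s <= supr (ev x) by apply: supr_ub; case: (ev_bounded x).
  rewrite /nrm /osc -/(depth x); lra.
Qed.

Definition lift_fun (x : bspace) (Hx : nrm x = 1) (p : I01) : I01.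
Proof.
  refine (exist _ (ev x (ival p) + depth x) _).
  by rewrite -Hx; exact: lift_bounds.
Defined.

Lemma ival_lift (x : bspace) (Hx : nrm x = 1) (p : I01) :
  ival (lift_fun x Hx p) = ev x (ival p) + depth x.
Proof. by []. Qed.

Lemma lift_spec (x : bspace) (Hx : nrm x = 1) :
  I_continuous (lift_fun x Hx) /\ I_surjective (lift_fun x Hx).
Proof.
  split.
  - move=> p eps He; have [d [Hd H]] := proj2 (cont_eps (ev x) (ival p)) (ev_cont x _) eps He.
    exists d; split => // q Hq; rewrite !ival_lift.
    have -> : ev x (ival q) + depth x - (ev x (ival p) + depth x) = ev x (ival q) - ev x (ival p) by ring.
    exact: H.
  - move=> y; have Hy := ival_bounds y.
    have [M [HM HM01]] := continuity_ab_maj (ev x) 0 1 ltac:(lra) (fun c _ => ev_cont x c).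
    have [m [Hm Hm01]] := continuity_ab_min (ev x) 0 1 ltac:(lra) (fun c _ => ev_cont x c).
    have Ed : depth x = - ev x m.
      apply: Rle_antisym; last exact: depth_ub.
      apply: (supr_le _ 0) => s; rewrite (ev_clamp x s).
      have := Hm (clamp s) (clamp_bounds s); lra.
    have Es : supr (ev x) = ev x M.
      apply: Rle_antisym; last by apply: supr_ub; case: (ev_bounded x).
      apply: (supr_le _ 0) => s; rewrite (ev_clamp x s); exact: HM (clamp_bounds s).
    have E1 : ev x M - ev x m = 1 by rewrite -Hx /nrm /osc -/(depth x) Ed Es; ring.
    (* The shifted function is 0 at the minimum [m] and 1 at the maximum [M], and takes every value
       between, whichever point comes first. *)
    have [||s [_ Hs]] := IVT_gen (ev x) m M (ival y - depth x).
    + exact: ev_cont.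
    + have Hle : ev x m <= ev x M by lra.
      rewrite Rmin_left // Rmax_right // Ed; lra.
    exists (toI s); apply: ival_inj; rewrite ival_lift /= -ev_clamp Hs; ring.
Qed.

Definition lift (x : sphere bnspace) : SI := exist _ _ (lift_spec (proj1_sig x) (proj2_sig x)).

Lemma val_lift (x : sphere bnspace) (s : R) :
  val (lift x) s = ev (proj1_sig x) s + depth (proj1_sig x).
Proof.
  change (ev (proj1_sig x) (clamp s) + depth (proj1_sig x) = ev (proj1_sig x) s + depth (proj1_sig x)).
  by rewrite -ev_clamp.
Qed.

Lemma depth_base (f : SI) : depth (base f) = val f 0.
Proof.
  apply: Rle_antisym.
  - apply: (supr_le _ 0) => s; rewrite ev_base; have := val_bounds f s; lra.
  - have [s Hs] := val_surj f 0 ltac:(lra); have := depth_ub (base f) s; rewrite ev_base Hs; lra.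
Qed.

Lemma sup_dist_bounded (f g : SI) :
  bounded_above (fun p : I01 => Rabs (ival (proj1_sig f p) - ival (proj1_sig g p))).
Proof.
  exists 1 => p; have := ival_bounds (proj1_sig f p); have := ival_bounds (proj1_sig g p) => ? ?.
  apply: Rabs_le; lra.
Qed.

Lemma sup_dist_val (f g : SI) (s : R) : Rabs (val f s - val g s) <= sup_dist f g.
Proof. exact: (supr_ub _ (sup_dist_bounded f g) (toI s)). Qed.

Lemma sup_dist_le (f g : SI) (e : R) :
  (forall s, Rabs (val f s - val g s) <= e) -> sup_dist f g <= e.
Proof.
  move=> H; apply: (supr_le _ (toI 0)) => p; rewrite -(toI_ival p); exact: H.
Qed.

Lemma sup_dist_ge0 (f g : SI) : 0 <= sup_dist f g.
Proof. exact: Rle_trans (Rabs_pos _) (sup_dist_val f g 0). Qed.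

Lemma SI_homeo_sphere : homeo (mspace sup_dist) (sphere bnspace).
Proof.
  exists (fun f => exist _ (base f : bnspace) (nrm_base f) : sphere bnspace).
  exists (lift : sphere bnspace -> mspace sup_dist).
  split; [|split; [|split]].
  - move=> f; apply: val_ext => s; rewrite val_lift /= ev_base depth_base; ring.
  - move=> x; apply: sig_ext; apply: b_ext => s; rewrite [proj1_sig (exist _ _ _)]/= ev_base !val_lift.
    rewrite ev0; ring.
  - move=> u f H.
    apply: (lim_squeeze _ (fun k => 2 * sup_dist f (u k)) _ 0); last exact: lim_scal0.
    move=> k _; rewrite Rminus_0_r Rabs_pos_eq; last exact: nrm_ge0.
    apply: nrm_le => s t; rewrite !ev_lc /= !ev_base.
    have /Rabs_le_between := sup_dist_val f (u k) s; have /Rabs_le_between := sup_dist_val f (u k) t; lra.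
  - move=> u x H; change (is_lim_seq (fun k => bd (proj1_sig (u k)) (proj1_sig x)) 0) in H.
    apply: (lim_squeeze _ (fun k => 2 * bd (proj1_sig (u k)) (proj1_sig x)) _ 0); last exact: lim_scal0.
    move=> k _; rewrite Rminus_0_r Rabs_pos_eq; last exact: sup_dist_ge0.
    apply: sup_dist_le => s; rewrite !val_lift.
    have /Rabs_le_between := bd_ev (proj1_sig (u k)) (proj1_sig x) s.
    have /Rabs_le_between := depth_lip (proj1_sig (u k)) (proj1_sig x).
    move=> ? ?; apply: Rabs_le; lra.
Qed.

(* The signed square root: [sqrt] vanishes on negative numbers. *)
Definition ssqrt (r : R) : R := sqrt r - sqrt (- r).
Definition ssqr (r : R) : R := r * Rabs r.

Lemma ssqrt_pos (r : R) : 0 <= r -> ssqrt r = sqrt r.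
Proof. move=> H; rewrite /ssqrt (sqrt_neg_0 (- r)); lra. Qed.

Lemma ssqrt_neg (r : R) : r <= 0 -> ssqrt r = - sqrt (- r).
Proof. move=> H; rewrite /ssqrt (sqrt_neg_0 r); lra. Qed.

Lemma ssqrt_ssqr (r : R) : ssqrt (ssqr r) = r.
Proof.
  rewrite /ssqr; case: (Rle_dec 0 r) => H.
  - rewrite Rabs_pos_eq // ssqrt_pos; [exact: sqrt_square | nra].
  - rewrite Rabs_left; last lra.
    rewrite ssqrt_neg; last nra.
    have -> : - (r * - r) = (- r) * (- r) by ring.
    rewrite sqrt_square; lra.
Qed.

Lemma ssqrt_sqr (r : R) : ssqrt r ^ 2 = Rabs r.
Proof.
  case: (Rle_dec 0 r) => H.
  - rewrite ssqrt_pos // Rabs_pos_eq // pow2_sqrt //.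
  - rewrite ssqrt_neg; last lra.
    rewrite Rabs_left; last lra.
    have -> : (- sqrt (- r)) ^ 2 = sqrt (- r) ^ 2 by ring.
    rewrite pow2_sqrt; lra.
Qed.

Lemma ssqr_ssqrt (r : R) : ssqr (ssqrt r) = r.
Proof.
  rewrite /ssqr; case: (Rle_dec 0 r) => H.
  - rewrite ssqrt_pos // Rabs_pos_eq; [exact: sqrt_sqrt | exact: sqrt_pos].
  - rewrite ssqrt_neg; last lra.
    rewrite Rabs_Ropp Rabs_pos_eq; last exact: sqrt_pos.
    have := sqrt_sqrt (- r) ltac:(lra); lra.
Qed.

Lemma ssqr_abs (r : R) : Rabs (ssqr r) = r ^ 2.
Proof.
  rewrite /ssqr Rabs_mult Rabs_Rabsolu -Rabs_mult Rabs_pos_eq; [ring | nra].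
Qed.

Lemma ssqrt_cont (r : R) : continuity_pt ssqrt r.
Proof.
  apply: (continuity_pt_minus sqrt (fun r => sqrt (- r))).
  - apply/continuity_pt_filterlim; exact: continuous_sqrt.
  - apply: (cont_comp Ropp sqrt); last by apply/continuity_pt_filterlim; exact: continuous_sqrt.
    apply: continuity_pt_opp; exact: continuity_pt_id.
Qed.

Lemma ssqr_cont (r : R) : continuity_pt ssqr r.
Proof.
  apply: (continuity_pt_mult (fun r => r) Rabs); first exact: continuity_pt_id.
  exact: Rcontinuity_abs.
Qed.

Lemma sqr_diff_bound (x y : R) : 0 <= (x - y) ^ 2 <= 2 * x ^ 2 + 2 * y ^ 2.
Proof. split; [exact: pow2_ge_0 | have := pow2_ge_0 (x + y); lra]. Qed.

Definition lf (x : l2) (n : nat) : R := proj1_sig x n.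

Lemma l2_sqr (x : l2) : ex_series (fun n => lf x n ^ 2).
Proof. exact: (proj2_sig x). Qed.

Lemma l2_diff_dom (x y : l2) : ex_series (fun n => 2 * lf x n ^ 2 + 2 * lf y n ^ 2).
Proof.
  apply: (ex_series_plus (fun n => 2 * lf x n ^ 2) (fun n => 2 * lf y n ^ 2)).
  - exact: (ex_series_scal_l 2 _ (l2_sqr x)).
  - exact: (ex_series_scal_l 2 _ (l2_sqr y)).
Qed.

Lemma l2_diff (x y : l2) : ex_series (fun n => (lf x n - lf y n) ^ 2).
Proof.
  apply: ex_series_le_pos (l2_diff_dom x y) => n; exact: sqr_diff_bound.
Qed.

Lemma l2_dist_sqr (x y : l2) : Series (fun n => (lf x n - lf y n) ^ 2) = l2_dist x y * l2_dist x y.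
Proof.
  rewrite /l2_dist sqrt_sqrt //; apply: series_pos_ge0 (l2_diff x y) => n; exact: pow2_ge_0.
Qed.

Lemma l1_to_l2_ex (a : l1) : ex_series (fun n => ssqrt (cf a n) ^ 2).
Proof. by apply: (ex_series_eq (fun n => Rabs (cf a n)) _ _ (l1_abs a)) => n; rewrite ssqrt_sqr. Qed.

Lemma l2_to_l1_ex (x : l2) : ex_series (fun n => Rabs (ssqr (lf x n))).
Proof. by apply: (ex_series_eq (fun n => lf x n ^ 2) _ _ (l2_sqr x)) => n; rewrite ssqr_abs. Qed.

Definition l1_to_l2 (a : l1) : l2 := exist _ (fun n => ssqrt (cf a n)) (l1_to_l2_ex a).
Definition l2_to_l1 (x : l2) : l1 := exist _ (fun n => ssqr (lf x n) : realn) (l2_to_l1_ex x).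

(** This is the Mazur map. The squared differences tend to 0 termwise and are dominated by
    [2 |a_n| + 2 |u_n|], whose sums converge because the l1 norms do. *)
Lemma l1_to_l2_cont : @seq_cont l1 (mspace l2_dist) l1_to_l2.
Proof.
  move=> u a Hu; have Hp := pn_cont _ _ Hu; case: Hu => Hc _.
  have [] := series_pratt (fun k n => (ssqrt (cf a n) - ssqrt (cf (u k) n)) ^ 2)
    (fun k n => 2 * Rabs (cf a n) + 2 * Rabs (cf (u k) n)) (fun _ => 0)
    (fun n => 2 * Rabs (cf a n) + 2 * Rabs (cf a n)).
  - move=> k n; rewrite -!ssqrt_sqr; exact: sqr_diff_bound.
  - move=> k; apply: (ex_series_plus (fun n => 2 * Rabs (cf a n)) (fun n => 2 * Rabs (cf (u k) n))).
    + exact: (ex_series_scal_l 2 _ (l1_abs a)).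
    + exact: (ex_series_scal_l 2 _ (l1_abs (u k))).
  - apply: (ex_series_plus (fun n => 2 * Rabs (cf a n)) (fun n => 2 * Rabs (cf a n)));
    exact: (ex_series_scal_l 2 _ (l1_abs a)).
  - move=> n; have L := is_lim_seq_continuous _ _ _ (ssqrt_cont (cf a n)) (Hc n).
    have L2 : is_lim_seq (fun k => ssqrt (cf a n) - ssqrt (cf (u k) n)) 0.
      replace (Finite 0) with (Finite (ssqrt (cf a n) - ssqrt (cf a n))) by (f_equal; ring).
      apply: is_lim_seq_minus'; [exact: is_lim_seq_const | exact: L].
    apply: (is_lim_seq_ext (fun k => (ssqrt (cf a n) - ssqrt (cf (u k) n)) * (ssqrt (cf a n) - ssqrt (cf (u k) n)))).
      by move=> k; ring.
    replace (Finite 0) with (Finite (0 * 0)) by (f_equal; ring).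
    exact: is_lim_seq_mult'.
  - move=> n; apply: is_lim_seq_plus'; first exact: is_lim_seq_const.
    exact: (is_lim_seq_scal_l _ 2 (Finite _) (is_lim_seq_abs _ _ (Hc n))).
  - have E (b : l1) : Series (fun n => 2 * Rabs (cf a n) + 2 * Rabs (cf b n)) = 2 * pn a + 2 * pn b.
      rewrite !pn_l1 -!Series_scal_l Series_plus //.
      + exact: (ex_series_scal_l 2 _ (l1_abs a)).
      + exact: (ex_series_scal_l 2 _ (l1_abs b)).
    rewrite E; apply: (is_lim_seq_ext (fun k => 2 * pn a + 2 * pn (u k))); first by move=> k; rewrite E.
    apply: is_lim_seq_plus'; first exact: is_lim_seq_const.
    exact: (is_lim_seq_scal_l _ 2 (Finite _) Hp).
  move=> _; rewrite series_const0 => L.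
  have := is_lim_seq_continuous sqrt _ _ _ L; rewrite sqrt_0; apply.
  apply/continuity_pt_filterlim; exact: continuous_sqrt.
Qed.

Lemma l2_to_l1_cont : @seq_cont (mspace l2_dist) l1 l2_to_l1.
Proof.
  move=> u x Hu; change (is_lim_seq (fun k => l2_dist x (u k)) 0) in Hu.
  have L2 : is_lim_seq (fun k => Series (fun n => (lf x n - lf (u k) n) ^ 2)) 0.
    apply: (is_lim_seq_ext (fun k => l2_dist x (u k) * l2_dist x (u k))).
      by move=> k; rewrite l2_dist_sqr.
    replace (Finite 0) with (Finite (0 * 0)) by (f_equal; ring).
    exact: is_lim_seq_mult'.
  have Hsq n : is_lim_seq (fun k => (lf x n - lf (u k) n) ^ 2) 0.
    apply: (lim_squeeze _ _ _ 0 _ L2) => k _; rewrite Rminus_0_r Rabs_pos_eq; last exact: pow2_ge_0.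
    apply: (series_pos_term (fun n => (lf x n - lf (u k) n) ^ 2)); last exact: l2_diff.
    move=> m; exact: pow2_ge_0.
  have Hc n : is_lim_seq (fun k => lf (u k) n) (lf x n).
    apply/lim_eps => eps He; have He2 : 0 < eps * eps by nra.
    move/lim_eps: (Hsq n) => /(_ _ He2) [N HN]; exists N => k Hk.
    have := HN k Hk; rewrite Rminus_0_r Rabs_pos_eq; last exact: pow2_ge_0.
    move=> H; apply: Rabs_def1; nra.
  apply/cv_l1.
  (* The bound [u^2 + x^2 <= 2 (x - u)^2 + 3 x^2] amounts to [(2 x - u)^2 >= 0]. It makes the sums
     of the dominating series converge directly from the l2 distance. *)
  have [] := series_pratt (fun k n => Rabs (ssqr (lf (u k) n) - ssqr (lf x n)))
    (fun k n => 2 * (lf x n - lf (u k) n) ^ 2 + 3 * lf x n ^ 2) (fun _ => 0)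
    (fun n => 3 * lf x n ^ 2).
  - move=> k n; split; first exact: Rabs_pos.
    apply: Rle_trans (Rabs_triang _ _) _; rewrite Rabs_Ropp !ssqr_abs.
    have := pow2_ge_0 (2 * lf x n - lf (u k) n); lra.
  - move=> k; apply: (ex_series_plus (fun n => 2 * (lf x n - lf (u k) n) ^ 2) (fun n => 3 * lf x n ^ 2)).
    + exact: (ex_series_scal_l 2 _ (l2_diff x (u k))).
    + exact: (ex_series_scal_l 3 _ (l2_sqr x)).
  - exact: (ex_series_scal_l 3 _ (l2_sqr x)).
  - move=> n; have L := is_lim_seq_continuous _ _ _ (ssqr_cont (lf x n)) (Hc n).
    exact: (proj1 (lim_dist _ _) L).
  - move=> n; rewrite -{2}(Rplus_0_l (3 * lf x n ^ 2)); apply: is_lim_seq_plus'; last exact: is_lim_seq_const.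
    exact: lim_scal0.
  - rewrite -(Rplus_0_l (Series (fun n => 3 * lf x n ^ 2))).
    apply: (is_lim_seq_ext (fun k => 2 * Series (fun n => (lf x n - lf (u k) n) ^ 2) + Series (fun n => 3 * lf x n ^ 2))).
      move=> k; rewrite Series_plus.
      + by rewrite (Series_scal_l 2).
      + exact: (ex_series_scal_l 2 _ (l2_diff x (u k))).
      + exact: (ex_series_scal_l 3 _ (l2_sqr x)).
    apply: is_lim_seq_plus'; [exact: lim_scal0 | exact: is_lim_seq_const].
  move=> _; rewrite series_const0; apply: is_lim_seq_ext => k.
  rewrite /l1d pn_l1; apply: Series_ext => n; rewrite cf_lc; f_equal.
  rewrite /cf /=; ring.
Qed.

Lemma l1_homeo_l2 : homeo l1 (mspace l2_dist).
Proof.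
  exists l1_to_l2, l2_to_l1; split; [|split; [|split]].
  - move=> a; apply: l1_ext => n; exact: ssqr_ssqrt.
  - move=> x; apply: sig_ext; apply: functional_extensionality => n; exact: ssqrt_ssqr.
  - exact: l1_to_l2_cont.
  - exact: l2_to_l1_cont.
Qed.

Lemma l2_dist_ge0 (x y : l2) : 0 <= l2_dist x y.
Proof. exact: sqrt_pos. Qed.

Theorem theorem5 : metric_homeomorphic sup_dist l2_dist.
Proof.
  apply: metric_homeomorphic_of_homeo; [exact: sup_dist_ge0 | exact: l2_dist_ge0 |].
  apply: homeo_trans SI_homeo_sphere _.
  have E : iso bnspace (dprod realn bnspace).
    apply: (iso_trans _ _ _ iso_b_l1).
    apply: (iso_trans _ _ _ (iso_sym _ _ (iso_dsum_cons realn))).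
    apply: iso_dprod; [exact: iso_refl | exact: (iso_sym _ _ iso_b_l1)].
  apply: (homeo_trans _ _ _ (iso_sphere _ _ E)).
  apply: (homeo_trans _ _ _ suspension_homeo).
  exact: (homeo_trans _ _ _ (iso_homeo _ _ iso_b_l1) l1_homeo_l2).
Qed.
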